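(* Consider the time-invariant game $\Gamma$ described in the context. Let the Graph Assumption, the Game Assumption, the Lipschitz Assumption, and parts (i) and (iii) of the Oracle Assumption (all stated in the context) hold, and suppose the pseudo-gradient $G$ is strictly monotone: $\langle G(x)-G(x'),x-x'\rangle>0$ for all $x,x'\in X_1\times\cdots\times X_N$ with $x\neq x'$. If $\alpha_t,\beta_t,\gamma_t$ are selected such that $\alpha_t=\gamma_t$ and $$\sum_{t=1}^\infty\alpha_t=\infty,\quad \sum_{t=1}^\infty\alpha_t^2<\infty,\quad \sum_{t=1}^\infty\frac{\alpha_t^2}{\beta_t^2}<\infty,\quad \sum_{t=1}^\infty\alpha_t\beta_t<\infty,\quad \sum_{t=1}^\infty\frac{\alpha_t^2}{\beta_t}<\infty,$$ then the sequence $\{x_t\}$ generated by the algorithm in the context converges almost surely to the variational generalized Nash equilibrium (vGNE) of $\Gamma$.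
   Context: Game. There are $N$ players, $[N]=\{1,\dots,N\}$. Player $i$ has a local set $X_i\subseteq\mathbb{R}^{d_i}$; $d=\sum_i d_i$; $x=\mathrm{col}\{x_i\}_{i\in[N]}\in\mathbb{R}^d$ is the stacked vector, $x_{-i}$ is $x$ without block $i$. Given $\psi_i:\mathbb{R}^{d_i}\to\mathbb{R}^n$, put $\sigma(x)=\frac1N\sum_{i=1}^N\psi_i(x_i)$ and $\sigma(x_{-i})=\frac1N\sum_{j\ne i}\psi_j(x_j)$. Player $i$ has a (time-invariant) cost $f_i(x_i,\sigma)=\mathbb{E}[F_i(x_i,\sigma,\xi_i)]$, where $\xi_i$ is a random vector in $\mathbb{R}^{q_i}$ and $F_i:\mathbb{R}^{d_i}\times\mathbb{R}^n\times\mathbb{R}^{q_i}\to\mathbb{R}$ is differentiable in $(x_i,\sigma)\in X_i\times\mathbb{R}^n$ for each fixed value of $\xi_i$, and a (time-invariant) constraint function $g_i:\mathbb{R}^{d_i}\to\mathbb{R}^m$ with components $g_{ij}$. Put $g(x)=\sum_{i=1}^N g_i(x_i)$ and $X=(X_1\times\cdots\times X_N)\cap\{x: g(x)\le \mathbf 0\}$. $\nabla_1,\nabla_2$ denote (column) gradients with respect to the first and second arguments; $\nabla\psi_i(x_i)\in\mathbb{R}^{d_i\times n}$ is the transposed Jacobian; $\nabla g_i=(\nabla g_{i1},\dots,\nabla g_{im})\in\mathbb{R}^{d_i\times m}$. Define $p_i(x_i,y)=\nabla_1 f_i(x_i,y)+\frac{\nabla\psi_i(x_i)}{N}\nabla_2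 f_i(x_i,y)$ and $q_i(x_i,y,\xi)=\nabla_1F_i(x_i,y,\xi)+\frac{\nabla\psi_i(x_i)}{N}\nabla_2F_i(x_i,y,\xi)$. The pseudo-gradient is $G(x)=\mathrm{col}\{p_i(x_i,\sigma(x))\}_{i\in[N]}$. At each $t\ge0$ player $i$ draws a sample $\xi_{i,t}$ of $\xi_i$. Filtration: $\mathcal{F}_0$ is trivial and $\mathcal{F}_t$ is the $\sigma$-algebra generated by $\{\xi_{i,s}: i\in[N],0\le s\le t-1\}$ for $t\ge1$. $\|\cdot\|$ is the Euclidean norm, $\Pi_X$ the Euclidean projection onto $X$, $[\cdot]_+$ the projection onto the nonnegative orthant. Equilibria. $x^*\in X$ is a GNE of $\Gamma$ if for each $i$, $x_i^*$ minimizes $f_i\big(x_i,\frac1N\psi_i(x_i)+\sigma(x_{-i}^* )\big)$ over $x_i\in X_i$ subject to $g_i(x_i)+\sum_{j\neq i}g_j(x_j^* )\le\mathbf 0$. A vGNE is a GNE for which the KKT conditions hold with a common multiplier $\mu^*\in\mathbb{R}^m_+$ for all players: $\mathbf 0\in p_i(x_i^*,\sigma(x^* ))+\nabla g_i(x_i^* )\mu^*+\mathbf{N}_{X_i}(x_i^* )$ for all $i\in[N]$ and $\mathbf 0\in -g(x^* )+\mathbf{N}_{\mathbb{R}^m_+}(\mu^* )$, where $\mathbf{N}_C(x)=\{s:s^{\top}(y-x)\le0\ \forall y\in C\}$. Under the assumptions of the claim the vGNE exists and is unique. Algorithm. $\mathcal{W}_t=[w_{ij,t}]\in\mathbb{R}^{N\times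 N}$ is the weighted adjacency matrix of the directed graph $\mathcal{G}_t=([N],\mathcal{E}_t)$: $w_{ij,t}>0$ if $(j,i)\in\mathcal{E}_t$, $w_{ij,t}=0$ otherwise, and $w_{ii,t}>0$. The parameters $\alpha_t,\beta_t,\gamma_t\in(0,1]$ are non-increasing in $t$. Initialize $z_{i,0}=1$, $x_{i,0}\in X_i$, $\mu_{i,0}=\mathbf 0\in\mathbb{R}^m$, $\sigma_{i,0}=\psi_i(x_{i,0})$, and for $t\ge0$: $z_{i,t+1}=\sum_j w_{ij,t}z_{j,t}$; $\hat\mu_{i,t}=\sum_j w_{ij,t}\mu_{j,t}$; $\hat\sigma_{i,t}=\sum_j w_{ij,t}\sigma_{j,t}$; $s_{i,t+1}=q_i\big(x_{i,t},\hat\sigma_{i,t}/z_{i,t+1},\xi_{i,t}\big)+\nabla g_i(x_{i,t})\,\hat\mu_{i,t}/z_{i,t+1}$; $x_{i,t+1}=\Pi_{X_i}[x_{i,t}-\alpha_t s_{i,t+1}]$; $\mu_{i,t+1}=[\hat\mu_{i,t}+\gamma_t(g_i(x_{i,t})-\beta_t\hat\mu_{i,t})]_+$; $\sigma_{i,t+1}=\hat\sigma_{i,t}+\psi_i(x_{i,t+1})-\psi_i(x_{i,t})$. Write $x_t=\mathrm{col}\{x_{i,t}\}_{i\in[N]}$. Graph Assumption. For all $t\ge0$: (i) there is a constant $\underline w\in(0,1)$ with $w_{ij,t}\ge\underline w$ whenever $w_{ij,t}>0$; (ii) $\mathcal{W}_t$ is column-stochastic, $\sum_i w_{ij,t}=1$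 for all $j$; (iii) there is an integer $U>0$ such that the graph $([N],\bigcup_{l=0}^{U-1}\mathcal{E}_{t+l})$ is strongly connected for all $t$. Game Assumption. (i) Each $X_i$ is nonempty, convex, compact. (ii) $X$ is nonempty and satisfies Slater's constraint qualification. (iii) For all $i$, $f_i(x_i,\sigma)$ is differentiable in $(x_i,\sigma)\in X_i\times\mathbb{R}^n$ and $x_i\mapsto f_i(x_i,\sigma(x))$ is convex on $X_i$ for any given $x_{-i}\in\mathbb{R}^{d-d_i}$. (iv) Each $g_{ij}$ is differentiable and convex on $X_i$. (v) Each $\psi_i$ is differentiable and $L_\sigma$-Lipschitz on $X_i$ ($L_\sigma>0$). There are constants $L,M>0$ such that $\|x_i\|\le L$, $\|g_i(x_i)\|\le L$, $\|\nabla g_i(x_i)\|\le M$ for all $i\in[N]$, $x_i\in X_i$. Lipschitz Assumption. For all $i\in[N]$ and $x_i\in X_i$, $y\mapsto p_i(x_i,y)$ is $L_f$-Lipschitz on $\mathbb{R}^n$ ($L_f>0$). Oracle Assumption. For all $t\ge0$, $i\in[N]$ and all $\mathcal{F}_t$-measurable $x_i\in X_i$, $y\in\mathbb{R}^n$: (i) $\mathbb{E}[q_i(x_i,y,\xi_{i,t})\mid\mathcal{F}_t]=p_i(x_i,y)$; (ii) $\mathbb{E}[\exp(\|q_i(x_i,y,\xi_{i,t})-p_i(x_i,y)\|^2/\iota^2)\mid\mathcal{F}_t]\le\exp(1)$ for some constant $\iota>0$; (iii) $\|q_i(x_i,y,\xi_{i,t})\|\le S$ for some constant $S>0$. *)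

(* Defs.v *)
(* Vectors of R^k are row vectors 'rV[R]_k, for
   which the library's Jacobian 'J f x : 'M_(k, l) is the transposed Jacobian
   of the column-vector convention; products such as (nabla psi) v are thus
   written v *m ('J psi x)^T. *)
From HB Require Import structures.
From mathcomp Require Import all_boot all_order all_algebra.
From mathcomp Require Import all_classical all_reals all_analysis.
Import Order.TTheory GRing.Theory Num.Theory.
Import numFieldNormedType.Exports.

Set Implicit Arguments.
Unset Strict Implicit.
Unset Printing Implicit Defensive.

Local Open Scope classical_set_scope.
Local Open Scope ring_scope.

(* Euclidean norm of a vector (the library norm is the sup norm); Frobenius norm
   of a matrix with several rows. *)
Definition enorm {R : realType} {k l : nat} (A : 'M[R]_(k, l)) : R :=
  Num.sqrt (\sum_i \sum_j A i j ^+ 2).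

Definition dot {R : realType} {k : nat} (u v : 'rV[R]_k) : R :=
  \sum_j u 0 j * v 0 j.

Definition grad {R : realType} {k : nat} (h : 'rV[R]_k -> R) (x : 'rV[R]_k) :
  'rV[R]_k := \row_j 'd h x (delta_mx 0 j).

(* The default value 0 is irrelevant when C is nonempty, closed and convex. *)
Definition eproj {R : realType} {k : nat} (C : set 'rV[R]_k) (v : 'rV[R]_k) :
  'rV[R]_k :=
  xget 0 [set y | C y /\ forall z, C z -> enorm (v - y) <= enorm (v - z)].

Definition normal_cone {R : realType} {k : nat} (C : set 'rV[R]_k)
  (x : 'rV[R]_k) : set 'rV[R]_k := [set s | forall y, C y -> dot s (y - x) <= 0].

Definition orthant {R : realType} {k : nat} : set 'rV[R]_k :=
  [set v | forall j, 0 <= v 0 j].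

Definition borel (T : topologicalType) : set (set T) := <<s [set A : set T | open A] >>.

Definition measurable_wrt {Omega : Type} {T : topologicalType}
  (F : set (set Omega)) (Y : Omega -> T) : Prop :=
  forall B, borel B -> F (Y @^-1` B).

(* Z is a version of the conditional expectation of Y given the sub-sigma-algebra F. *)
Definition is_cond_exp {R : realType} {d : measure_display}
  {Omega : measurableType d} (P : probability Omega R)
  (F : set (set Omega)) (Y Z : Omega -> R) : Prop :=
  [/\ P.-integrable setT (EFin \o Y),
      P.-integrable setT (EFin \o Z),
      measurable_wrt F Z &
      forall A, F A ->
        (\int[P]_(w in A) (Y w)%:E = \int[P]_(w in A) (Z w)%:E)%E].

Unset Implicit Arguments.

Record aggGame (R : realType) (d : measure_display) (Omega : measurableType d)
    (P : probability Omega R) (N n m : nat) := AggGame {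
  dim : 'I_N -> nat;
  ndim : 'I_N -> nat;
  strat : forall i, set 'rV[R]_(dim i);
  agg : forall i, 'rV[R]_(dim i) -> 'rV[R]_n; (* psi_i *)
  rcost : forall i, 'rV[R]_(dim i) -> 'rV[R]_n -> 'rV[R]_(ndim i) -> R; (* F_i *)
  constr : forall i, 'rV[R]_(dim i) -> 'rV[R]_m; (* g_i *)
  noise : forall i, Omega -> 'rV[R]_(ndim i) (* xi_i *)
}.

Arguments aggGame {R d Omega} P N n m.
Arguments dim {R d Omega P N n m} G i : rename.
Arguments ndim {R d Omega P N n m} G i : rename.
Arguments strat {R d Omega P N n m} G i : rename.
Arguments agg {R d Omega P N n m} G i _ : rename.
Arguments rcost {R d Omega P N n m} G i _ _ _ : rename.
Arguments constr {R d Omega P N n m} G i _ : rename.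
Arguments noise {R d Omega P N n m} G i _ : rename.

Section Game.
Context {R : realType} {d : measure_display} {Omega : measurableType d}
  {P : probability Omega R} {N n m : nat} (G : aggGame P N n m).

Definition profile := forall i : 'I_N, 'rV[R]_(dim G i).

Definition stack (x : profile) : 'rV[R]_(\sum_i dim G i) := mxrow x.

Definition strats (x : profile) : Prop := forall i, strat G i (x i).

Definition sigma (x : profile) : 'rV[R]_n := N%:R^-1 *: \sum_i agg G i (x i).

Definition sigma_others (i : 'I_N) (x : profile) : 'rV[R]_n :=
  N%:R^-1 *: \sum_(j | j != i) agg G j (x j).

Definition cost (i : 'I_N) (a : 'rV[R]_(dim G i)) (y : 'rV[R]_n) : R :=
  fine ('E_P[fun w => rcost G i a y (noise G i w)])%E.

Definition own_cost (i : 'I_N) (x : profile) (a : 'rV[R]_(dim G i)) : R :=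
  cost i a (N%:R^-1 *: agg G i a + sigma_others i x).

Definition agg_grad (i : 'I_N) (h : 'rV[R]_(dim G i) -> 'rV[R]_n -> R)
    (a : 'rV[R]_(dim G i)) (y : 'rV[R]_n) : 'rV[R]_(dim G i) :=
  grad (h^~ y) a + N%:R^-1 *: (grad (h a) y *m ('J (agg G i) a)^T).

Definition pgrad (i : 'I_N) : 'rV[R]_(dim G i) -> 'rV[R]_n -> 'rV[R]_(dim G i) :=
  agg_grad i (cost i).

Definition qgrad (i : 'I_N) (a : 'rV[R]_(dim G i)) (y : 'rV[R]_n)
    (u : 'rV[R]_(ndim G i)) : 'rV[R]_(dim G i) :=
  agg_grad i (fun a y => rcost G i a y u) a y.

Definition pseudo_grad (x : profile) : 'rV[R]_(\sum_i dim G i) :=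
  mxrow (fun i => pgrad i (x i) (sigma x)).

Definition constr_grad (i : 'I_N) (a : 'rV[R]_(dim G i)) : 'M[R]_(dim G i, m) :=
  'J (constr G i) a.

Definition constr_sum (x : profile) : 'rV[R]_m := \sum_i constr G i (x i).

Definition feasible (x : profile) : Prop :=
  strats x /\ forall k, constr_sum x 0 k <= 0.

Definition is_GNE (xs : profile) : Prop :=
  feasible xs /\
  forall i (a : 'rV[R]_(dim G i)), strat G i a ->
    (forall k, (constr G i a + \sum_(j | j != i) constr G j (xs j)) 0 k <= 0) ->
    own_cost i xs (xs i) <= own_cost i xs a.

Definition is_vGNE (xs : profile) : Prop :=
  is_GNE xs /\
  exists mu : 'rV[R]_m, [/\ orthant mu,
    forall i, [set pgrad i (xs i) (sigma xs) + mu *m (constr_grad i (xs i))^T + s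
                | s in normal_cone (strat G i) (xs i)] 0 &
    [set - constr_sum xs + s | s in normal_cone orthant mu] 0].

(* The measurability and integrability clauses are what the definition of the
   expected cost presupposes. *)
Definition well_posed : Prop :=
  [/\ forall i, measurable_wrt measurable (noise G i),
      forall i (a : 'rV[R]_(dim G i)) y,
        measurable_wrt (@borel 'rV[R]_(ndim G i)) (rcost G i a y),
      forall i (a : 'rV[R]_(dim G i)) y,
        P.-integrable setT (EFin \o (fun w => rcost G i a y (noise G i w))) &
      forall i (u : 'rV[R]_(ndim G i)) a y, strat G i a ->
        differentiable
          (fun v : 'rV[R]_(dim G i) * 'rV[R]_n => rcost G i v.1 v.2 u) (a, y)].

Definition game_assumption : Prop :=
  [/\ forall i, [/\ strat G i !=set0, convex_set (strat G i) & compact (strat G i)],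
      (exists x, feasible x) /\
        (exists x, strats x /\ forall k, constr_sum x 0 k < 0),
      (forall i a y, strat G i a ->
        differentiable
          (fun v : 'rV[R]_(dim G i) * 'rV[R]_n => cost i v.1 v.2) (a, y)) /\
        (forall i (x : profile), convex_function (strat G i) (own_cost i x)),
      forall i j,
        (forall a, strat G i a ->
          differentiable (fun v : 'rV[R]_(dim G i) => constr G i v 0 j) a) /\
        convex_function (strat G i) (fun v : 'rV[R]_(dim G i) => constr G i v 0 j) &
      [/\ forall i a, strat G i a -> differentiable (agg G i) a,
          exists2 Ls, 0 < Ls & forall i a a', strat G i a -> strat G i a' ->
            enorm (agg G i a - agg G i a') <= Ls * enorm (a - a') &
          exists L M, [/\ 0 < L, 0 < M & forall i a, strat G i a ->
            [/\ enorm a <= L, enorm (constr G i a) <= L &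
                enorm (constr_grad i a) <= M]]]].

Definition lipschitz_assumption : Prop :=
  exists2 Lf, 0 < Lf & forall i a, strat G i a -> forall y y',
    enorm (pgrad i a y - pgrad i a y') <= Lf * enorm (y - y').

Definition strictly_monotone : Prop :=
  forall x x', strats x -> strats x' -> stack x != stack x' ->
    0 < dot (pseudo_grad x - pseudo_grad x') (stack x - stack x').

Definition samples := nat -> forall i, Omega -> 'rV[R]_(ndim G i).

Definition is_sampling (xi : samples) : Prop :=
  forall t i, measurable_wrt measurable (xi t i) /\
    forall B, borel B -> P (xi t i @^-1` B) = P (noise G i @^-1` B).

(* For t = 0 the generating family is empty and the sigma-algebra is trivial. *)
Definition filtration (xi : samples) (t : nat) : set (set Omega) :=
  <<s [set A | exists s i B, [/\ (s < t)%N, borel B & A = xi s i @^-1` B]] >>.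

(* The points at which the oracle is queried are random. *)
Definition oracle_point (xi : samples) (t : nat) (i : 'I_N)
    (X : Omega -> 'rV[R]_(dim G i)) (Y : Omega -> 'rV[R]_n) : Prop :=
  [/\ measurable_wrt (filtration xi t) X, forall w, strat G i (X w) &
      measurable_wrt (filtration xi t) Y].

Definition oracle_unbiased (xi : samples) : Prop :=
  forall t i X Y, oracle_point xi t i X Y -> forall k,
    is_cond_exp P (filtration xi t)
      (fun w => qgrad i (X w) (Y w) (xi t i w) 0 k)
      (fun w => pgrad i (X w) (Y w) 0 k).

Definition oracle_bounded (xi : samples) : Prop :=
  exists2 S, 0 < S & forall t i X Y, oracle_point xi t i X Y ->
    {ae P, forall w, enorm (qgrad i (X w) (Y w) (xi t i w)) <= S}.

Record state := State {
  st_z : 'I_N -> R;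
  st_x : profile;
  st_mu : 'I_N -> 'rV[R]_m;
  st_sigma : 'I_N -> 'rV[R]_n
}.

Definition init (x0 : profile) : state :=
  State (fun=> 1) x0 (fun=> 0) (fun i => agg G i (x0 i)).

Definition step (W : 'M[R]_N) (a b c : R) (u : forall i, 'rV[R]_(ndim G i))
    (st : state) : state :=
  let z i := \sum_j W i j * st_z st j in
  let muhat i := \sum_j W i j *: st_mu st j in
  let sigmahat i := \sum_j W i j *: st_sigma st j in
  let s i := qgrad i (st_x st i) ((z i)^-1 *: sigmahat i) (u i)
             + (z i)^-1 *: (muhat i *m (constr_grad i (st_x st i))^T) in
  let x i := eproj (strat G i) (st_x st i - a *: s i) in
  State z x
    (fun i => eproj orthant (muhat i + c *: (constr G i (st_x st i) - b *: muhat i)))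
    (fun i => sigmahat i + agg G i (x i) - agg G i (st_x st i)).

Fixpoint run (W : nat -> 'M[R]_N) (alpha beta gamma : nat -> R) (x0 : profile)
    (xi : samples) (t : nat) (w : Omega) : state :=
  if t is t'.+1 then
    step (W t') (alpha t') (beta t') (gamma t') (fun i => xi t' i w)
      (run W alpha beta gamma x0 xi t' w)
  else init x0.

End Game.

Set Implicit Arguments.

(* E t j i means that (j, i) is an edge of the graph at time t; the diagonal of
   W is positive whether or not self-loops are listed as edges. *)
Definition is_weighting {R : realType} {N : nat} (E : nat -> rel 'I_N)
  (W : nat -> 'M[R]_N) : Prop :=
  forall t i j, [/\ E t j i -> 0 < W t i j,
    i != j -> ~~ E t j i -> W t i j = 0 & 0 < W t i i].

Definition graph_assumption {R : realType} {N : nat} (E : nat -> rel 'I_N)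
  (W : nat -> 'M[R]_N) : Prop :=
  [/\ exists wmin, 0 < wmin < 1 /\
        forall t i j, 0 < W t i j -> wmin <= W t i j,
      forall t j, \sum_i W t i j = 1 &
      exists2 U, (0 < U)%N & forall t i j,
        connect (fun a b => [exists l : 'I_U, E (t + l)%N a b]) i j].

Definition is_step_size {R : realType} (a : nat -> R) : Prop :=
  (forall t, 0 < a t <= 1) /\ nonincreasing_seq a.

(* Main.v *)
(* The vGNE exists by a minimax (Minty) argument: the pair (primal variational
   inequality, dual slackness) is a monotone equilibrium problem on the product
   of the strategy sets with a large box of multipliers, Slater's condition
   keeps the multiplier below the upper faces of the box, and only continuity of
   the pseudo-gradient along segments is needed. Strict monotonicity gives
   uniqueness.

   For the convergence, push-sum averaging makes sigma-hat / z and mu-hat / z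
   track the network averages with errors summable against alpha_t. The squared
   distance of x_t and of the average multiplier to a saddle point (xs, mus) is
   then a Lyapunov function: on every path along which the oracle samples are
   bounded, sum_t alpha_t (<G(x_t) - G(xs), x_t - xs> + noise_t) is bounded by a
   deterministic constant. The noise terms have mean zero, so the nonnegative
   series sum_t alpha_t <G(x_t) - G(xs), x_t - xs> has finite expectation and
   converges almost surely, without any martingale convergence theorem.
   Comparison with a Slater point bounds the multipliers on the path, hence
   |x_(t+1) - x_t| = O(alpha_t); as sum_t alpha_t = oo and sum_t alpha_t^2 < oo,
   the distance of x_t to xs tends to 0. *)
Require Import Defs.
From HB Require Import structures.
From mathcomp Require Import all_boot all_order all_algebra.
From mathcomp Require Import all_classical all_reals all_analysis.
From mathcomp Require Import measurable_realfun.
From mathcomp Require Import ring lra.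
Import Order.TTheory GRing.Theory Num.Theory.
Import numFieldNormedType.Exports.
Set Implicit Arguments.
Unset Strict Implicit.
Unset Printing Implicit Defensive.
Local Open Scope classical_set_scope.
Local Open Scope ring_scope.


(** * Euclidean geometry and projections *)

(** Two obstacles shape the estimates. The regularisation bounds the multipliers a priori only by a
    multiple of 1/beta_t, so the step of x_t is at first O(alpha_t/beta_t). This crude bound
    suffices for the consensus errors (weight alpha_t^2/beta_t) and the squared directions
    (alpha_t^2/beta_t^2); only once these sums are finite does the Slater comparison give bounds
    uniform in t. All constants are fixed before the path is, so a bound valid on almost every path
    can be integrated.

    The pseudo-gradient consists of gradients of convex costs: Lipschitz in the aggregate and
    bounded through the oracle, but not assumed continuous in the actions. Convexity makes up for
    this in the existence proof, monotonicity in the lower bound on the gap away from the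
    equilibrium.

    The random cost is measurable in the noise only for each fixed action and aggregate. Gradients
    at random points are therefore reached by difference quotients at lattice points, which take
    countably many values. This makes the iterates adapted, so that the oracle hypotheses apply to
    them. *)

Section Euclid.
Context {R : realType}.
Implicit Types (k l : nat).

Lemma dotC k (u v : 'rV[R]_k) : dot u v = dot v u.
Proof. by apply: eq_bigr => j _; rewrite mulrC. Qed.

Lemma dotDl k (u v w : 'rV[R]_k) : dot (u + v) w = dot u w + dot v w.
Proof. by rewrite -big_split; apply: eq_bigr => j _; rewrite mxE mulrDl. Qed.

Lemma dotDr k (u v w : 'rV[R]_k) : dot w (u + v) = dot w u + dot w v.
Proof. by rewrite dotC dotDl !(dotC w). Qed.

Lemma dotZl k a (u v : 'rV[R]_k) : dot (a *: u) v = a * dot u v.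
Proof. by rewrite mulr_sumr; apply: eq_bigr => j _; rewrite mxE mulrA. Qed.

Lemma dotZr k a (u v : 'rV[R]_k) : dot u (a *: v) = a * dot u v.
Proof. by rewrite dotC dotZl dotC. Qed.

Lemma dotNl k (u v : 'rV[R]_k) : dot (- u) v = - dot u v.
Proof. by rewrite -scaleN1r dotZl mulN1r. Qed.

Lemma dotNr k (u v : 'rV[R]_k) : dot u (- v) = - dot u v.
Proof. by rewrite dotC dotNl dotC. Qed.

Lemma dotBl k (u v w : 'rV[R]_k) : dot (u - v) w = dot u w - dot v w.
Proof. by rewrite dotDl dotNl. Qed.

Lemma dotBr k (u v w : 'rV[R]_k) : dot w (u - v) = dot w u - dot w v.
Proof. by rewrite dotDr dotNr. Qed.

Lemma dot0l k (v : 'rV[R]_k) : dot 0 v = 0.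
Proof. by rewrite -(scale0r 0) dotZl mul0r. Qed.

Lemma dot0r k (v : 'rV[R]_k) : dot v 0 = 0.
Proof. by rewrite dotC dot0l. Qed.

Lemma dot_suml k (I : Type) (r : seq I) (Q : pred I) (F : I -> 'rV[R]_k) v :
  dot (\sum_(i <- r | Q i) F i) v = \sum_(i <- r | Q i) dot (F i) v.
Proof.
by elim/big_rec2: _ => [|i x y _ <-]; rewrite ?dot0l ?dotDl.
Qed.

Lemma dot_sumr k (I : Type) (r : seq I) (Q : pred I) (F : I -> 'rV[R]_k) v :
  dot v (\sum_(i <- r | Q i) F i) = \sum_(i <- r | Q i) dot v (F i).
Proof. by rewrite dotC dot_suml; apply: eq_bigr => i _; rewrite dotC. Qed.

Lemma dot_mulmx_tr k l (A : 'M[R]_(k, l)) (u : 'rV[R]_l) (v : 'rV[R]_k) :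
  dot (u *m A^T) v = dot u (v *m A).
Proof.
rewrite /dot; under eq_bigr do rewrite mxE mulr_suml.
rewrite exchange_big /=; apply: eq_bigr => i _.
rewrite mxE mulr_sumr; apply: eq_bigr => j _.
by rewrite !mxE mulrAC mulrA.
Qed.

Lemma enorm_ge0 k l (A : 'M[R]_(k, l)) : 0 <= enorm A.
Proof. exact: sqrtr_ge0. Qed.

Lemma enorm_sqrE k l (A : 'M[R]_(k, l)) :
  enorm A ^+ 2 = \sum_i \sum_j A i j ^+ 2.
Proof.
by rewrite sqr_sqrtr //; do 2![apply: sumr_ge0 => ? _]; rewrite sqr_ge0.
Qed.

Lemma enorm_sqr k (u : 'rV[R]_k) : enorm u ^+ 2 = dot u u.
Proof. by rewrite enorm_sqrE big_ord1; apply: eq_bigr => j _; rewrite expr2. Qed.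

Lemma dot_ge0 k (u : 'rV[R]_k) : 0 <= dot u u.
Proof. by rewrite -enorm_sqr sqr_ge0. Qed.

Lemma dotuu_eq0 k (u : 'rV[R]_k) : (dot u u == 0) = (u == 0).
Proof.
apply/idP/eqP => [|->]; last by rewrite dot0l.
rewrite psumr_eq0 => [/allP h|j _]; last by rewrite -expr2 sqr_ge0.
apply/rowP => j; rewrite mxE; apply/eqP.
by have := h j (mem_index_enum _); rewrite -expr2 sqrf_eq0.
Qed.

Lemma dot_sqr_le k (u v : 'rV[R]_k) : dot u v ^+ 2 <= dot u u * dot v v.
Proof.
have [->|v0] := eqVneq v 0; first by rewrite !dot0r expr0n mulr0.
have vv : 0 < dot v v by rewrite lt0r dotuu_eq0 v0 dot_ge0.
have := dot_ge0 (dot v v *: u - dot u v *: v).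
rewrite !(dotBl, dotBr, dotZl, dotZr) (dotC v u) => h.
have {h} : 0 <= dot v v * (dot u u * dot v v - dot u v ^+ 2) by lra.
by rewrite pmulr_rge0 // subr_ge0.
Qed.

Lemma ler_norm_dot k (u v : 'rV[R]_k) : `|dot u v| <= enorm u * enorm v.
Proof.
rewrite -ler_sqr ?nnegrE ?mulr_ge0 ?enorm_ge0 //.
by rewrite exprMn !enorm_sqr real_normK ?num_real // dot_sqr_le.
Qed.

Lemma ler_dot k (u v : 'rV[R]_k) : dot u v <= enorm u * enorm v.
Proof. exact: le_trans (ler_norm _) (ler_norm_dot u v). Qed.

Lemma enormD k (u v : 'rV[R]_k) : enorm (u + v) <= enorm u + enorm v.
Proof.
rewrite -ler_sqr ?nnegrE ?addr_ge0 ?enorm_ge0 //.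
rewrite enorm_sqr sqrrD !(dotDl, dotDr) (dotC v u) !enorm_sqr.
by have := ler_dot u v; lra.
Qed.

Lemma enorm0 k l : enorm (0 : 'M[R]_(k, l)) = 0.
Proof.
rewrite /enorm big1 ?sqrtr0 // => i _; rewrite big1 // => j _.
by rewrite mxE expr0n.
Qed.

Lemma enormZ k a (u : 'rV[R]_k) : enorm (a *: u) = `|a| * enorm u.
Proof.
apply/eqP; rewrite -(@eqrXn2 _ 2) ?mulr_ge0 ?enorm_ge0 //.
by rewrite exprMn !enorm_sqr dotZl dotZr real_normK ?num_real // expr2 mulrA.
Qed.

Lemma enormN k (u : 'rV[R]_k) : enorm (- u) = enorm u.
Proof. by rewrite -scaleN1r enormZ normrN normr1 mul1r. Qed.

Lemma enormB k (u v : 'rV[R]_k) : enorm (u - v) <= enorm u + enorm v.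
Proof. by rewrite (le_trans (enormD _ _)) // enormN. Qed.

Lemma enormBC k (u v : 'rV[R]_k) : enorm (u - v) = enorm (v - u).
Proof. by rewrite -opprB enormN. Qed.

Lemma enorm_sum k (I : Type) (r : seq I) (Q : pred I) (F : I -> 'rV[R]_k) :
  enorm (\sum_(i <- r | Q i) F i) <= \sum_(i <- r | Q i) enorm (F i).
Proof.
elim/big_rec2: _ => [|i x y _ h]; first by rewrite enorm0.
by rewrite (le_trans (enormD _ _)) // lerD2l.
Qed.

Lemma coord_le_enorm k (u : 'rV[R]_k) j : `|u 0 j| <= enorm u.
Proof.
rewrite -ler_sqr ?nnegrE ?enorm_ge0 // real_normK ?num_real // enorm_sqr /dot (bigD1 j) //=.
by rewrite -expr2 lerDl sumr_ge0 // => i _; rewrite -expr2 sqr_ge0.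
Qed.

Lemma row_delta k (u : 'rV[R]_k) : u = \sum_j u 0 j *: delta_mx 0 j.
Proof. exact: row_sum_delta. Qed.

Lemma enorm_delta k (j : 'I_k) : enorm (delta_mx 0 j : 'rV[R]_k) = 1.
Proof.
apply/eqP; rewrite -(@eqrXn2 _ 2) ?enorm_ge0 // enorm_sqr expr1n /dot.
rewrite (bigD1 j) //= big1 => [|i /negbTE ij]; rewrite !mxE eqxx /=.
  by rewrite eqxx addr0 mulr1.
by rewrite ij mulr0.
Qed.

Lemma enorm_le_l1 k (u : 'rV[R]_k) : enorm u <= \sum_j `|u 0 j|.
Proof.
rewrite [in leLHS](row_delta u) (le_trans (enorm_sum _ _ _)) //.
by apply: ler_sum => j _; rewrite enormZ enorm_delta mulr1.
Qed.

Lemma norm_le_enorm k (u : 'rV[R]_k) : `|u| <= enorm u.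
Proof.
rewrite [`|u|]mx_normrE; apply: bigmax_le => [|[i j] _ /=].
  exact: enorm_ge0.
by rewrite ord1; exact: coord_le_enorm.
Qed.

Lemma coord_le_norm k l (A : 'M[R]_(k, l)) i j : `|A i j| <= `|A|.
Proof.
rewrite [`|A|]mx_normrE.
by apply: (le_trans _ (le_bigmax _ _ (i, j))).
Qed.

Lemma enorm_le_norm k (u : 'rV[R]_k) : enorm u <= k%:R * `|u|.
Proof.
rewrite (le_trans (enorm_le_l1 u)) //.
rewrite (@le_trans _ _ (\sum_(j < k) `|u|)) //.
  by apply: ler_sum => j _; exact: coord_le_norm.
by rewrite sumr_const card_ord mulr_natl.
Qed.

Lemma enorm_mulmx_tr k l (A : 'M[R]_(k, l)) (u : 'rV[R]_l) :
  enorm (u *m A^T) <= enorm u * enorm A.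
Proof.
rewrite -ler_sqr ?nnegrE ?mulr_ge0 ?enorm_ge0 // exprMn (enorm_sqrE A).
rewrite enorm_sqrE big_ord1 mulr_sumr; apply: ler_sum => i _.
have -> : (u *m A^T) 0 i = dot u (row i A).
  by rewrite mxE; apply: eq_bigr => j _; rewrite !mxE.
rewrite (le_trans (dot_sqr_le _ _)) // -enorm_sqr ler_wpM2l ?sqr_ge0 //.
by apply: ler_sum => j _; rewrite !mxE expr2.
Qed.

Lemma dot_mxrow N (p : 'I_N -> nat) (u v : forall i, 'rV[R]_(p i)) :
  dot (mxrow u) (mxrow v) = \sum_i dot (u i) (v i).
Proof.
have dotE k (a b : 'rV[R]_k) : dot a b = (a *m b^T) 0 0.
  by rewrite mxE; apply: eq_bigr => j _; rewrite mxE.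
rewrite dotE tr_mxrow mul_mxrow_mxcol summxE.
by apply: eq_bigr => i _; rewrite dotE.
Qed.

End Euclid.

Section Projection.
Context {R : realType} {k : nat}.
Implicit Types (C : set 'rV[R]_k) (u v x y z : 'rV[R]_k).

Definition lconvex (V : lmodType R) (C : set V) := forall (x y : V) (t : R),
  C x -> C y -> 0 <= t <= 1 -> C (x + t *: (y - x)).

Definition nearest C v y := C y /\ forall z, C z -> enorm (v - y) <= enorm (v - z).

(* Along the segment from y to z, the squared distance to v is a quadratic
   polynomial in the parameter with slope -2 <v - y, z - y> at 0. *)
Lemma nearest_obtuse C v y z :
  lconvex C -> nearest C v y -> C z -> dot (v - y) (z - y) <= 0.
Proof.
move=> cC [Cy ymin] Cz; rewrite leNgt; apply/negP => d0.
have e1 t : v - (y + t *: (z - y)) = (v - y) - t *: (z - y).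
  by rewrite opprD addrA.
have {ymin} : forall t, 0 <= t <= 1 ->
    enorm (v - y) <= enorm ((v - y) - t *: (z - y)).
  by move=> t t01; rewrite -e1; apply: ymin; exact: cC.
move: (v - y) (z - y) d0 => {e1} a b d0 ymin.
set D := dot a b in d0.
set Q := dot b b.
have Q0 : 0 <= Q by exact: dot_ge0.
(* This [t] gives [t * Q < D < 2 * D], against minimality; the [+ 1] makes the denominator positive
   at once. *)
pose t := Num.min 1 (D / (Q + 1)).
have Q1 : 0 < Q + 1 by lra.
have t0 : 0 < t by rewrite lt_min ltr01 divr_gt0.
have t1 : t <= 1 by rewrite ge_min lexx.
have tQ : t * (Q + 1) <= D by rewrite -ler_pdivlMr // ge_min lexx orbT.
have /ymin : 0 <= t <= 1 by rewrite (ltW t0).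
rewrite -ler_sqr ?nnegrE ?enorm_ge0 // !enorm_sqr.
rewrite !(dotBl, dotBr, dotZl, dotZr) -/Q (dotC b a) -/D => h.
have : 0 <= t * (t * Q - 2 * D) by lra.
by rewrite pmulr_rge0 //; nra.
Qed.

Lemma nearest_uniq C v y z : lconvex C -> nearest C v y -> nearest C v z -> y = z.
Proof.
move=> cC hy hz; have h1 := nearest_obtuse cC hy hz.1.
have h2 := nearest_obtuse cC hz hy.1.
apply/eqP; rewrite -subr_eq0 -dotuu_eq0 eq_le dot_ge0 andbT.
have -> : dot (y - z) (y - z) = dot (v - z) (y - z) + dot (v - y) (z - y).
  by rewrite !(dotBl, dotBr) (dotC z y); ring.
lra.
Qed.

Lemma eproj_nearest C v : (exists y, nearest C v y) -> nearest C v (eproj C v).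
Proof. by move=> [y hy]; exact: (xgetI 0 hy). Qed.

Lemma nearest_nonexp C u v x y : lconvex C -> nearest C u x -> nearest C v y ->
  enorm (x - y) <= enorm (u - v).
Proof.
move=> cC hx hy; have h1 := nearest_obtuse cC hx hy.1.
have h2 := nearest_obtuse cC hy hx.1.
have h : dot (x - y) (x - y) <= dot (u - v) (x - y).
  have : dot (u - v) (x - y) - dot (x - y) (x - y) =
      - dot (u - x) (y - x) - dot (v - y) (x - y).
    by rewrite !(dotBl, dotBr) (dotC y x); ring.
  lra.
rewrite leNgt; apply/negP => lt_uv.
have := ler_dot (u - v) (x - y); have := enorm_ge0 (u - v).
by move: h; rewrite -enorm_sqr expr2; nra.
Qed.

Lemma nearest_id C x : C x -> nearest C x x.
Proof. by move=> Cx; split => // z _; rewrite subrr enorm0 enorm_ge0. Qed.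

Lemma enorm_continuous : continuous (fun v : 'rV[R]_k => enorm v).
Proof.
move=> v; apply/(@cvgrPdist_le _ _ _ (nbhs v)) => e e0.
have K0 : 0 < k%:R + 1 :> R by rewrite ltr_wpDl.
have e'0 : 0 < e / (k%:R + 1) by rewrite divr_gt0.
apply/nbhs_ballP; exists (e / (k%:R + 1)) => //= w.
rewrite mx_norm_ball /ball_ /= => vw.
have : enorm (v - w) <= e.
  rewrite (le_trans (enorm_le_norm _)) //.
  rewrite (@le_trans _ _ ((k%:R + 1) * (e / (k%:R + 1)))) //; last first.
    by rewrite mulrC divfK // gt_eqF.
  by rewrite ler_pM // ?lerDl // ltW.
move=> h; rewrite ler_norml; apply/andP; split.
  by have := enormB v (v - w); rewrite subKr; lra.
by have := enormD w (v - w); rewrite addrC subrK; lra.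
Qed.

Lemma compact_nearest C v : compact C -> C !=set0 -> exists y, nearest C v y.
Proof.
move=> cC C0.
have [|y /set_mem Cy ymin] := @EVT_min_rV R k (fun z => enorm (v - z)) C C0 cC.
  apply: continuous_subspaceT => z.
  apply: (@continuous_comp _ _ _ (fun z => v - z) (fun u => enorm u)).
    by apply: (@cvgB _ _ _ (nbhs z)); [exact: cvg_cst|exact: cvg_id].
  exact: enorm_continuous.
by exists y; split => // z Cz; apply: ymin; rewrite inE.
Qed.

End Projection.

(** * Push-sum consensus *)

Lemma connect_exit (T : finType) (e : rel T) (S : {set T}) x y :
  connect e x y -> x \in S -> y \notin S ->
  exists a b, [/\ a \in S, b \notin S & e a b].
Proof.
move=> /connectP[p + ->] xS; elim: p x xS => /= [x -> //|b p IH x xS].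
move=> /andP[xb pb] yS; have [bS|bS] := boolP (b \in S); first exact: IH bS pb yS.
by exists x, b.
Qed.

Section Consensus.
Context {R : realType} {N : nat}.
Implicit Types (A : 'M[R]_N) (u v : 'cV[R]_N).

Definition l1 u : R := \sum_i `|u i 0|.

Lemma l1_ge0 u : 0 <= l1 u.
Proof. by rewrite sumr_ge0. Qed.

Lemma l1D u v : l1 (u + v) <= l1 u + l1 v.
Proof.
by rewrite -big_split; apply: ler_sum => i _; rewrite mxE ler_normD.
Qed.

Definition col_stochastic A :=
  (forall i j, 0 <= A i j) /\ forall j, \sum_i A i j = 1.

(* The condition [\sum_i u i 0 = 0] makes the constant part eta of A invisible. *)
Lemma l1_contract A u eta : col_stochastic A -> (forall i j, eta <= A i j) ->
  \sum_i u i 0 = 0 -> l1 (A *m u) <= (1 - N%:R * eta) * l1 u.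
Proof.
move=> [_ A1] Aeta u0.
have Au i : (A *m u) i 0 = \sum_j (A i j - eta) * u j 0.
  under [RHS]eq_bigr do rewrite mulrBl.
  by rewrite sumrB -mulr_sumr u0 mulr0 subr0 mxE.
have -> : (1 - N%:R * eta) * l1 u =
    \sum_i \sum_j (A i j - eta) * `|u j 0|.
  rewrite exchange_big /= /l1 mulr_sumr; apply: eq_bigr => j _.
  rewrite -mulr_suml; congr (_ * _).
  by rewrite sumrB A1 sumr_const card_ord mulr_natl.
apply: ler_sum => i _; rewrite Au (le_trans (ler_norm_sum _ _ _)) //.
by apply: ler_sum => j _; rewrite normrM ger0_norm // subr_ge0.
Qed.

Lemma l1_col_stochastic A u : col_stochastic A -> l1 (A *m u) <= l1 u.
Proof.
move=> [A0 A1]; have -> : l1 u = \sum_i \sum_j A i j * `|u j 0|.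
  rewrite exchange_big /=; apply: eq_bigr => j _.
  by rewrite -mulr_suml A1 mul1r.
apply: ler_sum => i _; rewrite mxE (le_trans (ler_norm_sum _ _ _)) //.
by apply: ler_sum => j _; rewrite normrM ger0_norm.
Qed.

Variables (E : nat -> rel 'I_N) (W : nat -> 'M[R]_N).
Hypotheses (hN : (0 < N)%N) (hW : is_weighting E W) (hgraph : graph_assumption E W).

Lemma weight_col_stochastic t : col_stochastic (W t).
Proof.
case: hgraph => _ W1 _; split => // i j.
have [h1 h2 h3] := hW t i j.
have [->|ij] := eqVneq i j; first by have [_ _ /ltW] := hW t j j.
have [/h1/ltW//|eji] := boolP (E t j i).
by rewrite h2.
Qed.

Fixpoint transition (t k : nat) : 'M[R]_N :=
  if k is k'.+1 then W (t + k')%N *m transition t k' else 1%:M.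

Lemma transition_col_stochastic t k : col_stochastic (transition t k).
Proof.
elim: k => [|k [T0 T1]] /=.
  split=> [i j|j]; first by rewrite mxE ler0n.
  rewrite (bigD1 j) //= big1 => [|i /negbTE ij]; first by rewrite mxE eqxx addr0.
  by rewrite mxE ij.
have [W0 W1] := weight_col_stochastic (t + k)%N; split => [i j|j].
  by rewrite mxE sumr_ge0 // => l _; rewrite mulr_ge0.
under eq_bigr do rewrite mxE.
rewrite exchange_big /= -[RHS](T1 j); apply: eq_bigr => l _.
by rewrite -mulr_suml W1 mul1r.
Qed.

(** For fixed [t] and [j], follow the set of nodes [i] whose entry [transition t k i j] is at least
    [wmin ^+ k]. Positive diagonals never let it shrink, and in every window of [U] steps some edge
    leaves it unless it is full. Hence it is full after [U * N] steps. *)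
Lemma transition_lbound : exists B wmin, [/\ 0 < wmin < 1,
  (forall t k i, wmin ^+ k <= transition t k i i) &
  (forall t i j, wmin ^+ B <= transition t B i j)].
Proof.
case: hgraph => [[wmin [w01 wlb]] _ [U U0 conn]].
have w0 : 0 <= wmin by case/andP: w01 => /ltW.
have Wii t i : wmin <= W t i i by apply: wlb; have [] := hW t i i.
pose S t j k : {set 'I_N} := [set i | wmin ^+ k <= transition t k i j]%SET.
have stepS t j k a b : a \in S t j k -> wmin <= W (t + k)%N b a ->
    b \in S t j k.+1.
  rewrite /S !inE /= => aS wab; rewrite mxE (bigD1 a) //= exprS.
  apply: (@le_trans _ _ (W (t + k)%N b a * transition t k a j)).
    by rewrite ler_pM // exprn_ge0.
  rewrite lerDl sumr_ge0 // => l _; rewrite mulr_ge0 //.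
    by have [] := weight_col_stochastic (t + k)%N.
  by have [] := transition_col_stochastic t k.
have monoS t j k l : S t j k \subset S t j (k + l)%N.
  elim: l => [|l IH]; first by rewrite addn0.
  apply: (fintype.subset_trans IH); rewrite addnS; apply/fintype.subsetP => i iS.
  exact: stepS iS (Wii _ _).
have S0 t j k : j \in S t j k.
  apply: (fintype.subsetP (monoS t j 0 k)).
  by rewrite /S inE /= expr0 mxE eqxx.
exists (U * N)%N, wmin; split => // [t k i|t i j].
  by have := S0 t i k; rewrite /S inE.
(* After [k] windows of length [U] at least [k + 1] nodes are reached, or all [N]; at [k = 0] this
   is the node [j] itself. *)
have cardS k : (minn N k.+1 <= #|S t j (U * k)%N|)%N.
  elim: k => [|k IH].
    rewrite (leq_trans (geq_minr _ _)) // finset.card_gt0; apply/finset.set0Pn.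
    by exists j; rewrite muln0.
  have sub : S t j (U * k)%N \subset S t j (U * k.+1)%N.
    by rewrite mulnS addnC; exact: monoS.
  have [full|] := boolP (S t j (U * k)%N == [set: 'I_N])%SET.
    have : S t j (U * k.+1)%N == [set: 'I_N]%SET by rewrite -finset.subTset -(eqP full).
    by move=> /eqP ->; rewrite cardsT card_ord geq_minl.
  rewrite -finset.subTset => /fintype.subsetPn[y _ yS].
  have [a [b [aS bS /existsP[l Eab]]]] :=
    connect_exit (conn (t + U * k)%N j y) (S0 t j _) yS.
  have bS' : b \in S t j (U * k.+1)%N.
    have := fintype.subsetP (monoS t j (U * k)%N%N l) _ aS.
    have wab : wmin <= W (t + (U * k + l))%N b a.
      by apply: wlb; have [] := hW (t + (U * k + l))%N b a; rewrite addnA => + _ _; exact.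
    move=> /stepS/(_ wab).
    (* The edge leaving the set appears at offset [l] of the window; the [U - l.+1] steps that
       remain only keep its head in the set. *)
    have -> : (U * k.+1 = (U * k + l).+1 + (U - l.+1))%N.
      by rewrite mulnS -addnS -addnA subnKC // addnC.
    exact: (fintype.subsetP (monoS _ _ _ _)).
  have : (#|S t j (U * k)%N| < #|S t j (U * k.+1)%N|)%N.
    by apply: proper_card; apply/properP; split => //; exists b.
  apply: leq_trans; rewrite (leq_trans _ (_ : (minn N k.+1).+1 <= _)%N) //.
  by rewrite -minnSS leq_min geq_minr andbT (leq_trans (geq_minl _ _)).
have : S t j (U * N)%N == [set: 'I_N]%SET.
  rewrite eqEcard finset.subsetT cardsT card_ord /=.
  by rewrite (leq_trans _ (cardS N)) // leq_min leqnn leqnSn.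
by move=> /eqP/finset.setP/(_ i); rewrite /S !inE.
Qed.


(** Column-stochastic matrices do not increase [l1], so the perturbations met along the way add up
    without amplification. *)
Lemma transition_perturbed (u d : nat -> 'cV[R]_N) t k :
  (forall t, u t.+1 = W t *m u t + d t) ->
  l1 (u (t + k)%N - transition t k *m u t) <= \sum_(s < k) l1 (d (t + s)%N).
Proof.
move=> hu; elim: k => [|k IH].
  by rewrite addn0 mul1mx subrr big_ord0 /l1 big1 // => i _; rewrite mxE normr0.
rewrite big_ord_recr /= addnS hu -mulmxA addrAC -mulmxBr.
rewrite (le_trans (l1D _ _)) // lerD2r (le_trans _ IH) //.
exact: l1_col_stochastic (weight_col_stochastic _).
Qed.

Lemma sum_shift_le (a : nat -> R) D s T :
  (forall t, 0 <= a t) -> (forall T, \sum_(t < T) a t <= D) ->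
  \sum_(t < T) a (s + t)%N <= D.
Proof.
move=> a0 aD; apply: (le_trans _ (aD (s + T)%N)).
by rewrite big_split_ord /= lerDr sumr_ge0.
Qed.

(** Over [B] steps the product contracts zero-sum vectors by [1 - kappa], at the price of [B]
    perturbations. As [a] is nonincreasing, the weights may be moved back in time; summing over [t]
    gives [S <= head + (1 - kappa) * S + B * D], where the head consists of [B] terms bounded by
    [l1 (u 0) + D]. Solving for [S] yields the constant [2 * B / kappa], the same for all
    sequences. *)
Lemma sum_zero_sum_contract : exists K : R, 0 <= K /\
  forall (u d : nat -> 'cV[R]_N) (a : nat -> R) D,
  (forall t, u t.+1 = W t *m u t + d t) ->
  (forall t, \sum_i u t i 0 = 0) ->
  (forall t, 0 <= a t <= 1) -> (forall s t, (s <= t)%N -> a t <= a s) ->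
  (forall T, \sum_(t < T) a t * l1 (d t) <= D) ->
  forall T, \sum_(t < T) a t * l1 (u t) <= K * (l1 (u 0%N) + D).
Proof.
have [B [w [/andP[w0 w1] _ trB]]] := transition_lbound.
pose kappa := N%:R * w ^+ B.
have kappa0 : 0 < kappa by rewrite mulr_gt0 ?ltr0n ?exprn_gt0.
exists (2 * B%:R / kappa); split; first by rewrite divr_ge0 ?(ltW kappa0).
move=> u d a D hu u0 a01 amono aD T.
have a0 t : 0 <= a t by case/andP: (a01 t).
have ad0 t : 0 <= a t * l1 (d t) by rewrite mulr_ge0 ?l1_ge0.
have D0 : 0 <= D by have := aD 0%N; rewrite big_ord0.
have au0 t : 0 <= a t * l1 (u t) by rewrite mulr_ge0 ?l1_ge0.
have ub t : a t * l1 (u t) <= l1 (u 0%N) + D.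
  have := transition_perturbed 0 t hu; rewrite add0n => ht.
  have h1 : l1 (u t) <= l1 (u 0%N) + \sum_(s < t) l1 (d s).
    rewrite -[u t](subrK (transition 0 t *m u 0%N)) addrC (le_trans (l1D _ _)) //.
    by rewrite lerD // l1_col_stochastic //; exact: transition_col_stochastic.
  rewrite (le_trans (ler_wpM2l (a0 t) h1)) // mulrDr lerD //.
    by rewrite ler_piMl ?l1_ge0 //; case/andP: (a01 t).
  rewrite (le_trans _ (aD t)) // mulr_sumr; apply: ler_sum => s _.
  by rewrite ler_wpM2r ?l1_ge0 // amono // ltnW.
have step t : a (B + t)%N * l1 (u (B + t)%N) <=
    (1 - kappa) * (a t * l1 (u t)) + \sum_(s < B) a (s + t)%N * l1 (d (s + t)%N).
  have h1 : l1 (u (B + t)%N) <=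
      (1 - kappa) * l1 (u t) + \sum_(s < B) l1 (d (s + t)%N).
    rewrite addnC -[u (t + B)%N](subrK (transition t B *m u t)) addrC.
    rewrite (le_trans (l1D _ _)) // lerD //.
      exact: l1_contract (transition_col_stochastic _ _) (trB t) (u0 t).
    rewrite (le_trans (transition_perturbed t B hu)) // le_eqVlt; apply/orP; left.
    by apply/eqP/eq_bigr => s _; rewrite addnC.
  (* Nonnegative because it dominates a norm, which avoids a separate proof of [kappa <= 1]. *)
  have k1 : 0 <= (1 - kappa) * l1 (u t).
    apply: (le_trans (l1_ge0 (transition t B *m u t))).
    exact: l1_contract (transition_col_stochastic _ _) (trB t) (u0 t).
  rewrite (le_trans (ler_wpM2l (a0 _) h1)) // mulrDr lerD //.
    by rewrite [leRHS]mulrCA ler_wpM2r // amono // leq_addl.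
  rewrite mulr_sumr; apply: ler_sum => s _.
  by rewrite ler_wpM2r ?l1_ge0 // amono // leq_add2r ltnW.
have tail : \sum_(t < T) a t * l1 (u t) <=
    B%:R * (l1 (u 0%N) + D) + \sum_(t < T) a (B + t)%N * l1 (u (B + t)%N).
  apply: (@le_trans _ _ (\sum_(t < B + T) a t * l1 (u t))).
    by rewrite addnC big_split_ord /= lerDl sumr_ge0.
  rewrite big_split_ord /= lerD2r.
  rewrite (le_trans (ler_sum _ (fun (i : 'I_B) _ => ub i))) //.
  by rewrite sumr_const card_ord mulr_natl.
have sumstep : \sum_(t < T) a (B + t)%N * l1 (u (B + t)%N) <=
    (1 - kappa) * \sum_(t < T) a t * l1 (u t) + B%:R * D.
  rewrite (le_trans (ler_sum _ (fun (i : 'I_T) _ => step i))) //.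
  rewrite big_split /= -mulr_sumr lerD2l exchange_big /=.
  rewrite (@le_trans _ _ (\sum_(s < B) D)) //; last first.
    by rewrite sumr_const card_ord mulr_natl.
  by apply: ler_sum => s _; exact: (sum_shift_le (a := fun t => a t * l1 (d t))).
have BD : B%:R * D <= B%:R * (l1 (u 0%N) + D).
  by rewrite ler_wpM2l // lerDr l1_ge0.
have -> : 2 * B%:R / kappa * (l1 (u 0%N) + D) =
   (2 * (B%:R * (l1 (u 0%N) + D))) / kappa by rewrite mulrAC !mulrA.
by rewrite ler_pdivlMr //; nra.
Qed.

Section PushSum.
Variable (z : nat -> 'I_N -> R).
Hypotheses (z0 : z 0%N = fun=> 1)
  (zS : forall t, z t.+1 = fun i => \sum_j W t i j * z t j).

Lemma sum_push_weights t : \sum_i z t i = N%:R.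
Proof.
elim: t => [|t IH]; first by rewrite z0 sumr_const card_ord.
rewrite zS exchange_big /= -IH; apply: eq_bigr => j _.
by rewrite -mulr_suml (weight_col_stochastic t).2 mul1r.
Qed.

(** The total weight is always [N >= 1]. From time [B] on, each node holds at least the fraction
    [w ^+ B] of the total held [B] steps before; earlier, the diagonal entry alone carries
    [w ^+ t]. *)
Lemma push_weights_lbound : exists2 delta, 0 < delta & forall t i, delta <= z t i.
Proof.
have [B [w [/andP[w0 w1] trD trB]]] := transition_lbound.
exists (w ^+ B); first exact: exprn_gt0.
have zt s k i : z (s + k)%N i = \sum_j transition s k i j * z s j.
  elim: k i => [|k IH] i.
    rewrite addn0 (bigD1 i) //= big1 => [|j /negbTE ij].
      by rewrite mxE eqxx mul1r addr0.
    by rewrite mxE eq_sym ij mul0r.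
  rewrite addnS zS; under eq_bigr do rewrite IH mulr_sumr.
  rewrite exchange_big /=; apply: eq_bigr => j _.
  by rewrite mxE mulr_suml; apply: eq_bigr => l _; rewrite mulrA.
have zge0 t i : 0 <= z t i.
  elim: t i => [|t IH] i; first by rewrite z0.
  rewrite zS sumr_ge0 // => j _; rewrite mulr_ge0 //.
  by have [] := weight_col_stochastic t.
have N1 : 1 <= N%:R :> R by rewrite ler1n.
move=> t i; have [tB|tB] := ltnP t B; last first.
  rewrite -(subnK tB) zt; apply: (@le_trans _ _ (\sum_j w ^+ B * z (t - B)%N j)).
    rewrite -mulr_sumr sum_push_weights ler_peMr // exprn_ge0 //; exact: ltW.
  by apply: ler_sum => j _; rewrite ler_wpM2r.
rewrite -(add0n t) zt (bigD1 i) //= z0 mulr1.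
rewrite (le_trans (_ : _ <= w ^+ t)) //.
  by rewrite ler_wiXn2l ?(ltW w0) ?(ltW w1) ?(ltnW tB).
rewrite (le_trans (trD 0%N t i)) // lerDl sumr_ge0 // => j _.
by rewrite mulr1; have [] := transition_col_stochastic 0 t.
Qed.

Definition mean (v : 'I_N -> R) : R := N%:R^-1 * \sum_i v i.

Lemma mean_push_step t (v e : 'I_N -> R) :
  mean (fun i => \sum_j W t i j * v j + e i) = mean v + mean e.
Proof.
rewrite /mean -mulrDr; congr (_ * _); rewrite big_split /=; congr (_ + _).
rewrite exchange_big /=; apply: eq_bigr => j _.
by rewrite -mulr_suml (weight_col_stochastic t).2 mul1r.
Qed.

(* The deviation y - z * mean y is a zero-sum vector driven by the same weights. *)
Lemma push_sum_consensus : exists K : R, 0 <= K /\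
  forall (y e : nat -> 'I_N -> R) (a : nat -> R) D,
  (forall t i, y t.+1 i = \sum_j W t i j * y t j + e t i) ->
  (forall t, 0 <= a t <= 1) -> (forall s t, (s <= t)%N -> a t <= a s) ->
  (forall T, \sum_(t < T) a t * (\sum_i `|e t i|) <= D) ->
  forall T, \sum_(t < T) a t *
    (\sum_i `|(\sum_j W t i j * y t j) / z t.+1 i - mean (y t)|) <=
    K * (\sum_i `|y 0%N i| + D).
Proof.
have [delta delta0 zdelta] := push_weights_lbound.
have [K0 [K00 hK0]] := sum_zero_sum_contract.
exists (delta^-1 * K0 * 2); split.
  by rewrite mulr_ge0 // mulr_ge0 // invr_ge0 ltW.
move=> y e a D hy a01 amono aD T.
have a0 t : 0 <= a t by case/andP: (a01 t).
have N0 : N%:R != 0 :> R by rewrite pnatr_eq0 -lt0n.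
have NN : N%:R * N%:R^-1 = 1 :> R by rewrite divff.
(* Subtracting [z t i * mean v] costs at most another copy of the sum, because the weights [z t] add
   up to [N]. *)
have dev_le (v : 'I_N -> R) t :
    \sum_i `|v i - z t i * mean v| <= 2 * \sum_i `|v i|.
  have -> : 2 * \sum_i `|v i| = \sum_i `|v i| + N%:R * (N%:R^-1 * \sum_i `|v i|).
    by rewrite mulrA NN mul1r mulr2n mulrDl !mul1r.
  rewrite (@le_trans _ _ (\sum_i (`|v i| + z t i * `|mean v|))) //.
    apply: ler_sum => i _; rewrite (le_trans (ler_normB _ _)) // lerD2l.
    by rewrite normrM ger0_norm // (le_trans (ltW delta0)).
  rewrite big_split /= lerD2l -mulr_suml sum_push_weights ler_wpM2l ?ler0n //.
  by rewrite normrM ger0_norm ?invr_ge0 // ler_wpM2l ?invr_ge0 // ler_norm_sum.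
pose u t : 'cV[R]_N := \col_i (y t i - z t i * mean (y t)).
pose d t : 'cV[R]_N := \col_i (e t i - z t.+1 i * mean (e t)).
have meanS t : mean (y t.+1) = mean (y t) + mean (e t).
  by rewrite -(mean_push_step t); congr mean; apply/funext => i; rewrite hy.
have Wu t i : (W t *m u t) i 0 = \sum_j W t i j * y t j - z t.+1 i * mean (y t).
  rewrite mxE; under eq_bigr do rewrite mxE mulrBr mulrA.
  by rewrite sumrB -mulr_suml zS.
have uS t : u t.+1 = W t *m u t + d t.
  by apply/colP => i; rewrite [in RHS]mxE Wu !mxE hy meanS; ring.
have u0 t : \sum_i u t i 0 = 0.
  under eq_bigr do rewrite mxE.
  by rewrite sumrB -mulr_suml sum_push_weights /mean mulrA NN mul1r subrr.
have l1d t : l1 (d t) <= 2 * \sum_i `|e t i|.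
  by rewrite /l1; under eq_bigr do rewrite mxE; exact: dev_le.
have l1u t : l1 (u t) <= 2 * \sum_i `|y t i|.
  by rewrite /l1; under eq_bigr do rewrite mxE; exact: dev_le.
have hd S : \sum_(t < S) a t * l1 (d t) <= 2 * D.
  rewrite (@le_trans _ _ (2 * \sum_(t < S) a t * \sum_i `|e t i|)) //.
    by rewrite mulr_sumr; apply: ler_sum => t _; rewrite mulrCA ler_wpM2l.
  by rewrite ler_wpM2l.
(* Before division by the push weight, the error is the entry [i] of [W t *m u t]; the lower bound
   [delta] pays for the division. *)
have dev t : \sum_i `|(\sum_j W t i j * y t j) / z t.+1 i - mean (y t)| <=
    delta^-1 * l1 (u t).
  rewrite (le_trans _ (_ : delta^-1 * l1 (W t *m u t) <= _)) //; last first.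
    rewrite ler_wpM2l ?invr_ge0 ?(ltW delta0) //.
    exact: l1_col_stochastic (weight_col_stochastic t).
  rewrite mulr_sumr; apply: ler_sum => i _; rewrite Wu.
  have zi : 0 < z t.+1 i by apply: lt_le_trans (zdelta _ _).
  set b := \sum_j _.
  have -> : b / z t.+1 i - mean (y t) = (z t.+1 i)^-1 * (b - z t.+1 i * mean (y t)).
    by field; rewrite gt_eqF.
  rewrite normrM ger0_norm ?invr_ge0 ?(ltW zi) // ler_wpM2r //.
  by rewrite lef_pV2 ?posrE.
rewrite (@le_trans _ _ (\sum_(t < T) delta^-1 * (a t * l1 (u t)))) //.
  by apply: ler_sum => t _; rewrite mulrCA ler_wpM2l.
rewrite -mulr_sumr -!mulrA ler_wpM2l ?invr_ge0 ?(ltW delta0) //.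
rewrite (le_trans (hK0 u d a (2 * D) uS u0 a01 amono hd T)) //.
by rewrite ler_wpM2l // mulrDr lerD2r.
Qed.

End PushSum.
End Consensus.

(** * Minimax and the Minty variational inequality *)

Lemma cvg_sumr {R : realType} {V : normedModType R} {T I : Type}
    (F : set_system T) (FF : Filter F) (r : seq I) (f : I -> T -> V) (l : I -> V) :
  (forall i, f i x @[x --> F] --> l i) ->
  (\sum_(i <- r) f i x) @[x --> F] --> \sum_(i <- r) l i.
Proof.
move=> fl; elim: r => [|i r IH].
  by rewrite big_nil; under eq_fun do rewrite big_nil; exact: cvg_cst.
by rewrite big_cons; under eq_fun do rewrite big_cons; exact: cvgD.
Qed.

Lemma continuous_sumr {R : realType} {V : normedModType R} {T : topologicalType}
    {I : Type} (r : seq I) (f : I -> T -> V) :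
  (forall i, continuous (f i)) -> continuous (fun x => \sum_(i <- r) f i x).
Proof. by move=> fc x; apply: (@cvg_sumr _ _ _ _ (nbhs x)) => i; exact: fc. Qed.

Lemma closed_preimage {T U : topologicalType} (f : T -> U) (D : set U) :
  continuous f -> closed D -> closed (f @^-1` D).
Proof. by move=> fc; apply: preimage_closed => x _; exact: fc. Qed.

Lemma lconvex_combination {R : realType} {V : lmodType R} (C : set V) k
    (c : 'I_k -> R) (x : 'I_k -> V) : lconvex C ->
  (forall j, 0 <= c j) -> \sum_j c j = 1 -> (forall j, C (x j)) ->
  C (\sum_j c j *: x j).
Proof.
move=> cC; elim: k c x => [|k IH] c x c0.
  by rewrite big_ord0 => /esym/eqP; rewrite oner_eq0.
rewrite !big_ord_recr /=; set l := c ord_max; set S := \sum_(i < k) _ => S1 Cx.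
have S0 : 0 <= S by rewrite sumr_ge0.
have l0 : 0 <= l by exact: c0.
have [Sz|Sn] := eqVneq S 0.
  have cz j : c (widen_ord (leqnSn k) j) = 0.
    have /eqP := Sz; rewrite psumr_eq0 // => /allP/(_ j (mem_index_enum _)).
    by move=> /eqP.
  rewrite big1 => [|j _]; last by rewrite cz scale0r.
  by have -> : l = 1 by [rewrite -S1 Sz add0r]; rewrite add0r scale1r.
have Sp : 0 < S by rewrite lt0r Sn.
have Cy : C (\sum_(i < k) (c (widen_ord (leqnSn k) i) / S) *: x (widen_ord (leqnSn k) i)).
  apply: IH => // [j|]; first by rewrite divr_ge0.
  by rewrite -mulr_suml divff.
have := cC _ _ l Cy (Cx ord_max); rewrite l0 -S1 lerDr S0 => /(_ isT).
set y := \sum_(i < k) (_ / _) *: _.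
have -> : \sum_(i < k) c (widen_ord (leqnSn k) i) *: x (widen_ord (leqnSn k) i) = S *: y.
  rewrite scaler_sumr; apply: eq_bigr => j _.
  by rewrite scalerA mulrC divfK.
have -> : S = 1 - l by rewrite -S1 addrK.
by rewrite scalerBr scalerBl scale1r addrA addrAC.
Qed.

Lemma slope_ge0 {R : realType} (S Q : R) :
  (forall t, 0 < t <= 1 -> 0 <= t * S + t ^+ 2 * Q) -> 0 <= S.
Proof.
move=> h; rewrite leNgt; apply/negP => S0.
have [Q0|Q0] := leP Q 0; first by have := h 1; rewrite ltr01 lexx => /(_ isT); nra.
pose t := Num.min 1 (- S / (2 * Q)).
have t0 : 0 < t by rewrite lt_min ltr01 divr_gt0 //; lra.
have t1 : t <= 1 by rewrite ge_min lexx.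
have tQ : t * (2 * Q) <= - S by rewrite -ler_pdivlMr ?mulr_gt0 // ge_min lexx orbT.
have := h t; rewrite t0 t1 => /(_ isT).
have -> : t * S + t ^+ 2 * Q = t * (S + t * Q) by ring.
by rewrite pmulr_rge0 //; lra.
Qed.

(* Minimise |(A lambda)_+|^2 over the simplex: at a minimiser, p = (A lambda)_+
   satisfies p^T A >= |p|^2 coordinatewise, whereas p^T A p <= 0. *)
Lemma skew_minimax {R : realType} k (A : 'M[R]_k.+1) :
  (forall i j, A i j + A j i <= 0) ->
  exists c : 'I_k.+1 -> R, [/\ forall j, 0 <= c j, \sum_j c j = 1 &
    forall i, \sum_j A i j * c j <= 0].
Proof.
move=> Askew.
pose D : set 'rV[R]_k.+1 := [set v | (forall j, 0 <= v 0 j) /\ \sum_j v 0 j = 1].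
pose Av (v : 'rV[R]_k.+1) i := \sum_j A i j * v 0 j.
pose f (v : 'rV[R]_k.+1) := \sum_i Num.max 0 (Av v i) ^+ 2.
have D0 : D !=set0.
  exists (delta_mx 0 0); split => [j|]; first by rewrite mxE ler0n.
  rewrite (bigD1 0) //= big1 => [|j /negbTE j0]; rewrite !mxE ?eqxx /= ?addr0 //.
  by rewrite j0.
have Dclosed : closed D.
  have -> : D = \bigcap_(j in [set: 'I_k.+1])
        (fun v : 'rV[R]_k.+1 => v 0 j) @^-1` [set y | 0 <= y] `&`
      (fun v : 'rV[R]_k.+1 => \sum_j v 0 j) @^-1` [set y | y = 1].
    apply/seteqP; split => v /= [h1 h2]; split => // j; first by move=> _; exact: h1.
    exact: h1.
  apply: closedI; first apply: closed_bigI => j _.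
    by apply: closed_preimage; [exact: coord_continuous|exact: closed_ge].
  apply: closed_preimage; last exact: closed_eq.
  by apply: continuous_sumr => j; exact: coord_continuous.
have Dcompact : compact D.
  apply: bounded_closed_compact => //; exists 1; split => [|M M1 v [v0 v1]].
    exact: num_real.
  rewrite /= (le_trans _ (ltW M1)) // -v1 [`|v|]mx_normrE; apply: bigmax_le => [|[i j] _].
    exact: sumr_ge0.
  by rewrite ord1 /= ger0_norm // (bigD1 j) //= lerDl sumr_ge0.
have fcont : continuous f.
  apply: continuous_sumr => i v; apply: (@continuous_comp _ _ _ (fun v => Num.max 0 (Av v i))
    (@GRing.exp R ^~ 2));
    last exact: exprn_continuous.
  apply: (@continuous_max _ _ (fun=> 0) (fun v => Av v i)); first exact: cst_continuous.
  apply: continuous_sumr => j x; apply: (@cvgMl_tmp _ _ (nbhs x) _ (fun x => x 0 j)). exact: coord_continuous.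
have [v /set_mem[v0 v1] vmin] :=
  EVT_min_rV D0 Dcompact (continuous_subspaceT fcont).
exists (fun j => v 0 j); split => //.
pose p i := Num.max 0 (Av v i).
have p0 i : 0 <= p i by rewrite le_max lexx.
have pAv i : p i * Av v i = p i ^+ 2.
  by rewrite /p maxEle; case: ifP => [_|_]; rewrite ?mul0r ?expr0n // expr2.
have opt j : \sum_i p i ^+ 2 <= \sum_i p i * A i j.
  pose b i := A i j - Av v i.
  suff : 0 <= 2 * \sum_i p i * b i.
    rewrite pmulr_rge0 //; under eq_bigr do rewrite mulrBr pAv.
    by rewrite sumrB subr_ge0.
  apply: (@slope_ge0 _ _ (\sum_i b i ^+ 2)) => t /andP[t0 t1].
  pose w := v + t *: (delta_mx 0 j - v).
  have wD : w \in D.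
    rewrite inE; split => [l|].
      have := v0 l; have : 0 <= (l == j)%:R :> R by rewrite ler0n.
      by rewrite !mxE /=; nra.
    under eq_bigr do rewrite !mxE /=.
    rewrite big_split /= -mulr_sumr sumrB v1.
    rewrite (bigD1 j) //= big1 ?eqxx => [|l /negbTE ->] //.
    by rewrite addr0 subrr mulr0 addr0.
  have Aw i : Av w i = Av v i + t * b i.
    rewrite /Av; under eq_bigr do rewrite !mxE /= mulrDr.
    rewrite big_split /=; congr (_ + _).
    under eq_bigr do rewrite mulrCA mulrBr.
    rewrite -mulr_sumr sumrB; congr (_ * (_ - _)).
    rewrite (bigD1 j) //= big1 ?eqxx => [|l /negbTE ->]; last by rewrite mulr0.
    by rewrite mulr1 addr0.
  have := vmin w wD; rewrite -subr_ge0 /f -sumrB => /le_trans; apply.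
  rewrite mulr_sumr mulr_sumr mulr_sumr -big_split /=; apply: ler_sum => i _.
  rewrite Aw -/(p i).
  (* Since [p] is the positive part at [v], this bounds the objective by a quadratic in [t] whose
     slope at 0 is [2 * \sum_i p i * b i]. *)
  have : Num.max 0 (Av v i + t * b i) ^+ 2 <= (p i + t * b i) ^+ 2.
    have pAi : Av v i <= p i by rewrite le_max lexx orbT.
    rewrite maxEle; case: ifP => [h|_]; last by rewrite expr0n sqr_ge0.
    by rewrite ler_sqr ?nnegrE //; lra.
  lra.
have pAp : \sum_j (\sum_i p i * A i j) * p j <= 0.
  rewrite -(@pmulr_rle0 _ 2) // mulr2n mulrDl mul1r.
  have -> : \sum_j (\sum_i p i * A i j) * p j = \sum_i \sum_j p i * p j * A i j.
    rewrite exchange_big /=; apply: eq_bigr => j _; rewrite mulr_suml.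
    by apply: eq_bigr => i _; rewrite mulrAC.
  rewrite [X in _ + X <= _]exchange_big /= -big_split /=; apply: sumr_le0 => i _.
  rewrite -big_split /=; apply: sumr_le0 => j _.
  by rewrite (mulrC (p j)) -mulrDr mulr_ge0_le0 // mulr_ge0.
move=> i; rewrite leNgt; apply/negP => Ai.
have pi : 0 < p i by rewrite /p lt_max Ai orbT.
have Q0 : 0 < \sum_i p i ^+ 2.
  by rewrite (bigD1 i) //= ltr_wpDr ?exprn_gt0 // sumr_ge0 // => j _; rewrite sqr_ge0.
have : \sum_j (\sum_i p i ^+ 2) * p j <= 0.
  by apply: (le_trans _ pAp); apply: ler_sum => j _; rewrite ler_wpM2r.
rewrite -mulr_sumr pmulr_rle0 // leNgt => /negP; apply.
by rewrite (bigD1 i) //= ltr_wpDr // sumr_ge0.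
Qed.

Section Minty.
Context {R : realType} {V : normedModType R}.
Variables (K : set V) (f : V -> V -> R).
Hypotheses (K0 : K !=set0) (Kconvex : lconvex K) (Kcompact : compact K).
Hypothesis fmono : forall u v, K u -> K v -> f u v + f v u <= 0.
Hypothesis fconvex : forall w u v (t : R), K w -> K u -> K v -> 0 <= t <= 1 ->
  f w (u + t *: (v - u)) <= f w u + t * (f w v - f w u).
Hypothesis flsc : forall v, K v -> closed [set u | K u /\ f v u <= 0].

(** The weights given by [skew_minimax] for the matrix [f (v i) (v j)] define a mixture of the
    [v j]; convexity of [f (v i)] bounds its value there by a row of the matrix applied to the
    weights. No fixed-point theorem enters. *)
Lemma minty_finite k (v : 'I_k -> V) : (forall j, K (v j)) ->
  exists2 u, K u & forall j, f (v j) u <= 0.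
Proof.
case: k v => [|k] v Kv; first by have [u Ku] := K0; exists u => // -[].
have [c [c0 c1 cA]] := @skew_minimax R k (\matrix_(i, j) f (v i) (v j))
  (fun i j => ltac:(by rewrite !mxE; apply: fmono)).
pose u := \sum_j c j *: v j.
exists u => [|i]; first exact: lconvex_combination.
(* The inequality for finite convex combinations is read off the epigraph of [f (v i)], a convex
   subset of a product space, so that [lconvex_combination] serves again. *)
pose epi : set (V * R^o) := [set q | K q.1 /\ f (v i) q.1 <= q.2].
have cepi : lconvex epi.
  move=> [x a] [y b] t [/= Kx fx] [/= Ky fy] /andP[t0 t1].
  split => /=; first by apply: Kconvex; rewrite ?t0.
  have := fconvex (Kv i) Kx Ky (t := t); rewrite t0 t1 => /(_ isT).
  by rewrite /GRing.scale /=; nra.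
have := lconvex_combination (x := fun j => (v j, f (v i) (v j)) : V * R^o) cepi c0 c1.
have -> : \sum_j c j *: ((v j, f (v i) (v j)) : V * R^o) =
    (u, \sum_j c j * f (v i) (v j)).
  rewrite /u; elim/big_rec3: _ => // j x y z _ -> /=.
  by congr (_, _).
move=> /(_ (fun j => conj (Kv j) (lexx _)))[_ /= h].
apply: (le_trans h); apply: (le_trans _ (cA i)).
by apply: ler_sum => j _; rewrite mxE mulrC.
Qed.

(** The sets of those [u] with [f v u <= 0] are closed in a compact set and have the finite
    intersection property by [minty_finite]. *)
Lemma minty : exists2 u, K u & forall v, K v -> f v u <= 0.
Proof.
have := Kcompact; rewrite compact_In0 => /(_ V K (fun v => [set u | K u /\ f v u <= 0])).
case.
- exists (fun v => [set u | K u /\ f v u <= 0]) => // v Kv.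
  by apply/seteqP; split => u // [].
- move=> D' D'K.
  have [u Ku hu] := @minty_finite (size (finmap.enum_fset D'))
    (fun j => tnth (in_tuple (finmap.enum_fset D')) j)
    (fun j => ltac:(by apply/set_mem/D'K; exact: mem_tnth)).
  exists u => v /= vD'; split => //.
  have /tnthP[j ->] : v \in in_tuple (finmap.enum_fset D') by [].
  exact: hu.
- move=> u hu; have [v0 Kv0] := K0.
  by exists u => [|v Kv]; [have [] := hu v0 Kv0|have [] := hu v Kv].
Qed.

End Minty.

(** * Differential calculus *)

Section Calculus.
Context {R : realType}.

Lemma continuous_colsub k l (f : 'I_l -> 'I_k) :
  continuous (fun u : 'rV[R]_k => colsub f u).
Proof.
move=> u s /nbhs_ballP[e e0 es]; apply/nbhs_ballP; exists e => //= v [_ uv].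
by apply: es; split => // i j; rewrite !mxE; exact: uv.
Qed.

Lemma cvg_at_rightW {T : topologicalType} (f : R -> T) (x : R) (l : T) :
  f @ x^' --> l -> f @ x^'+ --> l.
Proof.
by apply: cvg_trans; apply: cvg_app => A; rewrite /at_right /dnbhs !nbhs_simpl /within /=;
  apply: filterS => y Ay xy; apply: Ay; rewrite gt_eqF.
Qed.

Lemma diff_quotient_cvg (V W : normedModType R) (f : V -> W) a v :
  differentiable f a ->
  t^-1 *: (f (a + t *: v) - f a) @[t --> 0^'+] --> 'd f a v.
Proof.
move=> fa; rewrite -(deriveE v fa).
rewrite (_ : (fun t => _) = fun h => h^-1 *: ((f \o shift a) (h *: v) - f a)).
  exact: cvg_at_rightW (@diff_derivable _ _ _ f a v fa).
by apply/funext => t /=; rewrite (addrC a).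
Qed.

Lemma segment_cvg (V : normedModType R) (a v : V) :
  a + t *: v @[t --> 0^'+] --> a.
Proof.
apply: cvg_at_right_filter; rewrite -[X in _ --> X]addr0 -(scale0r v).
by apply: cvgD; [exact: cvg_cst|apply: cvgZr_tmp; exact: cvg_id].
Qed.

Definition lconvex_on (V : lmodType R) (C : set V) (f : V -> R) :=
  forall (x y : V) (t : R), C x -> C y -> 0 <= t <= 1 ->
    f (x + t *: (y - x)) <= f x + t * (f y - f x).

Lemma conv_line (V : lmodType R) (x y : V) (t : {i01 R}) :
  @conv R (convex_lmodType V) t y x = x + t%:num *: (y - x).
Proof.
rewrite /conv /= /unstable.onem scalerBl scalerBr scale1r addrCA; congr (_ + _).
Qed.

Lemma i01_exists (t : R) : 0 <= t <= 1 -> exists s : {i01 R}, s%:num = t.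
Proof.
by case/andP=> t0 t1; exists (Itv01 t0 t1).
Qed.

Lemma convex_set_lconvex (V : lmodType R) (C : set V) : convex_set C -> lconvex C.
Proof.
move=> cC x y t Cx Cy /i01_exists[s <-].
by rewrite -conv_line; apply/set_mem/cC; exact/mem_set.
Qed.

Lemma convex_function_lconvex_on (V : lmodType R) (C : set V) (f : V -> R) :
  convex_function C f -> lconvex_on C f.
Proof.
move=> cf x y t Cx Cy /i01_exists[s <-].
rewrite -conv_line (le_trans (cf s y x (mem_set Cy) (mem_set Cx))) //.
by rewrite convRE /unstable.onem; lra.
Qed.

Lemma convex_diff_le (V : normedModType R) (C : set V) (f : V -> R) a b :
  lconvex_on C f -> C a -> C b -> differentiable (f : V -> R^o) a ->
  'd (f : V -> R^o) a (b - a) <= f b - f a.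
Proof.
move=> cf Ca Cb fa; have := diff_quotient_cvg (v := b - a) fa => h.
apply: (cvgr_to_le h); near=> t.
have t0 : 0 < t by [].
have t1 : t <= 1 by near: t; exact: nbhs_right_le.
have := cf a b t Ca Cb; rewrite (ltW t0) t1 => /(_ isT) ft.
by rewrite /GRing.scale /= mulrC ler_pdivrMr //; lra.
Unshelve. all: by end_near. Qed.

Lemma dot_grad k (h : 'rV[R]_k -> R) (a v : 'rV[R]_k) :
  dot (grad h a) v = 'd (h : 'rV[R]_k -> R^o) a v.
Proof.
rewrite [in RHS](row_delta v) linear_sum /=; apply: eq_bigr => j _.
by rewrite linearZ /= mxE mulrC.
Qed.

Lemma diff_partial_l (U V W : normedModType R) (F : U * V -> W) a y v :
  differentiable F (a, y) ->
  differentiable (fun b => F (b, y)) a /\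
  'd (fun b => F (b, y)) a v = 'd F (a, y) (v, 0).
Proof.
move=> dF; have di : differentiable (fun b : U => (b, y)) a.
  by apply: differentiable_pair; [exact: ex_diff|exact: differentiable_cst].
split; first exact: (differentiable_comp di dF).
rewrite (diff_comp di dF) /= diff_pair //.
by rewrite diff_cst diff_val.
Qed.

Lemma diff_partial_r (U V W : normedModType R) (F : U * V -> W) a y w :
  differentiable F (a, y) ->
  differentiable (fun b => F (a, b)) y /\
  'd (fun b => F (a, b)) y w = 'd F (a, y) (0, w).
Proof.
move=> dF; have di : differentiable (fun b : V => (a, b)) y.
  by apply: differentiable_pair; [exact: differentiable_cst|exact: ex_diff].
split; first exact: (differentiable_comp di dF).
rewrite (diff_comp di dF) /= diff_pair //.
by rewrite diff_cst diff_val.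
Qed.

Lemma diff_affine (V W : normedModType R) (psi : V -> W) (c : R) (s : W) a :
  differentiable psi a ->
  'd (fun b => c *: psi b + s) a = c \*: 'd psi a :> (V -> W).
Proof.
move=> dpsi; have dZ : differentiable (c \*: psi) a by exact: differentiableZ.
have h := diffD dZ (differentiable_cst s a).
rewrite diff_cst in h; rewrite -(diffZ c dpsi).
by refine (etrans h _); apply/funext => w; exact: addr0.
Qed.

(** Chain rule through the aggregate: the vector on the right is the expression of [agg_grad], so
    [pgrad] is the gradient of [own_cost], which counts the effect of a player's own action on the
    aggregate. *)
Lemma diff_own k n (F : 'rV[R]_k * 'rV[R]_n -> R) (psi : 'rV[R]_k -> 'rV[R]_n)
    (c : R) (s : 'rV[R]_n) a v :
  differentiable (F : _ -> R^o) (a, c *: psi a + s) -> differentiable psi a ->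
  differentiable ((fun b => F (b, c *: psi b + s)) : _ -> R^o) a /\
  'd ((fun b => F (b, c *: psi b + s)) : _ -> R^o) a v =
  dot (grad (fun b => F (b, c *: psi a + s)) a +
       c *: (grad (fun y => F (a, y)) (c *: psi a + s) *m ('J psi a)^T)) v.
Proof.
move=> dF dpsi; set y := c *: psi a + s in dF *.
have dg : differentiable (fun b => c *: psi b + s) a.
  by apply: differentiableD; [exact: differentiableZ|exact: differentiable_cst].
have dh : differentiable (fun b => (b, c *: psi b + s)) a.
  by apply: differentiable_pair; first exact: ex_diff.
split; first exact: (differentiable_comp dh dF).
rewrite (diff_comp dh dF) /= diff_pair //= diff_val.
have -> : 'd (fun b => c *: psi b + s) a v = c *: (v *m 'J psi a).
  by rewrite diff_affine // /jacobian mul_rV_lin1.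
rewrite dotDl dotZl dot_mulmx_tr !dot_grad.
have [_ ->] := diff_partial_l v dF; have [_ ->] := diff_partial_r (v *m 'J psi a) dF.
have -> : (v, c *: (v *m 'J psi a)) = (v, 0) + c *: (0, v *m 'J psi a).
  by congr (_, _); rewrite /= ?scaler0 ?addr0 ?add0r.
by rewrite linearD linearZ.
Qed.

Lemma closed_sublevel (V : normedModType R) (C : set V) (h : V -> R) :
  closed C -> (forall u, C u -> {for u, continuous h}) ->
  closed [set u | C u /\ h u <= 0].
Proof.
move=> cC hc u clu; have Cu : C u.
  by apply: cC => B /clu[w [[Cw _] Bw]]; exists w.
split => //; rewrite leNgt; apply/negP => hu.
have /clu[w [[_ hw]]] : nbhs u [set w | 0 < h w].
  exact: (@cvgr_gt _ _ (nbhs u) _ _ _ (hc u Cu)).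
by rewrite /= ltNge hw.
Qed.

End Calculus.

(** * The game and its saddle points *)

Section GameFacts.
Context {R : realType} {d : measure_display} {Omega : measurableType d}
  {P : probability Omega R} {N n m : nat} (G : aggGame P N n m).
Hypotheses (hN : (0 < N)%N) (hgame : game_assumption G)
  (hlip : lipschitz_assumption G) (hmono : strictly_monotone G).
Implicit Types (x y : profile G) (mu nu : 'rV[R]_m).

Definition pg x i := pgrad G i (x i) (sigma G x).

Lemma strat_lconvex i : lconvex (strat G i).
Proof. by case: hgame => /(_ i)[_ /convex_set_lconvex]. Qed.

Lemma strat_compact i : compact (strat G i).
Proof. by case: hgame => /(_ i)[]. Qed.

Lemma strat_closed i : closed (strat G i).
Proof. by apply: compact_closed; [exact: norm_hausdorff|exact: strat_compact]. Qed.

Lemma strat_nonempty i : strat G i !=set0.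
Proof. by case: hgame => /(_ i)[]. Qed.

Lemma constr_lconvex i k : lconvex_on (strat G i) (fun v => constr G i v 0 k).
Proof. by case: hgame => _ _ _ /(_ i k)[_ /convex_function_lconvex_on]. Qed.

Lemma constr_comp_differentiable i k a : strat G i a ->
  differentiable ((fun v => constr G i v 0 k) : _ -> R^o) a.
Proof. by case: hgame => _ _ _ /(_ i k)[h _] _; exact: h. Qed.

Lemma constr_differentiable i a : strat G i a -> differentiable (constr G i) a.
Proof.
move=> ia.
have -> : constr G i = fun v => \sum_(k < m) constr G i v 0 k *: delta_mx 0 k.
  by apply/funext => v; exact: row_delta.
rewrite (_ : (fun v => _) = \sum_(k < m) fun v => constr G i v 0 k *: delta_mx 0 k).
  apply: differentiable_sum => k; apply: differentiableZl.
  exact: constr_comp_differentiable.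
by apply/funext => v; rewrite fct_sumE.
Qed.

Lemma agg_differentiable i a : strat G i a -> differentiable (agg G i) a.
Proof. by case: hgame => _ _ _ _ [h _ _]; exact: h. Qed.

Lemma diff_comp_coord k l (f : 'rV[R]_k -> 'rV[R]_l) a v j :
  differentiable f a ->
  'd f a v 0 j = 'd ((fun w => f w 0 j) : _ -> R^o) a v.
Proof.
move=> df.
have dc : differentiable (fun N : 'rV[R]_l => N 0 j : R^o) (f a).
  exact: differentiable_coord.
rewrite (diff_comp df dc) /=.
pose c := (fun N : 'rV[R]_l => N 0 j : R^o).
have lc : linear c by move=> b u w; rewrite /c !mxE.
pose cL : {linear 'rV[R]_l -> R^o} := HB.pack c (GRing.isLinear.Build _ _ _ _ _ lc).
rewrite -[RHS]/('d cL (f a) ('d f a v)) diff_lin //.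
exact: coord_continuous.
Qed.

Lemma dot_constr_grad i a mu v : strat G i a ->
  dot (mu *m (constr_grad G i a)^T) v =
  \sum_k mu 0 k * 'd ((fun w => constr G i w 0 k) : _ -> R^o) a v.
Proof.
move=> ia; rewrite dot_mulmx_tr /constr_grad /jacobian mul_rV_lin1.
by apply: eq_bigr => k _; rewrite diff_comp_coord //; exact: constr_differentiable.
Qed.

Lemma constr_grad_le i a b mu : strat G i a -> strat G i b -> orthant mu ->
  dot (mu *m (constr_grad G i a)^T) (b - a) <=
  dot mu (constr G i b) - dot mu (constr G i a).
Proof.
move=> ia ib mu0; rewrite dot_constr_grad // -dotBr; apply: ler_sum => k _.
rewrite !mxE ler_wpM2l //; apply: (convex_diff_le (@constr_lconvex i k)) => //.
exact: constr_comp_differentiable.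
Qed.

Lemma own_cost_lconvex i x : lconvex_on (strat G i) (own_cost G i x).
Proof. by case: hgame => _ _ [_ /(_ i x)/convex_function_lconvex_on]. Qed.

Lemma sigma_own i x :
  sigma G x = N%:R^-1 *: agg G i (x i) + sigma_others G i x.
Proof. by rewrite /sigma /sigma_others (bigD1 i) //= scalerDr. Qed.

Lemma diff_own_cost i x a v : strat G i a ->
  differentiable (own_cost G i x : _ -> R^o) a /\
  'd (own_cost G i x : _ -> R^o) a v =
  dot (pgrad G i a (N%:R^-1 *: agg G i a + sigma_others G i x)) v.
Proof.
move=> ia; case: hgame => _ _ [hc _] _ _.
exact: (diff_own v (hc i a _ ia) (agg_differentiable ia)).
Qed.

Lemma diff_own_cost_at i x v : strat G i (x i) ->
  'd (own_cost G i x : _ -> R^o) (x i) v = dot (pg x i) v.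
Proof. by move=> ix; rewrite /pg (sigma_own i) (diff_own_cost x v ix).2. Qed.

Lemma own_cost_gradient_le i x a b : strat G i a -> strat G i b ->
  dot (pgrad G i a (N%:R^-1 *: agg G i a + sigma_others G i x)) (b - a) <=
  own_cost G i x b - own_cost G i x a.
Proof.
move=> ia ib; have [da <-] := diff_own_cost x (b - a) ia.
exact: convex_diff_le (@own_cost_lconvex i x) ia ib da.
Qed.

Lemma stack_inj x y : stack G x = stack G y -> x = y.
Proof.
by move=> /eq_mxrowP xy; apply: functional_extensionality_dep.
Qed.

(** The quantity of [strictly_monotone], written block by block. *)
Definition gap x y : R := \sum_i dot (pg x i - pg y i) (x i - y i).

Lemma gap_gt0 x y : strats G x -> strats G y -> x <> y -> 0 < gap x y.
Proof.
move=> hx hy xy; have := hmono hx hy.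
rewrite /pseudo_grad /stack -!mxrowB dot_mxrow; apply.
by apply/eqP => /stack_inj.
Qed.

Lemma gap_ge0 x y : strats G x -> strats G y -> 0 <= gap x y.
Proof.
move=> hx hy; have [->|/gap_gt0 h] := pselect (x = y); last by rewrite ltW ?h.
by rewrite /gap big1 // => i _; rewrite subrr dot0l.
Qed.

(** Saddle point of the Lagrangian with only the costs linearised: the constraints enter through
    their values, as convexity allows. This form is what the minimax argument produces and what the
    Lyapunov estimate uses; [vGNE_saddle] and [saddle_vGNE] tie it to the KKT conditions. *)
Record saddle (xs : profile G) (mu : 'rV[R]_m) : Prop := Saddle {
  saddle_strats : strats G xs;
  saddle_mu_ge0 : orthant mu;
  saddle_feasible : forall k, constr_sum G xs 0 k <= 0;
  saddle_slack : dot mu (constr_sum G xs) = 0;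
  saddle_vi : forall y, strats G y ->
    0 <= \sum_i dot (pg xs i) (y i - xs i) + dot mu (constr_sum G y) }.

Lemma dot_orthant_le0 mu (v : 'rV[R]_m) :
  orthant mu -> (forall k, v 0 k <= 0) -> dot mu v <= 0.
Proof. by move=> mu0 v0; apply: sumr_le0 => k _; rewrite mulr_ge0_le0. Qed.

(** Slackness comes from testing the normal cone of the orthant at 0; the gradient inequality for
    the convex constraints then trades their gradients for values. *)
Lemma vGNE_saddle xs : is_vGNE G xs -> exists mu, saddle xs mu.
Proof.
move=> [[[hs hf] _] [mu [mu0 stat [s hs' /eqP]]]].
rewrite addrC subr_eq0 => /eqP es; rewrite es in hs' => {s es}.
exists mu; split => //.
  apply/eqP; rewrite eq_le dot_orthant_le0 //=.
  have /hs' : orthant (0 : 'rV[R]_m) by move=> k; rewrite mxE.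
  by rewrite sub0r dotNr oppr_le0 dotC.
move=> y hy; have slack : 0 <= dot mu (constr_sum G xs).
  have /hs' : orthant (0 : 'rV[R]_m) by move=> k; rewrite mxE.
  by rewrite sub0r dotNr oppr_le0 dotC.
apply: (@le_trans _ _ (\sum_i (dot (pg xs i) (y i - xs i) +
    (dot mu (constr G i (y i)) - dot mu (constr G i (xs i)))))); last first.
  rewrite big_split /= lerD2l sumrB -!dot_sumr -/(constr_sum G y).
  by rewrite gerBl.
apply: sumr_ge0 => i _; have [s ns e] := stat i.
have := ns (y i) (hy i); have -> : s = - (pg xs i + mu *m (constr_grad G i (xs i))^T).
  by apply/eqP; rewrite -addr_eq0 addrC; apply/eqP.
rewrite dotNl oppr_le0 dotDl => /le_trans; apply.
by rewrite lerD2l; exact: constr_grad_le.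
Qed.

Lemma dotBB k (a b u v : 'rV[R]_k) :
  dot (a - b) (u - v) = - (dot a (v - u) + dot b (u - v)).
Proof. by rewrite !(dotBl, dotBr); ring. Qed.

(** Each variational inequality is tested at the other solution. Feasibility makes both multiplier
    terms nonpositive, so the gap between two distinct solutions would be nonpositive. *)
Lemma saddle_uniq xs xs' mu mu' : saddle xs mu -> saddle xs' mu' -> xs = xs'.
Proof.
move=> h h'; apply: contrapT => ne.
have := gap_gt0 (saddle_strats h) (saddle_strats h') ne.
have h1 := saddle_vi h (saddle_strats h').
have h2 := saddle_vi h' (saddle_strats h).
have h3 := dot_orthant_le0 (saddle_mu_ge0 h) (saddle_feasible h').
have h4 := dot_orthant_le0 (saddle_mu_ge0 h') (saddle_feasible h).
have -> : gap xs xs' = - \sum_i dot (pg xs i) (xs' i - xs i) -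
    \sum_i dot (pg xs' i) (xs i - xs' i).
  rewrite -opprD -big_split -sumrN /=; apply: eq_bigr => i _.
  exact: dotBB.
lra.
Qed.

Definition upd x i (a : 'rV[R]_(Defs.dim G i)) : profile G := dfwith x i a.

Lemma saddle_block xs mu i a : saddle xs mu -> strat G i a ->
  0 <= dot (pg xs i) (a - xs i) + dot mu (constr_sum G (upd xs a)) /\
  constr_sum G (upd xs a) =
    constr G i a + \sum_(j | j != i) constr G j (xs j).
Proof.
move=> h ia; have e : constr_sum G (upd xs a) =
    constr G i a + \sum_(j | j != i) constr G j (xs j).
  rewrite /constr_sum (bigD1 i) //= /upd dfwithin; congr (_ + _).
  by apply: eq_bigr => j ji; rewrite dfwithout // eq_sym.
split => //; have hu : strats G (upd xs a).
  move=> j; have [<-|ij] := eqVneq i j; first by rewrite /upd dfwithin.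
  by rewrite /upd dfwithout //; exact: saddle_strats h j.
have := saddle_vi h hu; rewrite (bigD1 i) //= {1}/upd dfwithin big1 ?addr0 //.
by move=> j ji; rewrite /upd dfwithout 1?eq_sym // subrr dot0r.
Qed.

(** Optimality of each player: a unilateral deviation is tested in the variational inequality, and
    convexity of [own_cost] turns the gradient bound into a cost bound. Stationarity: the same
    inequality at [xs i + t *: v], divided by [t], as [t] tends to 0. *)
Lemma saddle_vGNE xs mu : saddle xs mu -> is_vGNE G xs.
Proof.
move=> h; have hs := saddle_strats h; have mu0 := saddle_mu_ge0 h.
split.
  split=> [|i a ia fa]; first by split => //; exact: saddle_feasible h.
  rewrite -subr_ge0; apply: le_trans (own_cost_gradient_le xs (hs i) ia).
  have [h1 e] := saddle_block h ia; rewrite -sigma_own -/(pg xs i).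
  rewrite -e in fa; have := dot_orthant_le0 mu0 fa; lra.
exists mu; split => // [i|].
  exists (- (pg xs i + mu *m (constr_grad G i (xs i))^T)); last by rewrite subrr.
  move=> y iy; rewrite dotNl oppr_le0 dotDl dot_constr_grad //.
  set v := y - xs i.
  have lim : \sum_k mu 0 k * (t^-1 *: (constr G i (xs i + t *: v) 0 k -
        constr G i (xs i) 0 k : R^o)) @[t --> 0^'+] -->
      \sum_k mu 0 k * 'd ((fun w => constr G i w 0 k) : _ -> R^o) (xs i) v.
    apply: (@cvg_sumr _ R^o) => k; apply: cvgMl_tmp; apply: diff_quotient_cvg.
    exact: constr_comp_differentiable.
  apply: (cvgr_to_ge (cvgD (cvg_cst (dot (pg xs i) v)) lim)).
  near=> t; have t0 : 0 < t by [].
  have t1 : t <= 1 by near: t; exact: nbhs_right_le.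
  have /(saddle_block h)[h1 e] : strat G i (xs i + t *: v).
    by apply: strat_lconvex; rewrite // (ltW t0).
  have e0 : dot mu (constr_sum G (upd xs (xs i + t *: v))) =
     dot mu (constr G i (xs i + t *: v) - constr G i (xs i)).
    rewrite e -[RHS]addr0 -(saddle_slack h) -dotDr; congr dot.
    by rewrite /constr_sum [in RHS](bigD1 i) //= addrA subrK.
  have e1 : xs i + t *: v - xs i = t *: v by rewrite addrC addKr.
  rewrite e0 e1 dotZr in h1.
  rewrite -(pmulr_rge0 _ t0) mulrDr /=; congr (0 <= _): h1; congr (_ + _).
  rewrite mulr_sumr; apply: eq_bigr => k _.
  by rewrite !mxE mulrCA /GRing.scale /= mulVKf // gt_eqF.
exists (constr_sum G xs); last by rewrite addrC subrr.
move=> nu nu0; rewrite dotBr dotC (dotC _ mu) (saddle_slack h) subr0.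
exact: dot_orthant_le0 nu0 (saddle_feasible h).
Unshelve. all: by end_near. Qed.

End GameFacts.

(** * Existence of an equilibrium with multipliers confined to a box *)

Section SaddleExistence.
Context {R : realType} {d : measure_display} {Omega : measurableType d}
  {P : probability Omega R} {N n m : nat} (G : aggGame P N n m).
Hypotheses (hN : (0 < N)%N) (hgame : game_assumption G)
  (hlip : lipschitz_assumption G) (hmono : strictly_monotone G).
Implicit Types (x y : profile G) (mu nu : 'rV[R]_m).

Definition segment x y (t : R) : profile G := fun i => x i + t *: (y i - x i).

Lemma segment_strats x y t : strats G x -> strats G y -> 0 <= t <= 1 ->
  strats G (segment x y t).
Proof. by move=> hx hy t01 i; exact: (strat_lconvex hgame). Qed.

Lemma constr_sum_segment x y : strats G x -> forall nu,
  dot nu (constr_sum G (segment x y t)) @[t --> 0^'+] --> dot nu (constr_sum G x).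
Proof.
move=> hx nu; apply: (@cvg_sumr _ R^o) => k; apply: cvgMl_tmp.
rewrite summxE; under eq_fun do rewrite summxE.
apply: (@cvg_sumr _ R^o) => i; rewrite /segment.
have := differentiable_continuous (constr_comp_differentiable hgame k (hx i)).
by move=> hc; apply: continuous_cvg hc _; exact: segment_cvg.
Qed.

(** The quotient between the parameters [t] and [2 * t] has limit [2 d - d], with [d] the derivative
    of [own_cost] along the segment. It is the upper bound of [vi_segment_le]. *)
Lemma vi_limit x y : strats G x ->
  \sum_i t^-1 *: (own_cost G i x (x i + (2 * t) *: (y i - x i)) -
    own_cost G i x (x i + t *: (y i - x i)) : R^o) @[t --> 0^'+] -->
  \sum_i dot (pg x i) (y i - x i).
Proof.
move=> hx; apply: (@cvg_sumr _ R^o) => i; set v := y i - x i.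
have [dh _] := diff_own_cost hgame x v (hx i).
have q1 := diff_quotient_cvg (v := v) dh.
have q2 := diff_quotient_cvg (v := 2 *: v) dh.
rewrite diff_own_cost_at // in q1; rewrite diff_own_cost_at // dotZr in q2.
rewrite (_ : dot (pg x i) v = 2 * dot (pg x i) v - dot (pg x i) v); last first.
  by move: (dot _ _) => e; ring.
apply: cvg_trans (cvgB q2 q1).
apply: near_eq_cvg; near=> t; rewrite fctE /= scalerA (mulrC t).
by rewrite -[LHS]scalerBr; congr (_ *: _); rewrite opprB addrA subrK.
Unshelve. all: by end_near. Qed.

Lemma dot_scaled_le k (p u v w : 'rV[R]_k) D t :
  0 < t -> u - v = t *: w -> dot p (u - v) <= D -> dot p w <= t^-1 * D.
Proof. by move=> t0 ->; rewrite dotZr ler_pdivlMl. Qed.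

(** Stands in for continuity of the pseudo-gradient along a segment. The gradient inequality for the
    convex [own_cost] of player [i], from parameter [t] to [2 * t], bounds the inner product by a
    difference quotient. There the other players stay at [x], whereas [pg] moves them too; the
    aggregates differ by O(t), which the Lipschitz constants convert into [C * t]. *)
Lemma vi_segment_le x y : strats G x -> strats G y -> exists C : R,
  forall t, 0 < t -> 2 * t <= 1 ->
  \sum_i dot (pg (segment x y t) i) (y i - x i) <=
  \sum_i t^-1 *: (own_cost G i x (x i + (2 * t) *: (y i - x i)) -
    own_cost G i x (x i + t *: (y i - x i)) : R^o) + C * t.
Proof.
move=> hx hy; have [Lf Lf0 hLf] := hlip.
have [_ _ _ _ [_ [Ls Ls0 hLs] _]] := hgame.
pose S := \sum_j enorm (y j - x j).
exists (\sum_i Lf * (Ls * S) * enorm (y i - x i)) => t t0 t1.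
rewrite mulr_suml -big_split /=; apply: ler_sum => i _.
have hz : strats G (segment x y t) by apply: segment_strats => //; lra.
have h2t : strats G (segment x y (2 * t)) by apply: segment_strats => //; lra.
pose s := N%:R^-1 *: agg G i (segment x y t i) + sigma_others G i x.
have e2 : segment x y (2 * t) i - segment x y t i = t *: (y i - x i).
  by rewrite /segment opprD addrACA subrr add0r -scalerBl; congr (_ *: _); ring.
have h1 := dot_scaled_le t0 e2 (own_cost_gradient_le hgame x (hz i) (h2t i)).
rewrite -/s in h1.
have sig : enorm (sigma G (segment x y t) - s) <= Ls * S * t.
  rewrite (sigma_own i) /s opprD addrACA subrr add0r.
  rewrite /sigma_others -scalerBr enormZ ger0_norm ?invr_ge0 ?ler0n //.
  rewrite -sumrB (le_trans (_ : _ <= \sum_(j < N | j != i)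
      enorm (agg G j (segment x y t j) - agg G j (x j)))) //.
    rewrite (le_trans _ (enorm_sum _ _ _)) //.
    by rewrite ler_piMl ?enorm_ge0 // invf_le1 ?ltr0n ?ler1n.
  rewrite /S mulr_sumr mulr_suml [leRHS](bigID (fun j => j != i)) /=.
  rewrite ler_wpDr ?sumr_ge0 // => [j _|].
    by rewrite !mulr_ge0 ?enorm_ge0 // ltW.
  apply: ler_sum => j _; rewrite (le_trans (hLs _ _ _ (hz j) (hx j))) //.
  rewrite /segment (addrC (x j)) addrK enormZ gtr0_norm //.
  by rewrite -mulrA (mulrC t).
have h2 : dot (pgrad G i (segment x y t i) (sigma G (segment x y t)) -
    pgrad G i (segment x y t i) s) (y i - x i) <= Lf * (Ls * S) * enorm (y i - x i) * t.
  rewrite (le_trans (ler_dot _ _)) // mulrAC ler_wpM2r ?enorm_ge0 //.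
  by rewrite (le_trans (hLf _ _ (hz i) _ _)) // -mulrA ler_wpM2l // ltW.
by rewrite dotBl lerBlDr in h2; rewrite addrC (le_trans h2) // lerD2l.
Qed.

(** Profile and multiplier are packed into one row vector, so that compactness is closedness plus
    boundedness. *)
Let U := 'rV[R]_(\sum_i Defs.dim G i + m).

Definition primal (u : U) : profile G := fun i => submxrow (lsubmx u) i.
Definition dual (u : U) : 'rV[R]_m := rsubmx u.

Lemma primal_segment (u v : U) t :
  primal (u + t *: (v - u)) = segment (primal u) (primal v) t.
Proof.
apply: functional_extensionality_dep => i.
by apply/rowP => j; rewrite !mxE.
Qed.

Lemma dual_segment (u v : U) t :
  dual (u + t *: (v - u)) = dual u + t *: (dual v - dual u).
Proof. by apply/rowP => j; rewrite !mxE. Qed.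

Lemma primal_continuous i : continuous (fun u : U => primal u i).
Proof.
rewrite (_ : (fun u => _) =
    colsub (fun j => lshift m (tagnat.Rank i j))); first exact: continuous_colsub.
by apply/funext => u; apply/rowP => j; rewrite !mxE.
Qed.

Lemma dual_continuous : continuous dual.
Proof.
rewrite (_ : dual = colsub (fun j => rshift _ j)); first exact: continuous_colsub.
by apply/funext => u; apply/rowP => j; rewrite !mxE.
Qed.

Variable K : R.
Hypothesis K0 : 0 <= K.

Definition box : set 'rV[R]_m := [set mu | forall k, 0 <= mu 0 k <= K].

Definition boxed : set U := [set u | strats G (primal u) /\ box (dual u)].

(** Primal variational inequality plus dual slackness, based at [u] and tested at [v]. The
    multiplier terms are antisymmetric, so monotonicity of the bifunction is that of the
    pseudo-gradient. *)
Definition saddle_bifun (u v : U) : R :=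
  \sum_i dot (pg (primal u) i) (primal v i - primal u i) +
  dot (dual u) (constr_sum G (primal v)) - dot (dual v) (constr_sum G (primal u)).

Lemma boxed_pair y nu : strats G y -> box nu ->
  exists2 u, boxed u & primal u = y /\ dual u = nu.
Proof.
move=> hy hnu; have e : primal (row_mx (mxrow y) nu) = y.
  apply: functional_extensionality_dep => i.
  by rewrite /primal row_mxKl mxrowK.
have e2 : dual (row_mx (mxrow y) nu) = nu by exact: row_mxKr.
by exists (row_mx (mxrow y) nu) => //; split; rewrite ?e ?e2.
Qed.

Lemma boxed_nonempty : boxed !=set0.
Proof.
have [_ [[y [hy _]] _] _ _ _] := hgame.
have b0 : box 0 by move=> k; rewrite mxE lexx.
by have [u hu _] := boxed_pair hy b0; exists u.
Qed.

Lemma boxed_compact : compact boxed.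
Proof.
have [_ _ _ _ [_ _ [L [M [L0 _ hL]]]]] := hgame.
apply: bounded_closed_compact.
  exists (L + K); split => [|B LB u [hs hb]]; first exact: num_real.
  rewrite /= (le_trans _ (ltW LB)) // [`|u|]mx_normrE.
  apply: bigmax_le => [|[i j] _ /=]; first by rewrite addr_ge0 // ltW.
  rewrite ord1; case: (splitP j) => [j' jj'|k jk].
    rewrite (@le_trans _ _ L) ?lerDl //.
    have [+ _ _] := hL _ _ (hs (tagnat.sig1 j')); apply: le_trans.
    rewrite (le_trans _ (coord_le_enorm _ (tagnat.sig2 j'))) // !mxE.
    rewrite tagnat.sig2K le_eqVlt; apply/orP; left; apply/eqP; congr `|u _ _|.
    exact: val_inj.
  have := hb k; rewrite mxE; have -> : rshift _ k = j by exact: val_inj.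
  by case/andP=> u0 uK; rewrite ger0_norm // (le_trans uK) // lerDr ltW.
have -> : boxed = (\bigcap_i [set u | strat G i (primal u i)]) `&`
   (\bigcap_k ([set u | 0 <= dual u 0 k] `&` [set u | dual u 0 k <= K])).
  apply/seteqP; split=> u /=.
    by move=> [hs hb]; split => [i _|k _]; [exact: hs|have /andP[] := hb k].
  move=> [hs hb]; split => [i|k]; first exact: hs i I.
  by have [h1 h2] := hb k I; apply/andP.
have dk k : continuous (fun u : U => dual u 0 k).
  move=> u; apply: (@continuous_comp _ _ _ dual (fun v => v 0 k)).
    exact: dual_continuous.
  exact: coord_continuous.
apply: closedI; apply: closed_bigI => i _.
  exact: (closed_preimage (@primal_continuous i) (@strat_closed _ _ _ _ _ _ _ _ hgame i)).
apply: closedI.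
  exact: closed_preimage (dk i) (@closed_ge _ 0).
exact: closed_preimage (dk i) (@closed_le _ K).
Qed.

Lemma boxed_lconvex : lconvex boxed.
Proof.
move=> u v t [hu bu] [hv bv] t01; split.
  by rewrite primal_segment; exact: segment_strats.
rewrite dual_segment; move: (dual u) (dual v) bu bv => p q bp bq k.
rewrite !mxE; have /andP[a1 a2] := bp k; have /andP[b1 b2] := bq k.
by case/andP: t01 => t0 t1; apply/andP; split; nra.
Qed.

Lemma box_orthant mu : box mu -> orthant mu.
Proof. by move=> h k; case/andP: (h k). Qed.

Lemma saddle_bifun_mono u v :
  boxed u -> boxed v -> saddle_bifun u v + saddle_bifun v u <= 0.
Proof.
move=> [hu _] [hv _]; have := gap_ge0 hmono hu hv; rewrite /saddle_bifun /gap.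
set x := primal u; set y := primal v.
have -> : \sum_i dot (pg x i - pg y i) (x i - y i) =
   - (\sum_i dot (pg x i) (y i - x i) + \sum_i dot (pg y i) (x i - y i)).
  rewrite -big_split -sumrN /=; apply: eq_bigr => i _; exact: dotBB.
lra.
Qed.

Lemma constr_sum_lconvex mu x y t : strats G x -> strats G y -> orthant mu ->
  0 <= t <= 1 -> dot mu (constr_sum G (segment x y t)) <=
  dot mu (constr_sum G x) + t * (dot mu (constr_sum G y) - dot mu (constr_sum G x)).
Proof.
move=> hx hy mu0 t01; rewrite -dotBr -dotZr -dotDr; apply: ler_sum => k _.
rewrite ler_wpM2l // !mxE !summxE -sumrB mulr_sumr -big_split /=.
by apply: ler_sum => i _; apply: (@constr_lconvex _ _ _ _ _ _ _ G hgame i k).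
Qed.

Lemma saddle_bifun_convex w u v t : boxed w -> boxed u -> boxed v ->
  0 <= t <= 1 -> saddle_bifun w (u + t *: (v - u)) <=
    saddle_bifun w u + t * (saddle_bifun w v - saddle_bifun w u).
Proof.
move=> [_ bw] [hu _] [hv _] t01.
have := constr_sum_lconvex hu hv (box_orthant bw) t01.
rewrite /saddle_bifun primal_segment dual_segment dotDl dotZl dotBl.
set x := primal w; set y := primal u; set z := primal v.
have -> : \sum_i dot (pg x i) (segment y z t i - x i) =
    \sum_i dot (pg x i) (y i - x i) + t *
      (\sum_i dot (pg x i) (z i - x i) - \sum_i dot (pg x i) (y i - x i)).
  rewrite -sumrB mulr_sumr -big_split /=; apply: eq_bigr => i _.
  by rewrite /segment !(dotBr, dotDr, dotZr); move: (dot _ _) (dot _ _) (dot _ _) => a b c; ring.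
lra.
Qed.

Lemma saddle_bifun_lsc v : boxed v ->
  closed [set u | boxed u /\ saddle_bifun v u <= 0].
Proof.
move=> _; apply: closed_sublevel.
  by apply: compact_closed boxed_compact; exact: norm_hausdorff.
move=> u [hu _]; set x := primal v.
have cp i : (fun w : U => primal w i - x i) w @[w --> u] --> primal u i - x i.
  by apply: (@cvgB _ _ _ (nbhs u)); [exact: primal_continuous|exact: cvg_cst].
have cc k i : constr G i (primal w i) 0 k @[w --> u] --> constr G i (primal u i) 0 k.
  have := differentiable_continuous (constr_comp_differentiable hgame k (hu i)).
  by move=> hc; apply: (@continuous_cvg _ _ _ (nbhs u) _ _ _ _ hc); exact: primal_continuous.
rewrite /saddle_bifun /=; apply: (@cvgB _ _ _ (nbhs u)).
  apply: (@cvgD _ _ _ (nbhs u)).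
    apply: (@cvg_sumr _ R^o _ _ (nbhs u)) => i.
    apply: (@cvg_sumr _ R^o _ _ (nbhs u)) => j.
    apply: (@cvgMl_tmp _ _ (nbhs u)).
    exact: (@continuous_cvg _ _ _ (nbhs u) _ _ _ _
      (@coord_continuous _ _ _ 0 j _) (cp i)).
  apply: (@cvg_sumr _ R^o _ _ (nbhs u)) => k; apply: (@cvgMl_tmp _ _ (nbhs u)).
  rewrite summxE (_ : (fun w => constr_sum G (primal w) 0 k) =
      fun w => \sum_i constr G i (primal w i) 0 k).
    by apply: (@cvg_sumr _ R^o _ _ (nbhs u)) => i; exact: cc.
  by apply/funext => w; rewrite summxE.
apply: (@cvg_sumr _ R^o _ _ (nbhs u)) => k; apply: (@cvgM _ _ (nbhs u)).
  exact: (@continuous_cvg _ _ _ (nbhs u) _ _ _ _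
      (@coord_continuous _ _ _ 0 k _) (@dual_continuous u)).
exact: cvg_cst.
Qed.

(** From the Minty inequality to the direct one. The bifunction based at an intermediate point of
    the segment from [u] to [v] vanishes there and is nonpositive at [u], so convexity makes it
    nonnegative at [v]. Its value at [v] is at most [H t] by [vi_segment_le], and [t] tends to 0. *)
Lemma box_equilibrium : exists xs mu, [/\ strats G xs, box mu &
  forall y nu, strats G y -> box nu ->
    0 <= \sum_i dot (pg xs i) (y i - xs i) + dot mu (constr_sum G y) -
         dot nu (constr_sum G xs)].
Proof.
have [u Bu hu] := minty boxed_nonempty boxed_lconvex boxed_compact
  saddle_bifun_mono saddle_bifun_convex saddle_bifun_lsc.
exists (primal u), (dual u); have [hx bmu] := Bu; split => // y nu hy bnu.
have [v Bv [ey enu]] := boxed_pair hy bnu.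
set x := primal u in hx *; set mu := dual u in bmu *.
have [C hC] := vi_segment_le hx hy.
pose Q t : R := \sum_i t^-1 *: (own_cost G i x (x i + (2 * t) *: (y i - x i)) -
    own_cost G i x (x i + t *: (y i - x i)) : R^o).
pose H t := (1 - t) * (Q t + C * t) + (dot mu (constr_sum G y) +
  t * dot (nu - mu) (constr_sum G y)) - dot nu (constr_sum G (segment x y t)).
have H0 t : 0 < t -> 2 * t <= 1 -> 0 <= H t.
  move=> t0 t1; have t01 : 0 <= t <= 1 by lra.
  pose vt := u + t *: (v - u).
  have Bt : boxed vt by exact: boxed_lconvex.
  have h0 : saddle_bifun vt vt = 0.
    rewrite /saddle_bifun addrK big1 // => i _.
    by rewrite subrr dot0r.
  have := saddle_bifun_convex Bt Bu Bv t01; rewrite -/vt h0 => h1.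
  have h2 := hu _ Bt.
  have : 0 <= t * saddle_bifun vt v by case/andP: t01 => _ t1'; nra.
  rewrite pmulr_rge0 //; rewrite /saddle_bifun primal_segment dual_segment ey enu.
  rewrite -/x -/mu => /le_trans; apply; rewrite /H lerD2r dotDl dotZl lerD2r.
  rewrite (eq_bigr (fun i => (1 - t) * dot (pg (segment x y t) i) (y i - x i))).
    by rewrite -mulr_sumr ler_wpM2l ?hC // subr_ge0; case/andP: t01.
  move=> i _; rewrite -dotZr; congr dot; rewrite /segment.
  by rewrite opprD addrA scalerBl scale1r.
have limt : (fun t : R => t) t @[t --> 0^'+] --> (0 : R).
  by apply: cvg_at_right_filter; exact: cvg_id.
have limH : H t @[t --> 0^'+] --> (1 - 0) * (\sum_i dot (pg x i) (y i - x i) + C * 0) +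
    (dot mu (constr_sum G y) + 0 * dot (nu - mu) (constr_sum G y)) -
    dot nu (constr_sum G x).
  apply: cvgB; last exact: constr_sum_segment.
  apply: cvgD; last by apply: cvgD; [exact: cvg_cst|exact: cvgMr_tmp].
  apply: cvgM; first by apply: cvgB; [exact: cvg_cst|exact: limt].
  by apply: cvgD; [exact: vi_limit|exact: cvgMl_tmp].
move: limH; rewrite subr0 mul1r mulr0 addr0 mul0r addr0 => limH.
apply: (cvgr_to_ge limH); near=> t; apply: H0; first by [].
rewrite mulrC -ler_pdivlMr // mul1r; near: t.
by apply: nbhs_right_le; rewrite invr_gt0.
Unshelve. all: by end_near. Qed.

End SaddleExistence.

(** * Saddle points of the game, uniqueness, and a local lower bound on the gap *)

Section SaddlePoint.
Context {R : realType} {d : measure_display} {Omega : measurableType d}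
  {P : probability Omega R} {N n m : nat} (G : aggGame P N n m).
Hypotheses (hN : (0 < N)%N) (hgame : game_assumption G)
  (hlip : lipschitz_assumption G) (hmono : strictly_monotone G).

Lemma slater_margin : exists (y : profile G) (kappa : R), [/\ strats G y, 0 < kappa &
  forall mu, orthant mu -> dot mu (constr_sum G y) <= - kappa * \sum_k mu 0 k].
Proof.
have [_ [_ [y [hy sl]]] _ _ _] := hgame.
(* The unit 1 of the minimum keeps the margin positive when there is no constraint. *)
pose kappa := \big[Num.min/1]_(k < m) - constr_sum G y 0 k.
exists y, kappa; split => // [|mu mu0].
  by apply: lt_bigmin => // k _; rewrite oppr_gt0.
rewrite mulr_sumr; apply: ler_sum => k _; rewrite mulrC ler_wpM2r //.
by rewrite lerNr; apply: bigmin_le_cond.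
Qed.

(** Testing at the Slater point keeps every multiplier coordinate strictly below [C0 / kappa + 1],
    the size of the box. Each coordinate can then be raised, and the equilibrium inequality at [xs]
    itself forces the corresponding constraint to be nonpositive. *)
Lemma saddle_exists : exists (xs : profile G) mu, saddle xs mu.
Proof.
have [y [kappa [hy kappa0 hk]]] := slater_margin.
have [_ _ _ _ [_ _ [L [M [L0 _ hL]]]]] := hgame.
(* Computed with the gradient at the Slater point: the box must be chosen before [xs] is known, and
   monotonicity transfers the bound to the gradient at [xs]. *)
pose C0 := \sum_i enorm (pg y i) * (L + L).
have C00 : 0 <= C0.
  by apply: sumr_ge0 => i _; rewrite mulr_ge0 ?enorm_ge0 // addr_ge0 // ltW.
have K0 : 0 <= C0 / kappa + 1 by rewrite addr_ge0 // divr_ge0 // ltW.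
have [xs [mu [hx bmu heq]]] := box_equilibrium hN hgame hlip hmono K0.
have mu0 := box_orthant bmu.
have b0 : box (C0 / kappa + 1) (0 : 'rV[R]_m) by move=> k; rewrite mxE lexx.
have vi z : strats G z -> 0 <= \sum_i dot (pg xs i) (z i - xs i) +
    dot mu (constr_sum G z).
  by move=> hz; have := heq _ _ hz b0; rewrite dot0l subr0.
have muK k : mu 0 k < C0 / kappa + 1.
  apply: (@le_lt_trans _ _ (C0 / kappa)); last by rewrite ltrDl.
  rewrite ler_pdivlMr //.
  have h1 : \sum_i dot (pg xs i) (y i - xs i) <= C0.
    apply: (@le_trans _ _ (\sum_i dot (pg y i) (y i - xs i))).
      rewrite -subr_ge0 -sumrB (le_trans (gap_ge0 hmono hy hx)) //.
      by apply: ler_sum => i _; rewrite dotBl.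
    apply: ler_sum => i _; rewrite (le_trans (ler_dot _ _)) // ler_wpM2l ?enorm_ge0 //.
    rewrite (le_trans (enormB _ _)) // lerD //.
      by have [] := hL i (y i) (hy i).
    by have [] := hL i (xs i) (hx i).
  have h2 : mu 0 k <= \sum_j mu 0 j.
    by rewrite (bigD1 k) //= lerDl sumr_ge0.
  by have := vi _ hy; have := hk _ mu0; nra.
have self : \sum_i dot (pg xs i) (xs i - xs i) = 0.
  by rewrite big1 // => i _; rewrite subrr dot0r.
have feas k : constr_sum G xs 0 k <= 0.
  have bnu : box (C0 / kappa + 1) (mu + (C0 / kappa + 1 - mu 0 k) *: delta_mx 0 k).
    move=> j; rewrite !mxE eqxx /=; have /andP[j0 j1] := bmu j; have := muK k.
    have [->|_] := eqVneq j k; rewrite ?mulr1 ?mulr0; move=> *; apply/andP; split; lra.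
  have := heq _ _ hx bnu; rewrite self dotDl dotZl add0r opprD addrA subrr add0r.
  have -> : dot (delta_mx 0 k) (constr_sum G xs) = constr_sum G xs 0 k.
    rewrite /dot (bigD1 k) //= big1 => [|j /negbTE jk]; rewrite !mxE ?eqxx /=.
      by rewrite mul1r addr0.
    by rewrite jk mul0r.
  by rewrite oppr_ge0 pmulr_rle0 // subr_gt0.
exists xs, mu; split => //.
apply/eqP; rewrite eq_le dot_orthant_le0 //=.
by have := vi _ hx; rewrite self add0r.
Qed.

Lemma vGNE_unique (xs : profile G) mu : saddle xs mu -> unique (is_vGNE G) xs.
Proof.
move=> h; split; first exact: (saddle_vGNE hgame h).
by move=> x' /(vGNE_saddle hgame)[mu' h']; exact: (saddle_uniq hmono h h').
Qed.

Lemma dotBB_mid k (a b y x s : 'rV[R]_k) :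
  dot (a - b) (y - s) =
  dot a (y - x) - dot b (y - x) + (dot a (x - s) - dot b (x - s)).
Proof. by rewrite !(dotBl, dotBr); ring. Qed.

Lemma dotB_scaled k (a b u w : 'rV[R]_k) (t : R) :
  u = t *: w -> dot (a - b) u = t * (dot a w - dot b w).
Proof. by move=> ->; rewrite dotZr dotBl. Qed.

(* Monotonicity tested at the midpoint z of x and xs: since
   <G(z) - G(xs), x - xs> > 0, bounded monotone G cannot make the gap vanish
   near x, although G itself need not be continuous at boundary points. *)
Lemma gap_lbound_near B (x xs : profile G) : (forall (y : profile G) i, strats G y -> enorm (pg y i) <= B) ->
  strats G x -> strats G xs -> x <> xs ->
  exists2 c, 0 < c & exists2 r, 0 < r & forall y, strats G y ->
    \sum_i enorm (y i - x i) <= r -> c <= gap y xs.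
Proof.
move=> hB hx hs ne; have hh : 0 <= (2^-1 : R) <= 1 by lra.
pose z := segment x xs 2^-1.
have hz : strats G z by apply: segment_strats.
have zxs i : z i - xs i = 2^-1 *: (x i - xs i).
  rewrite /z /segment; apply/rowP => j; rewrite !mxE; lra.
have xz i : x i - z i = 2^-1 *: (x i - xs i).
  rewrite /z /segment; apply/rowP => j; rewrite !mxE; lra.
have nz : z <> xs.
  move=> e; apply: ne; apply: functional_extensionality_dep => i.
  have /eqP := zxs i; rewrite e subrr eq_sym scaler_eq0 invr_eq0 pnatr_eq0 /=.
  by rewrite subr_eq0 => /eqP.
have c0 := gap_gt0 hmono hz hs nz.
have B0 : 0 <= B.
  by apply: le_trans (enorm_ge0 (pg x (Ordinal hN))) _; exact: hB.
exists (gap z xs) => //; exists (gap z xs / (4 * B + 1)).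
  by rewrite divr_gt0 //; lra.
move=> y hy; rewrite ler_pdivlMr; last lra.
set r := \sum_i _ => hr.
have r0 : 0 <= r by apply: sumr_ge0 => i _; exact: enorm_ge0.
have g1 := gap_ge0 hmono hy hz.
(* Here T u = <G(u), x - xs> and D u = <G(u), y - x>. Nonnegativity of [gap y z] bounds [T y] below
   by [T z] and terms in [D], whence [gap y xs >= 2 * gap z xs - 4 * B * r]; the radius makes the
   last term at most [gap z xs]. *)
have [T TE] : exists T : profile G -> R,
  forall u, T u = \sum_i dot (pg u i) (x i - xs i) by eexists.
have [D DE] : exists D : profile G -> R,
  forall u, D u = \sum_i dot (pg u i) (y i - x i) by eexists.
have bd (u : profile G) : strats G u -> `|D u| <= B * r.
  move=> hu; rewrite DE (le_trans (ler_norm_sum _ _ _)) // mulr_sumr.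
  apply: ler_sum => i _; rewrite (le_trans (ler_norm_dot _ _)) //.
  by rewrite ler_wpM2r ?enorm_ge0 // hB.
have /ler_normlP[a1 a2] := bd y hy; have /ler_normlP[b1 b2] := bd z hz.
have /ler_normlP[e1 e2] := bd xs hs.
have gE : gap y xs = D y - D xs + (T y - T xs).
  rewrite !DE !TE -!sumrB -big_split /=; apply: eq_bigr => i _.
  exact: dotBB_mid.
have gz : gap z xs = 2^-1 * (T z - T xs).
  rewrite !TE -sumrB mulr_sumr; apply: eq_bigr => i _.
  exact: dotB_scaled (zxs i).
have gyz : gap y z = D y - D z + 2^-1 * (T y - T z).
  rewrite !DE !TE -!sumrB mulr_sumr -big_split /=; apply: eq_bigr => i _.
  apply: (etrans (dotBB_mid _ _ _ (x i) _)); congr (_ + _).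
  by apply: (etrans (esym (dotBl _ _ _))); exact: dotB_scaled (xz i).
rewrite gyz in g1; rewrite gE; rewrite gz in hr *; lra.
Qed.

End SaddlePoint.

(** * Pathwise Lyapunov estimates *)

Lemma lconvex_orthant {R : realType} k : lconvex (@orthant R k).
Proof.
move=> x y t hx hy /andP[t0 t1] j; rewrite !mxE.
by have := hx j; have := hy j; nra.
Qed.

Lemma eproj_orthant {R : realType} k (v : 'rV[R]_k) :
  eproj orthant v = \row_j Num.max 0 (v 0 j).
Proof.
have hn : nearest orthant v (\row_j Num.max 0 (v 0 j)).
  split=> [j|z hz]; first by rewrite mxE le_max lexx.
  rewrite -ler_sqr ?nnegrE ?enorm_ge0 // !enorm_sqr; apply: ler_sum => j _.
  rewrite !mxE -!expr2; have := hz j; have [h|h] := leP 0 (v 0 j).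
    by rewrite subrr expr0n sqr_ge0.
  by nra.
apply: (nearest_uniq (@lconvex_orthant _ _) _ hn).
by apply: eproj_nearest; eexists; exact: hn.
Qed.

Lemma pos_part_shift_le {R : realType} (p h : R) :
  0 <= p -> `|Num.max 0 (p + h) - p| <= `|h|.
Proof.
move=> p0; have [h1|h1] := leP 0 (p + h); first by rewrite addrC addKr.
by rewrite sub0r normrN (ger0_norm p0) ler0_norm; lra.
Qed.

Lemma rowBE {R : realType} k (a b : 'rV[R]_k) j : (a - b) 0 j = a 0 j - b 0 j.
Proof. by rewrite !mxE. Qed.

Lemma dot_l1_le {R : realType} k (a b : 'rV[R]_k) c :
  (forall j, `|b 0 j| <= c) -> `|dot a b| <= c * \sum_j `|a 0 j|.
Proof.
move=> bc; rewrite (le_trans (ler_norm_sum _ _ _)) // mulr_sumr.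
by apply: ler_sum => j _; rewrite normrM mulrC ler_wpM2r.
Qed.

(* The regularisation term - a b p (p / z - nu) is at most a b z nu^2 / 4 by
   completing the square. *)
Lemma dual_coord_le {R : realType} (p z g b a nu H delta c : R) :
  0 <= p -> 0 < delta -> delta <= z -> z <= c -> 0 < a -> 0 < b -> 0 <= nu ->
  `|g - b * p| <= H ->
  (Num.max 0 (p + a * (g - b * p)) - p) * (z^-1 * p - nu) <=
  a * (g * (z^-1 * p - nu)) + a ^+ 2 * (H ^+ 2 / delta) + a * b * (c * nu ^+ 2).
Proof.
move=> p0 d0 dz zc a0 b0 nu0 hH; have z0 : 0 < z by lra.
set h := g - b * p in hH *; set e := Num.max _ _ - p.
have e1 : a * h <= e by rewrite /e lerBrDr addrC le_max lexx orbT.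
have e2 : e * p <= a * h * p + (a * h) ^+ 2.
  rewrite /e; have [h1|h1] := leP 0 (p + a * h); last by nra.
  by rewrite (addrC p) addrK lerDl sqr_ge0.
have H0 : 0 <= H by exact: le_trans (normr_ge0 _) hH.
have hsq : h ^+ 2 <= H ^+ 2 by rewrite -[h ^+ 2]real_normK ?num_real // ler_sqr ?nnegrE.
have zi : z^-1 <= delta^-1 by rewrite lef_pV2 ?posrE.
have z1 : 0 < z^-1 by rewrite invr_gt0.
have s1 : z^-1 * (e * p) <= a * h * (z^-1 * p) + a ^+ 2 * (H ^+ 2 / delta).
  apply: (le_trans (ler_wpM2l (ltW z1) e2)).
  rewrite mulrDr (_ : z^-1 * (a * h * p) = a * h * (z^-1 * p)); last by ring.
  rewrite lerD2l exprMn mulrCA ler_wpM2l ?sqr_ge0 // mulrC.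
  by rewrite ler_pM ?sqr_ge0 ?(ltW z1).
have s2 : nu * (a * h) <= nu * e by exact: ler_wpM2l.
have s3 : - (p * (z^-1 * p - nu)) <= c * nu ^+ 2.
  have : 0 <= z^-1 * (p - z * nu / 2) ^+ 2 by rewrite mulr_ge0 ?sqr_ge0 // ltW.
  have -> : z^-1 * (p - z * nu / 2) ^+ 2 =
      p * (z^-1 * p - nu) + z * nu ^+ 2 / 4 by field; rewrite gt_eqF.
  have : z * nu ^+ 2 <= c * nu ^+ 2 by rewrite ler_wpM2r ?sqr_ge0.
  have : 0 <= z * nu ^+ 2 by rewrite mulr_ge0 ?sqr_ge0 // ltW.
  lra.
have s4 := ler_wpM2l (ltW (mulr_gt0 a0 b0)) s3.
have -> : e * (z^-1 * p - nu) = z^-1 * (e * p) - nu * e by ring.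
apply: (le_trans (lerB s1 s2)).
have -> : a * h * (z^-1 * p) + a ^+ 2 * (H ^+ 2 / delta) - nu * (a * h) =
  a * (g * (z^-1 * p - nu)) + a ^+ 2 * (H ^+ 2 / delta) +
  a * b * - (p * (z^-1 * p - nu)) by rewrite /h; ring.
by rewrite lerD2l.
Qed.

Lemma dot_inexact_grad_ge {R : realType} j k (v a b : 'rV[R]_k) (w x y : 'rV[R]_j)
    (r q : 'rV[R]_k) (c : R) :
  `|dot (r - q) (a - b)| <= c -> dot w (y - x) <= dot r b - dot r a ->
  dot q a - dot q b - c <= dot w (x - y).
Proof.
rewrite -[y - x]opprB dotNr !(dotBl, dotBr) => /ler_normlP[]; lra.
Qed.

Lemma descent_step_sqdist_le {R : realType} k (xn x y s q p p' r : 'rV[R]_k)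
    (a g c1 c2 L Lf : R) : 0 < a ->
  enorm (xn - y) <= enorm (x - a *: (q + r) - y) ->
  dot p' (x - y) - 2 * L * Lf * c1 <= dot p (x - y) ->
  g - 2 * L * c2 <= dot r (x - y) ->
  dot (xn - y) (xn - y) <= dot (x - y) (x - y) -
    2 * a * (dot (q - p) (x - y) + dot p' (x - y) + g) + a ^+ 2 * enorm (q + r) ^+ 2 +
    4 * L * Lf * (a * c1) + 4 * L * (a * c2).
Proof.
move=> a0; rewrite -ler_sqr ?nnegrE ?enorm_ge0 // (enorm_sqr (xn - y)) addrAC => h3 h1 h2.
apply: (le_trans h3); rewrite !enorm_sqr; move: (x - y) h1 h2 => v h1 h2.
have -> : dot (v - a *: (q + r)) (v - a *: (q + r)) =
    dot v v - 2 * a * dot (q + r) v + a ^+ 2 * dot (q + r) (q + r).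
  by rewrite !(dotBl, dotBr, dotZl, dotZr) (dotC v); ring.
have := ler_wpM2l (ltW a0) h1; have := ler_wpM2l (ltW a0) h2.
by rewrite dotDl dotBl; lra.
Qed.

(** The primal step contributes [- 2 * a * qx] and the dual step [2 * a * qx], where [qx] stands for
    <mu_mean, g(x_t)>: the coupling of multiplier and constraint cancels and leaves the drift. *)
Lemma combine_primal_dual_steps {R : realType} N (X' X nz A qx qy nx D2 sd md e q q' a b L Lf
    h c3 c4 c5 : R) :
  X' <= X - 2 * a * (nz + A + (qx - qy)) + a ^+ 2 * D2 + 4 * L * Lf * (a * sd) +
    4 * L * (a * md) ->
  e <= a * (qx - nx) + (h + L) * (a * md) + (a ^+ 2 * c3) *+ N + (a * b * c5) *+ N ->
  q' <= q + 2 * e + a ^+ 2 * c4 ->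
  X' + q' <= X + q - 2 * a * (A + nx - qy + nz) +
    (a ^+ 2 * D2 + 4 * L * Lf * (a * sd) + (6 * L + 2 * h) * (a * md) +
     a ^+ 2 * (2 * N%:R * c3 + c4) + a * b * (2 * N%:R * c5)).
Proof. by rewrite -(mulr_natl (_ ^+ 2 * c3)) -(mulr_natl (_ * c5)); lra. Qed.

Lemma drift_cancel_le {R : realType} (a b c e : R) :
  0 <= b + c -> e <= 0 -> a - b <= a + c - e.
Proof. lra. Qed.

Lemma dot_recentre_le {R : realType} k (e q r nu g : 'rV[R]_k) (a c1 c2 h L D : R) :
  0 < a -> dot e (r - nu) <= a * dot g (r - nu) + c1 + c2 ->
  `|dot (q - r) e| <= a * h * D -> `|dot (q - r) g| <= L * D ->
  dot e (q - nu) <= a * dot g (q - nu) + (h + L) * (a * D) + c1 + c2.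
Proof.
move=> a0 h1 /ler_normlP[_ h2] /ler_normlP[h3 _].
have -> : q - nu = (q - r) + (r - nu) by rewrite addrA subrK.
rewrite !(dotDr (q - r) (r - nu)) (dotC e (q - r)) (dotC g (q - r)).
by have := ler_wpM2l (ltW a0) h3; lra.
Qed.

Section Path.
Context {R : realType} {d : measure_display} {Omega : measurableType d}
  {P : probability Omega R} {N n m : nat} (G : aggGame P N n m).
Hypotheses (hN : (0 < N)%N) (hgame : game_assumption G).
Variables (E : nat -> rel 'I_N) (W : nat -> 'M[R]_N).
Hypotheses (hW : is_weighting E W) (hgraph : graph_assumption E W).
Variables (alpha beta : nat -> R) (x0 : profile G).
Hypotheses (hx0 : strats G x0) (halpha : is_step_size alpha) (hbeta : is_step_size beta).

(** The weights depend on [W] alone, so their lower bound and the consensus constant are fixed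
    before any path is considered. *)
Fixpoint push_weight (t : nat) : 'I_N -> R :=
  if t is t'.+1 then fun i => \sum_j W t' i j * push_weight t' j else fun=> 1.

Variables (L M Ls Lf S B delta K : R).
Hypotheses (L0 : 0 < L) (M0 : 0 < M) (Ls0 : 0 < Ls) (Lf0 : 0 < Lf) (S0 : 0 < S)
  (delta0 : 0 < delta) (K0 : 0 <= K).
Hypothesis hL : forall i a, strat G i a ->
  [/\ enorm a <= L, enorm (constr G i a) <= L & enorm (constr_grad G i a) <= M].
Hypothesis hLs : forall i a a', strat G i a -> strat G i a' ->
  enorm (agg G i a - agg G i a') <= Ls * enorm (a - a').
Hypothesis hLf : forall i a, strat G i a -> forall y y',
  enorm (pgrad G i a y - pgrad G i a y') <= Lf * enorm (y - y').
Hypothesis hB : forall i a y, strat G i a -> enorm (pgrad G i a y) <= B.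
Hypothesis hdelta : forall t i, delta <= push_weight t i.
Hypothesis hK : forall (y e : nat -> 'I_N -> R) (a : nat -> R) D,
  (forall t i, y t.+1 i = \sum_j W t i j * y t j + e t i) ->
  (forall t, 0 <= a t <= 1) -> (forall s t, (s <= t)%N -> a t <= a s) ->
  (forall T, \sum_(t < T) a t * (\sum_i `|e t i|) <= D) ->
  forall T, \sum_(t < T) a t *
    (\sum_i `|(\sum_j W t i j * y t j) / push_weight t.+1 i - mean (y t)|) <=
    K * (\sum_i `|y 0%N i| + D).
Variables (sa2 sab sa2b sa2b2 : R).
Hypotheses (ha2 : forall T, \sum_(t < T) alpha t ^+ 2 <= sa2)
  (hab : forall T, \sum_(t < T) alpha t * beta t <= sab)
  (ha2b : forall T, \sum_(t < T) alpha t ^+ 2 / beta t <= sa2b)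
  (ha2b2 : forall T, \sum_(t < T) alpha t ^+ 2 / beta t ^+ 2 <= sa2b2).

Variables (u : nat -> forall i, 'rV[R]_(ndim G i)) (st : nat -> state G).
Hypotheses (st0 : st 0%N = init G x0)
  (stS : forall t, st t.+1 =
     step G (W t) (alpha t) (beta t) (alpha t) (u t) (st t)).

Let x t := st_x G (st t).
Let mu t := st_mu G (st t).
Let z t := push_weight t.

Definition mu_hat t i := \sum_j W t i j *: st_mu G (st t) j.
Definition sigma_hat t i := \sum_j W t i j *: st_sigma G (st t) j.
Definition sigma_est t i := (push_weight t.+1 i)^-1 *: sigma_hat t i.
Definition qsample t i := qgrad G i (st_x G (st t) i) (sigma_est t i) (u t i).
Definition direction t i := qsample t i +
  (push_weight t.+1 i)^-1 *: (mu_hat t i *m (constr_grad G i (st_x G (st t) i))^T).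
Definition mu_mean t : 'rV[R]_m := N%:R^-1 *: \sum_i st_mu G (st t) i.

Hypothesis hS : forall t i, enorm (qsample t i) <= S.

Lemma alpha_gt0 t : 0 < alpha t. Proof. by case: halpha => /(_ t)/andP[]. Qed.
Lemma alpha_le1 t : alpha t <= 1. Proof. by case: halpha => /(_ t)/andP[]. Qed.
Lemma beta_gt0 t : 0 < beta t. Proof. by case: hbeta => /(_ t)/andP[]. Qed.
Lemma beta_le1 t : beta t <= 1. Proof. by case: hbeta => /(_ t)/andP[]. Qed.
Lemma alpha_anti s t : (s <= t)%N -> alpha t <= alpha s.
Proof. by case: halpha => _; exact. Qed.

Lemma st_zE t : st_z G (st t) = push_weight t.
Proof. by elim: t => [|t IH]; rewrite ?st0 ?stS //= IH. Qed.

Lemma weight_gt0 t i : 0 < push_weight t i.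
Proof. exact: lt_le_trans (hdelta t i). Qed.

Lemma weight_ge0 t i j : 0 <= W t i j.
Proof. by have [] := weight_col_stochastic hW hgraph t. Qed.

Lemma weight_sum1 t j : \sum_i W t i j = 1.
Proof. by have [] := weight_col_stochastic hW hgraph t. Qed.

Lemma sum_push_weight t : \sum_i push_weight t i = N%:R.
Proof. exact: (sum_push_weights hW hgraph). Qed.

Lemma push_weight_le t i : push_weight t i <= N%:R.
Proof.
rewrite -(sum_push_weight t) (bigD1 i) //= lerDl sumr_ge0 // => j _.
exact/ltW/weight_gt0.
Qed.

Lemma st_xS t i : x t.+1 i = eproj (strat G i) (x t i - alpha t *: direction t i).
Proof. by rewrite /x stS /= st_zE. Qed.

Lemma st_muS t i : mu t.+1 i = \row_k Num.max 0 ((mu_hat t i +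
  alpha t *: (constr G i (x t i) - beta t *: mu_hat t i)) 0 k).
Proof. by rewrite /mu stS /= eproj_orthant. Qed.

Lemma st_sigmaS t i : st_sigma G (st t.+1) i =
  sigma_hat t i + (agg G i (x t.+1 i) - agg G i (x t i)).
Proof. by rewrite /x stS /= addrA. Qed.

Lemma eproj_strat_nearest i v : nearest (strat G i) v (eproj (strat G i) v).
Proof.
apply: eproj_nearest; apply: compact_nearest; first exact: (strat_compact hgame).
exact: (strat_nonempty hgame).
Qed.

Lemma st_x_strats t : strats G (x t).
Proof.
case: t => [|t] i; first by rewrite /x st0; exact: hx0.
by rewrite st_xS; have [] := eproj_strat_nearest (x t i - alpha t *: direction t i).
Qed.

Lemma st_mu_ge0 t i k : 0 <= mu t i 0 k.
Proof.
case: t => [|t]; first by rewrite /mu st0 /= mxE.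
by rewrite st_muS mxE le_max lexx.
Qed.

Lemma mu_hatE t i k : mu_hat t i 0 k = \sum_j W t i j * mu t j 0 k.
Proof. by rewrite summxE; apply: eq_bigr => j _; rewrite mxE. Qed.

Lemma mu_hat_ge0 t i k : 0 <= mu_hat t i 0 k.
Proof.
by rewrite mu_hatE sumr_ge0 // => j _; rewrite mulr_ge0 ?weight_ge0 ?st_mu_ge0.
Qed.

Lemma sum_mu_hat t k : \sum_i mu_hat t i 0 k = \sum_i mu t i 0 k.
Proof.
under eq_bigr do rewrite mu_hatE.
rewrite exchange_big /=; apply: eq_bigr => j _.
by rewrite -mulr_suml weight_sum1 mul1r.
Qed.

Lemma mu_hat_le t i k : mu_hat t i 0 k <= \sum_j mu t j 0 k.
Proof.
rewrite -sum_mu_hat (bigD1 i) //= lerDl sumr_ge0 // => j _; exact: mu_hat_ge0.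
Qed.

Lemma constr_coord_le t i k : `|constr G i (x t i) 0 k| <= L.
Proof.
have [_ h _] := hL (st_x_strats t i).
exact: le_trans (coord_le_enorm _ _) h.
Qed.

(** The regularisation damps the total: it is at most [1 - alpha t * beta t] times its previous
    value plus [N * alpha t * L]. The ceiling [N * L / beta t] is invariant under this recursion and
    does not decrease with [t]. *)
Lemma sum_mu_le t k : \sum_i mu t i 0 k <= N%:R * L / beta t.
Proof.
have NL0 : 0 <= N%:R * L by rewrite mulr_ge0 // ltW.
elim: t => [|t IH].
  rewrite big1 ?divr_ge0 ?(ltW (beta_gt0 _)) // => i _.
  by rewrite /mu st0 /= mxE.
have a0 := alpha_gt0 t; have a1 := alpha_le1 t; have b0 := beta_gt0 t.
have b1 := beta_le1 t.
have bS : beta t.+1 <= beta t by case: hbeta => _; apply.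
have ab : 0 <= 1 - alpha t * beta t by nra.
apply: (@le_trans _ _ (N%:R * L / beta t)); last first.
  by rewrite ler_wpM2l // lef_pV2 ?posrE ?beta_gt0.
apply: (@le_trans _ _ (\sum_i ((1 - alpha t * beta t) * mu_hat t i 0 k + alpha t * L))).
  apply: ler_sum => i _; rewrite st_muS !mxE ge_max; apply/andP; split.
    by rewrite addr_ge0 // mulr_ge0 ?mu_hat_ge0 // ltW.
  have := constr_coord_le t i k; rewrite ler_norml => /andP[_ h].
  have := ler_wpM2l (ltW a0) h; lra.
rewrite big_split /= -mulr_sumr sum_mu_hat sumr_const card_ord -mulr_natl.
have := ler_wpM2l ab IH; set Q := N%:R * L in NL0 *.
have -> : (1 - alpha t * beta t) * (Q / beta t) = Q / beta t - alpha t * Q.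
  by field; rewrite gt_eqF.
by rewrite /Q; lra.
Qed.

Lemma beta_mu_hat_le t i k : beta t * mu_hat t i 0 k <= N%:R * L.
Proof.
rewrite mulrC -ler_pdivlMr ?beta_gt0 //.
exact: le_trans (mu_hat_le t i k) (sum_mu_le t k).
Qed.

(** [L] for the constraint value and [N * L] for [beta t * mu_hat], by [beta_mu_hat_le]. *)
Definition hbound : R := (N%:R + 1) * L.

Lemma hbound_ge0 : 0 <= hbound.
Proof. by rewrite mulr_ge0 ?addr_ge0 // ltW. Qed.

Definition dual_drift t i := constr G i (x t i) - beta t *: mu_hat t i.

Lemma dual_drift_le t i k : `|dual_drift t i 0 k| <= hbound.
Proof.
rewrite /dual_drift /hbound 3!mxE.
have := constr_coord_le t i k; rewrite !ler_norml => /andP[h1 h2].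
have h3 := beta_mu_hat_le t i k.
have h4 : 0 <= beta t * mu_hat t i 0 k by rewrite mulr_ge0 ?mu_hat_ge0 ?(ltW (beta_gt0 _)).
have : 0 <= N%:R * L by rewrite mulr_ge0 // ltW.
by move=> *; apply/andP; split; lra.
Qed.

Definition mu_incr t i := mu t.+1 i - mu_hat t i.

Lemma mu_incrE t i k : mu_incr t i 0 k =
  Num.max 0 (mu_hat t i 0 k + alpha t * dual_drift t i 0 k) - mu_hat t i 0 k.
Proof. by rewrite /mu_incr st_muS !mxE. Qed.

Lemma mu_incr_le t i k : `|mu_incr t i 0 k| <= alpha t * hbound.
Proof.
have a0 := alpha_gt0 t.
rewrite mu_incrE; apply: (@le_trans _ _ (alpha t * `|dual_drift t i 0 k|)); last first.
  by rewrite ler_wpM2l ?(ltW a0) // dual_drift_le.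
have m0 := mu_hat_ge0 t i k; rewrite -[in leRHS](gtr0_norm a0) -normrM.
exact: pos_part_shift_le.
Qed.

Lemma mu_step t i k : mu t.+1 i 0 k = \sum_j W t i j * mu t j 0 k + mu_incr t i 0 k.
Proof. rewrite -mu_hatE /mu_incr; move: (mu t.+1 i) (mu_hat t i) => a b.
by rewrite !mxE addrCA subrr addr0. Qed.

Lemma mu_meanE t k : mu_mean t 0 k = mean (fun i => mu t i 0 k).
Proof. by rewrite /mu_mean mxE summxE. Qed.

Definition mu_disagree t i : R :=
  \sum_k `|((push_weight t.+1 i)^-1 *: mu_hat t i) 0 k - mu_mean t 0 k|.

(** The consensus bound, once per coordinate: multipliers start at zero and are perturbed by at most
    [alpha t * hbound], which gives the weight [alpha t ^+ 2]. *)
Definition cmu : R := m%:R * (K * (sa2 * N%:R * hbound)).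

Lemma sum_mu_disagree T : \sum_(t < T) alpha t * \sum_i mu_disagree t i <= cmu.
Proof.
have -> : \sum_(t < T) alpha t * \sum_i mu_disagree t i =
    \sum_k \sum_(t < T) alpha t * \sum_i `|(\sum_j W t i j * mu t j 0 k) /
      push_weight t.+1 i - mean (fun i => mu t i 0 k)|.
  rewrite exchange_big /=; apply: eq_bigr => t _.
  rewrite -mulr_sumr; congr (_ * _); rewrite exchange_big /=.
  apply: eq_bigr => i _; apply: eq_bigr => k _.
  by rewrite mxE mu_meanE mu_hatE mulrC.
rewrite /cmu mulr_natl -[X in _ *+ X]card_ord -sumr_const; apply: ler_sum => k _.
have := hK (y := fun t i => mu t i 0 k) (e := fun t i => mu_incr t i 0 k)
  (a := alpha) (D := sa2 * N%:R * hbound) (fun t i => mu_step t i k).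
rewrite [X in K * (X + _)]big1 ?add0r => [|i _]; last first.
  by rewrite /mu st0 /= mxE normr0.
apply=> [t|s t|T']; first by rewrite (ltW (alpha_gt0 t)) alpha_le1.
  exact: alpha_anti.
apply: (@le_trans _ _ (\sum_(t < T') alpha t ^+ 2 * (N%:R * hbound))).
  apply: ler_sum => t _; rewrite expr2 -mulrA ler_wpM2l ?(ltW (alpha_gt0 t)) //.
  rewrite mulrCA mulr_natl -[X in _ *+ X]card_ord -sumr_const.
  by apply: ler_sum => i _; exact: mu_incr_le.
rewrite -mulr_suml -mulrA ler_wpM2r // mulr_ge0 ?hbound_ge0 //.
Qed.

(** Direction bound with the factor [1 / beta t] taken out: [beta t <= 1] absorbs the sample term,
    and the other term combines [sum_mu_le], the gradient bound [M] and the lower bound on push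
    weights. *)
Definition cdir : R := S + m%:R * (N%:R * L) * M / delta.

Lemma cdir_ge0 : 0 <= cdir.
Proof.
by rewrite addr_ge0 ?(ltW S0) // divr_ge0 ?(ltW delta0) // !mulr_ge0 // ltW.
Qed.

Lemma direction_le t i (Q : R) : enorm (mu_hat t i) <= Q ->
  enorm (direction t i) <= S + Q * M / delta.
Proof.
move=> hQ; rewrite /direction (le_trans (enormD _ _)) // lerD ?hS //.
rewrite enormZ gtr0_norm ?invr_gt0 ?weight_gt0 // mulrC.
have [_ _ hM] := hL (st_x_strats t i).
rewrite ler_pM ?enorm_ge0 ?invr_ge0 ?(ltW (weight_gt0 _ _)) //; last first.
  by rewrite lef_pV2 ?posrE ?weight_gt0.
rewrite (le_trans (enorm_mulmx_tr _ _)) // ler_pM ?enorm_ge0 //.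
Qed.

Lemma direction_le_beta t i : enorm (direction t i) <= cdir / beta t.
Proof.
have b0 := beta_gt0 t; have b1 := beta_le1 t.
have h : enorm (mu_hat t i) <= m%:R * (N%:R * L / beta t).
  rewrite (le_trans (enorm_le_l1 _)) // mulr_natl -[X in _ *+ X]card_ord -sumr_const.
  apply: ler_sum => k _; rewrite ger0_norm ?mu_hat_ge0 //.
  exact: le_trans (mu_hat_le t i k) (sum_mu_le t k).
rewrite (le_trans (direction_le h)) // /cdir mulrDl lerD //.
  by rewrite ler_peMr ?(ltW S0) // invf_ge1.
by rewrite le_eqVlt; apply/orP; left; apply/eqP; ring.
Qed.

Lemma x_incr_le t i : enorm (x t.+1 i - x t i) <= alpha t * enorm (direction t i).
Proof.
rewrite st_xS.
have := nearest_nonexp (strat_lconvex hgame (i := i))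
  (eproj_strat_nearest (x t i - alpha t *: direction t i))
  (nearest_id (st_x_strats t i)).
move=> /le_trans; apply.
by rewrite addrAC subrr add0r enormN enormZ gtr0_norm ?alpha_gt0.
Qed.

Definition sigma_disagree t i : R :=
  \sum_k `|sigma_est t i 0 k - sigma G (x t) 0 k|.

(** An action moves by at most [alpha t * cdir / beta t], so the tracking of the aggregate is
    perturbed with weight [alpha t ^+ 2 / beta t], summed by [sa2b]. *)
Definition csig : R := \sum_(k < n) K * (\sum_i `|agg G i (x0 i) 0 k| +
  sa2b * (N%:R * (Ls * cdir))).

Lemma sigma_hatE t i k :
  sigma_hat t i 0 k = \sum_j W t i j * st_sigma G (st t) j 0 k.
Proof. by rewrite summxE; apply: eq_bigr => j _; rewrite mxE. Qed.

Lemma sigma_meanE t k :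
  sigma G (x t) 0 k = mean (fun i => st_sigma G (st t) i 0 k).
Proof.
rewrite /sigma mxE summxE /mean; congr (_ * _).
elim: t => [|t IH]; first by rewrite /x st0.
under [RHS]eq_bigr do rewrite st_sigmaS !mxE.
rewrite big_split sumrB /=.
rewrite (_ : \sum_i sigma_hat t i 0 k = \sum_i st_sigma G (st t) i 0 k).
  by rewrite -IH addrC subrK.
under eq_bigr do rewrite sigma_hatE.
rewrite exchange_big /=; apply: eq_bigr => j _.
by rewrite -mulr_suml weight_sum1 mul1r.
Qed.

Lemma sum_sigma_disagree T :
  \sum_(t < T) alpha t * \sum_i sigma_disagree t i <= csig.
Proof.
have -> : \sum_(t < T) alpha t * \sum_i sigma_disagree t i =
    \sum_k \sum_(t < T) alpha t * \sum_i `|(\sum_j W t i j * st_sigma G (st t) j 0 k) /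
      push_weight t.+1 i - mean (fun i => st_sigma G (st t) i 0 k)|.
  rewrite exchange_big /=; apply: eq_bigr => t _.
  rewrite -mulr_sumr; congr (_ * _); rewrite exchange_big /=.
  apply: eq_bigr => i _; apply: eq_bigr => k _.
  by rewrite mxE sigma_meanE sigma_hatE mulrC.
apply: ler_sum => k _.
have := hK (y := fun t i => st_sigma G (st t) i 0 k)
  (e := fun t i => (agg G i (x t.+1 i) - agg G i (x t i)) 0 k)
  (a := alpha) (D := sa2b * (N%:R * (Ls * cdir))).
rewrite st0 /=; apply=> [t i|t|s t|T'].
- by rewrite -sigma_hatE st_sigmaS mxE.
- by rewrite (ltW (alpha_gt0 t)) alpha_le1.
- exact: alpha_anti.
apply: (@le_trans _ _ (\sum_(t < T') alpha t ^+ 2 / beta t * (N%:R * (Ls * cdir)))).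
  apply: ler_sum => t _; rewrite expr2 -2!mulrA ler_wpM2l ?(ltW (alpha_gt0 t)) //.
  rewrite (_ : alpha t * _ = N%:R * (Ls * (alpha t * (cdir / beta t)))); last first.
    by move: cdir => c; ring.
  rewrite mulr_natl -[X in _ *+ X]card_ord -sumr_const.
  apply: ler_sum => i _; rewrite (le_trans (coord_le_enorm _ _)) //.
  rewrite (le_trans (hLs (st_x_strats _ _) (st_x_strats _ _))) //.
  rewrite ler_wpM2l ?(ltW Ls0) // (le_trans (x_incr_le _ _)) //.
  by rewrite ler_wpM2l ?(ltW (alpha_gt0 t)) // direction_le_beta.
rewrite -mulr_suml ler_wpM2r //; apply: mulr_ge0 => //.
by apply: mulr_ge0; [exact: ltW|exact: cdir_ge0].
Qed.


(** The averaged multiplier moves by [1 / N] times the sum of the increments; the factor [N]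
    restores the sum, so that the coupling terms of all players cancel in [lyap_step]. *)
Definition lyap (y : profile G) (nu : 'rV[R]_m) t : R :=
  \sum_i dot (x t i - y i) (x t i - y i) +
  N%:R * dot (mu_mean t - nu) (mu_mean t - nu).

Definition noise_term (y : profile G) t : R :=
  \sum_i dot (qsample t i - pgrad G i (x t i) (sigma_est t i)) (x t i - y i).

(** At a saddle point it dominates [gap], by the variational inequality and feasibility; at a Slater
    point with [nu = 0] it grows with the multiplier, up to a bounded term. *)
Definition drift (y : profile G) (nu : 'rV[R]_m) t : R :=
  \sum_i dot (pg (x t) i) (x t i - y i) + dot nu (constr_sum G (x t)) -
  dot (mu_mean t) (constr_sum G y).

Lemma pgrad_est_le (y : profile G) t i : strat G i (y i) ->
  dot (pg (x t) i) (x t i - y i) - 2 * L * Lf * sigma_disagree t i <=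
  dot (pgrad G i (x t i) (sigma_est t i)) (x t i - y i).
Proof.
move=> iy; rewrite lerBlDr -lerBlDl -dotBl (le_trans (ler_dot _ _)) //.
have h1 : enorm (pg (x t) i - pgrad G i (x t i) (sigma_est t i)) <=
    Lf * sigma_disagree t i.
  rewrite (le_trans (hLf (st_x_strats t i) _ _)) // ler_wpM2l ?(ltW Lf0) //.
  rewrite enormBC (le_trans (enorm_le_l1 _)) //.
  apply: ler_sum => k _; move: (sigma_est t i) (sigma G (x t)) => a b.
  by rewrite !mxE.
have h2 : enorm (x t i - y i) <= 2 * L.
  rewrite (le_trans (enormB _ _)) // mulrDl mul1r lerD //.
    by have [] := hL (st_x_strats t i).
  by have [] := hL iy.
by rewrite (le_trans (ler_pM (enorm_ge0 _) (enorm_ge0 _) h1 h2)) // mulrC mulrA.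
Qed.

(** Convexity needs a nonnegative multiplier and is applied with the local estimate that the
    algorithm uses; replacing it by [mu_mean] costs the disagreement. *)
Lemma constr_grad_est_le (y : profile G) t i : strat G i (y i) ->
  dot (mu_mean t) (constr G i (x t i)) - dot (mu_mean t) (constr G i (y i)) -
    2 * L * mu_disagree t i <=
  dot ((push_weight t.+1 i)^-1 *: (mu_hat t i *m (constr_grad G i (x t i))^T))
    (x t i - y i).
Proof.
move=> iy; rewrite scalemxAl /mu_disagree.
set r := (push_weight t.+1 i)^-1 *: mu_hat t i.
have r0 : orthant r.
  by move=> k; rewrite mxE mulr_ge0 ?mu_hat_ge0 // invr_ge0 ltW ?weight_gt0.
have := constr_grad_le hgame (st_x_strats t i) iy r0.
have : `|dot (r - mu_mean t) (constr G i (x t i) - constr G i (y i))| <=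
    2 * L * \sum_k `|r 0 k - mu_mean t 0 k|.
  rewrite (eq_bigr (fun k => `|(r - mu_mean t) 0 k|)); last first.
    by move=> k _; rewrite rowBE.
  apply: dot_l1_le => k; rewrite rowBE (le_trans (ler_normB _ _)) //.
  rewrite mulrDl mul1r lerD // ?constr_coord_le //.
  by have [_ h _] := hL iy; exact: le_trans (coord_le_enorm _ _) h.
exact: dot_inexact_grad_ge.
Qed.

Lemma primal_step (y : profile G) t i : strat G i (y i) ->
  dot (x t.+1 i - y i) (x t.+1 i - y i) <=
  dot (x t i - y i) (x t i - y i) -
  2 * alpha t * (dot (qsample t i - pgrad G i (x t i) (sigma_est t i)) (x t i - y i) +
    dot (pg (x t) i) (x t i - y i) +
    (dot (mu_mean t) (constr G i (x t i)) - dot (mu_mean t) (constr G i (y i)))) +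
  alpha t ^+ 2 * enorm (direction t i) ^+ 2 +
  4 * L * Lf * (alpha t * sigma_disagree t i) + 4 * L * (alpha t * mu_disagree t i).
Proof.
move=> iy; have a0 := alpha_gt0 t.
have h1 := pgrad_est_le t iy; have h2 := constr_grad_est_le t iy.
have h3 := nearest_nonexp (strat_lconvex hgame (i := i))
    (eproj_strat_nearest (x t i - alpha t *: direction t i)) (nearest_id iy).
rewrite -st_xS in h3.
exact: descent_step_sqdist_le a0 h3 h1 h2.
Qed.

(** [dual_coord_le] holds at the local estimate, where the truncation acts; recentring both inner
    products at [mu_mean] costs [hbound + L] times the disagreement. *)
Lemma dual_step t i nu : orthant nu ->
  dot (mu_incr t i) (mu_mean t - nu) <=
  alpha t * dot (constr G i (x t i)) (mu_mean t - nu) +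
  (hbound + L) * (alpha t * mu_disagree t i) +
  alpha t ^+ 2 * (m%:R * (hbound ^+ 2 / delta)) +
  alpha t * beta t * (N%:R * dot nu nu).
Proof.
move=> nu0; have a0 := alpha_gt0 t.
have h1 : dot (mu_incr t i) ((push_weight t.+1 i)^-1 *: mu_hat t i - nu) <=
    alpha t * dot (constr G i (x t i)) ((push_weight t.+1 i)^-1 *: mu_hat t i - nu) +
    alpha t ^+ 2 * (m%:R * (hbound ^+ 2 / delta)) +
    alpha t * beta t * (N%:R * dot nu nu).
  have -> : alpha t ^+ 2 * (m%:R * (hbound ^+ 2 / delta)) =
      \sum_(k < m) alpha t ^+ 2 * (hbound ^+ 2 / delta).
    by rewrite sumr_const card_ord -[RHS]mulr_natl mulrCA.
  rewrite /dot 3!mulr_sumr -2!big_split /=; apply: ler_sum => k _.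
  rewrite mu_incrE; have := dual_drift_le t i k.
  have := mu_hat_ge0 t i k; rewrite /dual_drift.
  move: (mu_hat t i) (constr G i (x t i)) => q g q0; rewrite !mxE => hH.
  rewrite -[nu 0 k * nu 0 k]expr2; apply: dual_coord_le => //.
  - exact: (hdelta t.+1 i).
  - exact: (push_weight_le t.+1 i).
  - exact: beta_gt0.
have h2 : `|dot (mu_mean t - (push_weight t.+1 i)^-1 *: mu_hat t i) (mu_incr t i)| <=
    alpha t * hbound * mu_disagree t i.
  rewrite [mu_disagree t i](eq_bigr (fun k => `|(mu_mean t -
      (push_weight t.+1 i)^-1 *: mu_hat t i) 0 k|)).
    by apply: dot_l1_le => k; exact: mu_incr_le.
  by move=> k _; rewrite rowBE distrC.
have h3 : `|dot (mu_mean t - (push_weight t.+1 i)^-1 *: mu_hat t i)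
    (constr G i (x t i))| <= L * mu_disagree t i.
  rewrite [mu_disagree t i](eq_bigr (fun k => `|(mu_mean t -
      (push_weight t.+1 i)^-1 *: mu_hat t i) 0 k|)).
    by apply: dot_l1_le => k; exact: constr_coord_le.
  by move=> k _; rewrite rowBE distrC.
exact: dot_recentre_le a0 h1 h2 h3.
Qed.

Lemma mu_meanS t : mu_mean t.+1 = mu_mean t + N%:R^-1 *: \sum_i mu_incr t i.
Proof.
rewrite /mu_mean -scalerDr; congr (_ *: _); apply/rowP => k.
rewrite mxE !summxE; under eq_bigr do rewrite mu_step.
rewrite big_split /=; congr (_ + _); rewrite -sum_mu_hat.
by apply: eq_bigr => i _; rewrite mu_hatE.
Qed.

Lemma dual_lyap_step t nu :
  N%:R * dot (mu_mean t.+1 - nu) (mu_mean t.+1 - nu) <=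
  N%:R * dot (mu_mean t - nu) (mu_mean t - nu) +
  2 * \sum_i dot (mu_incr t i) (mu_mean t - nu) +
  alpha t ^+ 2 * (N%:R * (m%:R * hbound ^+ 2)).
Proof.
set eb := N%:R^-1 *: \sum_i mu_incr t i.
have N0 : N%:R != 0 :> R by rewrite pnatr_eq0 -lt0n.
have -> : mu_mean t.+1 - nu = (mu_mean t - nu) + eb by rewrite mu_meanS addrAC.
have -> : \sum_i dot (mu_incr t i) (mu_mean t - nu) = N%:R * dot eb (mu_mean t - nu).
  by rewrite dotZl mulrA divff // mul1r dot_suml.
have eb_le : dot eb eb <= m%:R * (alpha t * hbound) ^+ 2.
  rewrite mulr_natl -[X in _ *+ X]card_ord -sumr_const; apply: ler_sum => k _.
  rewrite -expr2 -[X in X <= _]real_normK ?num_real // ler_sqr ?nnegrE //; last first.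
    by rewrite mulr_ge0 ?hbound_ge0 // ltW ?alpha_gt0.
  rewrite mxE summxE normrM ger0_norm ?invr_ge0 //.
  rewrite mulrC ler_pdivrMr ?ltr0n // (le_trans (ler_norm_sum _ _ _)) //.
  rewrite mulr_natr -[X in _ *+ X]card_ord -sumr_const.
  by apply: ler_sum => i _; exact: mu_incr_le.
have := ler_wpM2l (ler0n R N) eb_le; clear eb_le.
move: eb (mu_mean t - nu) (alpha t) hbound => a b al h.
by rewrite !(dotDl, dotDr) (dotC b a) => hh; lra.
Qed.

Definition lyap_err (nu : 'rV[R]_m) t : R :=
  alpha t ^+ 2 * (\sum_i enorm (direction t i) ^+ 2) +
  4 * L * Lf * (alpha t * \sum_i sigma_disagree t i) +
  (6 * L + 2 * hbound) * (alpha t * \sum_i mu_disagree t i) +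
  alpha t ^+ 2 * (2 * N%:R * (m%:R * (hbound ^+ 2 / delta)) +
                  N%:R * (m%:R * hbound ^+ 2)) +
  alpha t * beta t * (2 * N%:R * (N%:R * dot nu nu)).

Lemma lyap_step (y : profile G) nu t : strats G y -> orthant nu ->
  lyap y nu t.+1 <= lyap y nu t - 2 * alpha t * (drift y nu t + noise_term y t) +
    lyap_err nu t.
Proof.
move=> hy nu0.
have h1 := @ler_sum R 'I_N (index_enum _) predT _ _ (fun i _ => primal_step t (hy i)).
rewrite !big_split /= sumrN -!mulr_sumr !big_split /= sumrN in h1.
have h2 := @ler_sum R 'I_N (index_enum _) predT _ _ (fun i _ => dual_step t i nu0).
rewrite !big_split /= -!mulr_sumr !sumr_const card_ord in h2.
rewrite -(dot_suml _ _ (fun i => constr G i (x t i))) -/(constr_sum G (x t)) in h2.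
rewrite -(dot_sumr _ _ (fun i => constr G i (x t i))) -/(constr_sum G (x t)) in h1.
rewrite -(dot_sumr _ _ (fun i => constr G i (y i))) -/(constr_sum G y) in h1.
rewrite dotBr !(dotC (constr_sum G (x t))) !mulrnAr in h2.
exact: combine_primal_dual_steps h1 h2 (dual_lyap_step t nu).
Qed.

(** The sources of error: [sa2b2] for the squared directions, [csig] (through [sa2b]) for the
    aggregate estimates, [cmu] and [sa2] for the multiplier increments, [sab] for the
    regularisation. *)
Definition lyap_err_bound (nu : 'rV[R]_m) : R :=
  N%:R * cdir ^+ 2 * sa2b2 + 4 * L * Lf * csig + (6 * L + 2 * hbound) * cmu +
  (2 * N%:R * (m%:R * (hbound ^+ 2 / delta)) + N%:R * (m%:R * hbound ^+ 2)) * sa2 +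
  (2 * N%:R * (N%:R * dot nu nu)) * sab.

Lemma sum_lyap_err nu T : \sum_(t < T) lyap_err nu t <= lyap_err_bound nu.
Proof.
rewrite !big_split /= -!mulr_sumr -!mulr_suml; have h0 := hbound_ge0.
have L1 := ltW L0; have Lf1 := ltW Lf0; have d1 := ltW delta0.
apply: lerD; last first.
  by rewrite [X in X <= _]mulrC ler_wpM2l ?hab // !mulr_ge0 ?dot_ge0.
apply: lerD; last first.
  by rewrite [X in X <= _]mulrC ler_wpM2l ?ha2 // addr_ge0 // !mulr_ge0 ?sqr_ge0 // ?invr_ge0.
apply: lerD; last first.
  by rewrite ler_wpM2l ?sum_mu_disagree // addr_ge0 // mulr_ge0.
apply: lerD; last by rewrite ler_wpM2l ?sum_sigma_disagree // !mulr_ge0.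
apply: (@le_trans _ _ (\sum_(t < T) N%:R * cdir ^+ 2 * (alpha t ^+ 2 / beta t ^+ 2))).
  apply: ler_sum => t _.
  rewrite (_ : N%:R * cdir ^+ 2 * _ = alpha t ^+ 2 * (N%:R * (cdir / beta t) ^+ 2)).
    rewrite ler_wpM2l ?sqr_ge0 // mulr_natl -[X in _ *+ X]card_ord -sumr_const.
    apply: ler_sum => i _; rewrite ler_sqr ?nnegrE ?enorm_ge0 ?direction_le_beta //.
    by rewrite divr_ge0 ?cdir_ge0 // ltW ?beta_gt0.
  by move: cdir (beta_gt0 t) => c b0; field; rewrite gt_eqF.
by rewrite -mulr_sumr ler_wpM2l // mulr_ge0 ?sqr_ge0.
Qed.

Lemma lyap_sum_le (y : profile G) nu T : strats G y -> orthant nu ->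
  lyap y nu T + 2 * \sum_(t < T) alpha t * (drift y nu t + noise_term y t) <=
  lyap y nu 0 + \sum_(t < T) lyap_err nu t.
Proof.
move=> hy nu0; elim: T => [|T IH]; first by rewrite !big_ord0 mulr0.
rewrite !big_ord_recr /=; have := lyap_step T hy nu0; lra.
Qed.

Lemma lyap_err_ge0 nu t : 0 <= lyap_err nu t.
Proof.
have a0 := ltW (alpha_gt0 t); have b0 := ltW (beta_gt0 t).
have h0 := hbound_ge0; have L1 := ltW L0; have Lf1 := ltW Lf0; have d1 := ltW delta0.
have s0 i : 0 <= sigma_disagree t i by exact: sumr_ge0.
have m0 i : 0 <= mu_disagree t i by exact: sumr_ge0.
rewrite !addr_ge0 // !mulr_ge0 ?dot_ge0 ?sqr_ge0 ?sumr_ge0 //.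
- by move=> i _; rewrite sqr_ge0.
- by rewrite addr_ge0 // mulr_ge0.
- by rewrite addr_ge0 // !mulr_ge0 ?sqr_ge0 // invr_ge0.
Qed.

Lemma mu_mean_ge0 t : orthant (mu_mean t).
Proof.
move=> k; rewrite mu_meanE mulr_ge0 ?invr_ge0 // sumr_ge0 // => i _.
exact: st_mu_ge0.
Qed.

Lemma strat_dist_le i a b : strat G i a -> strat G i b -> enorm (a - b) <= 2 * L.
Proof.
move=> ia ib; rewrite (le_trans (enormB _ _)) // mulrDl mul1r lerD //.
  by have [] := hL ia.
by have [] := hL ib.
Qed.

Lemma primal_dist_le (y : profile G) t : strats G y ->
  \sum_i dot (x t i - y i) (x t i - y i) <= N%:R * (2 * L) ^+ 2.
Proof.
move=> hy; rewrite mulr_natl -[X in _ *+ X]card_ord -sumr_const.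
apply: ler_sum => i _; rewrite -enorm_sqr ler_sqr ?nnegrE ?enorm_ge0 //.
  exact: strat_dist_le (st_x_strats t i) (hy i).
by rewrite mulr_ge0 // ltW.
Qed.

Lemma lyap0_le (y : profile G) nu : strats G y ->
  lyap y nu 0 <= N%:R * (2 * L) ^+ 2 + N%:R * dot nu nu.
Proof.
move=> hy; rewrite /lyap lerD ?primal_dist_le // (_ : mu_mean 0 = 0).
  by rewrite sub0r dotNl dotNr opprK.
by rewrite /mu_mean st0 /= big1 ?scaler0.
Qed.

Lemma noise_term_le (y : profile G) t : strats G y ->
  `|noise_term y t| <= N%:R * ((S + B) * (2 * L)).
Proof.
move=> hy; rewrite (le_trans (ler_norm_sum _ _ _)) //.
rewrite mulr_natl -[X in _ *+ X]card_ord -sumr_const; apply: ler_sum => i _.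
rewrite (le_trans (ler_norm_dot _ _)) // ler_pM ?enorm_ge0 //.
  by rewrite (le_trans (enormB _ _)) // lerD ?hS // hB //; exact: st_x_strats.
exact: strat_dist_le (st_x_strats t i) (hy i).
Qed.

Lemma pg_term_le (y : profile G) t : strats G y ->
  `|\sum_i dot (pg (x t) i) (x t i - y i)| <= N%:R * (B * (2 * L)).
Proof.
move=> hy; rewrite (le_trans (ler_norm_sum _ _ _)) //.
rewrite mulr_natl -[X in _ *+ X]card_ord -sumr_const; apply: ler_sum => i _.
rewrite (le_trans (ler_norm_dot _ _)) // ler_pM ?enorm_ge0 //.
  by rewrite hB //; exact: st_x_strats.
exact: strat_dist_le (st_x_strats t i) (hy i).
Qed.

(** * Uniform bounds along the path by comparison with a Slater point *)

Variables (ys : profile G) (kappa : R).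
Hypotheses (hys : strats G ys) (kappa0 : 0 < kappa)
  (hkappa : forall nu, orthant nu -> dot nu (constr_sum G ys) <= - kappa * \sum_k nu 0 k).

Definition cslater : R := N%:R * ((S + B) * (2 * L)) + N%:R * (B * (2 * L)).

Definition lyap_bound : R := N%:R * (2 * L) ^+ 2 + N%:R * (cslater / kappa) ^+ 2 +
  2 * cslater + lyap_err_bound 0.

(** A dichotomy at each step, with [nu = 0]. If the multiplier is large, Slater's margin outweighs
    noise and gradient term, and [lyap] grows at most by the error. If it is small, [lyap] is below
    a fixed level and one step adds at most [2 * cslater] plus the error, as [alpha t <= 1]. The
    noise is bounded here, not averaged. *)
Lemma lyap_slater_le t : lyap ys 0 t <= lyap_bound.
Proof.
have c0 : 0 <= cslater.
  apply: addr_ge0; first exact: le_trans (normr_ge0 _) (noise_term_le 0 hys).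
  exact: le_trans (normr_ge0 _) (pg_term_le 0 hys).
have o0 : orthant (0 : 'rV[R]_m) by move=> k; rewrite mxE.
suff: lyap ys 0 t <= N%:R * (2 * L) ^+ 2 + N%:R * (cslater / kappa) ^+ 2 +
    2 * cslater + \sum_(s < t) lyap_err 0 s.
  by move/le_trans; apply; rewrite lerD2l sum_lyap_err.
elim: t => [|t IH].
  rewrite big_ord0 addr0 (le_trans (lyap0_le 0 hys)) // dot0l mulr0 addr0.
  by rewrite -addrA lerDl addr_ge0 // mulr_ge0 ?sqr_ge0.
have h := lyap_step t hys o0; rewrite big_ord_recr /=.
have a0 := alpha_gt0 t; have a1 := alpha_le1 t.
have hd : kappa * \sum_k mu_mean t 0 k - cslater <= drift ys 0 t + noise_term ys t.
  rewrite /drift dot0l addr0; have h1 := hkappa (mu_mean_ge0 t).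
  have /ler_normlP[h2 _] := noise_term_le t hys.
  have /ler_normlP[h3 _] := pg_term_le t hys.
  rewrite mulNr in h1; rewrite /cslater.
  move: h1 h2 h3; move: (dot (mu_mean t) _) (noise_term _ _) (\sum_i dot _ _).
  by move=> *; lra.
have [big|small] := leP cslater (kappa * \sum_k mu_mean t 0 k).
  have hn : 0 <= drift ys 0 t + noise_term ys t.
    by apply: (le_trans _ hd); rewrite subr_ge0.
  have := mulr_ge0 (ltW a0) hn; move: h IH; lra.
have err0 : 0 <= \sum_(s < t) lyap_err 0 s.
  by apply: sumr_ge0 => s _; exact: lyap_err_ge0.
have mub : N%:R * dot (mu_mean t - 0) (mu_mean t - 0) <= N%:R * (cslater / kappa) ^+ 2.
  rewrite ler_wpM2l // subr0 -enorm_sqr ler_sqr ?nnegrE ?enorm_ge0 //.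
    rewrite (le_trans (enorm_le_l1 _)) // ler_pdivlMr // mulrC.
    rewrite (eq_bigr (fun k => mu_mean t 0 k)); first exact: ltW.
    by move=> k _; rewrite ger0_norm //; exact: mu_mean_ge0.
  by rewrite divr_ge0 // ltW.
have pd := primal_dist_le t hys.
have mean0 : 0 <= kappa * \sum_k mu_mean t 0 k.
  by rewrite mulr_ge0 ?(ltW kappa0) // sumr_ge0 // => k _; exact: mu_mean_ge0.
have hn : - cslater <= drift ys 0 t + noise_term ys t.
  by apply: (le_trans _ hd); rewrite lerBrDr addrC subrr.
have h5 := ler_wpM2l (ltW a0) hn.
have h6 : alpha t * cslater <= cslater by rewrite ler_piMl.
have h7 : lyap ys 0 t <= N%:R * (2 * L) ^+ 2 + N%:R * (cslater / kappa) ^+ 2.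
  exact: lerD pd mub.
move: h h5 h6 h7 err0; lra.
Qed.

(** [lyap_bound] controls the square of each coordinate of [mu_mean], so [lyap_bound + 1] dominates
    the coordinate itself. *)
Definition cincr : R := S + m%:R * (N%:R * (lyap_bound + 1)) * M / delta.

Lemma x_incr_bound t i : enorm (x t.+1 i - x t i) <= alpha t * cincr.
Proof.
rewrite (le_trans (x_incr_le t i)) // ler_wpM2l ?(ltW (alpha_gt0 t)) //.
apply: direction_le; rewrite (le_trans (enorm_le_l1 _)) //.
rewrite mulr_natl -[X in _ *+ X]card_ord -sumr_const; apply: ler_sum => k _.
rewrite ger0_norm ?mu_hat_ge0 // (le_trans (mu_hat_le t i k)) //.
have -> : \sum_j mu t j 0 k = N%:R * mu_mean t 0 k.
  by rewrite mu_meanE /mean mulrA divff ?mul1r // pnatr_eq0 -lt0n.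
rewrite ler_wpM2l //; have mk := mu_mean_ge0 t k.
have h1 : mu_mean t 0 k ^+ 2 <= lyap_bound.
  apply: (le_trans _ (lyap_slater_le t)); rewrite /lyap subr0.
  apply: (@le_trans _ _ (dot (mu_mean t) (mu_mean t))).
    rewrite -enorm_sqr -[X in X <= _]real_normK ?num_real //.
    by rewrite ler_sqr ?nnegrE ?enorm_ge0 // coord_le_enorm.
  apply: (@le_trans _ _ (N%:R * dot (mu_mean t) (mu_mean t))).
    by rewrite ler_peMl ?dot_ge0 // ler1n.
  by rewrite lerDr sumr_ge0 // => j _; rewrite dot_ge0.
have := sqr_ge0 (mu_mean t 0 k - 1); rewrite sqrrB1.
move: h1 mk; lra.
Qed.

(** The drift dominates the gap at a saddle point, and the final value of [lyap] is nonnegative.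
    Nothing on the right depends on the samples. *)
Lemma path_gap_sum (xs : profile G) mus T : saddle xs mus ->
  2 * \sum_(t < T) alpha t * (gap (x t) xs + noise_term xs t) <=
  N%:R * (2 * L) ^+ 2 + N%:R * dot mus mus + lyap_err_bound mus.
Proof.
move=> hsad; have hs := saddle_strats hsad.
have h1 := lyap_sum_le T hs (saddle_mu_ge0 hsad).
have h2 : 0 <= lyap xs mus T.
  rewrite addr_ge0 ?mulr_ge0 ?dot_ge0 // sumr_ge0 // => i _; exact: dot_ge0.
have h3 := lerD (lyap0_le mus hs) (sum_lyap_err mus T).
apply: (le_trans _ h3); apply: (le_trans _ h1).
rewrite -[X in X <= _]add0r lerD // ler_wpM2l //; apply: ler_sum => t _.
rewrite ler_wpM2l ?(ltW (alpha_gt0 t)) // lerD2r /drift.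
have v := saddle_vi hsad (st_x_strats t).
have w := dot_orthant_le0 (mu_mean_ge0 t) (saddle_feasible hsad).
have -> : gap (x t) xs = \sum_i dot (pg (x t) i) (x t i - xs i) -
    \sum_i dot (pg xs i) (x t i - xs i).
  by rewrite -sumrB; apply: eq_bigr => i _; exact: dotBl.
exact: drift_cancel_le v w.
Qed.

End Path.

(** * Measurability *)

Section Grid.
Context {R : realType} {k : nat}.
Implicit Types (v e : 'rV[R]_k).

Definition grid_scale (q : nat) : R := q.+1%:R ^+ 2.

Lemma grid_scale_gt0 q : 0 < grid_scale q.
Proof. by rewrite exprn_gt0. Qed.

Definition grid (q : nat) v : 'rV[R]_k :=
  \row_j ((Num.floor (v 0 j * grid_scale q))%:~R / grid_scale q).

Lemma grid_dist q v : `|grid q v - v| <= (grid_scale q)^-1.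
Proof.
have c0 := grid_scale_gt0 q.
rewrite [`|_|]mx_normrE; apply: bigmax_le => [|[i j] _ /=].
  by rewrite invr_ge0 ltW.
rewrite ord1 rowBE mxE; have /andP[] := floor_itv (v 0 j * grid_scale q).
rewrite intrD -ler_pdivrMr // -ltr_pdivlMr // mulrDl mul1r => h1 h2.
by rewrite distrC ger0_norm ?subr_ge0 // lerBlDl ltW.
Qed.

Lemma grid_scale_small (r : R) : 0 < r ->
  \forall q \near \oo, (grid_scale q)^-1 <= q.+1%:R^-1 /\ q.+1%:R^-1 < r.
Proof.
move=> r0; near=> q; have q0 : 0 < q.+1%:R :> R by [].
split.
  rewrite lef_pV2 ?posrE ?grid_scale_gt0 // /grid_scale expr2.
  by rewrite ler_peMl // ler1n.
by near: q; exact: near_infty_natSinv_lt (PosNum r0).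
Unshelve. all: by end_near. Qed.

Lemma grid_cvg v : grid q v @[q --> \oo] --> v.
Proof.
apply/cvgrPdist_le => r r0; near=> q.
have [h1 h2] : (grid_scale q)^-1 <= q.+1%:R^-1 /\ q.+1%:R^-1 < r.
  by near: q; exact: grid_scale_small.
by rewrite distrC (le_trans (grid_dist q v)) // (le_trans h1) // ltW.
Unshelve. all: by end_near. Qed.

(* The grid is finer than the increment 1/(q+1), so the rounding error is
   negligible in the difference quotient. *)
Lemma grid_diff_cvg (Psi : 'rV[R]_k -> R) v e :
  differentiable (Psi : _ -> R^o) v ->
  q.+1%:R * (Psi (grid q v + q.+1%:R^-1 *: e) - Psi (grid q v)) @[q --> \oo] -->
  'd (Psi : _ -> R^o) v e.
Proof.
move=> dPsi; apply/cvgrPdist_le => r r0.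
have C0 : 0 < 2 + `|e| by rewrite ltr_pwDl.
have r1 : 0 < r / (2 + `|e|) by rewrite divr_gt0.
have := diff_locally dPsi => /eqaddoP/(_ _ r1)/nbhs_ballP[s /= s0 hs].
have hs' h : `|h| < s -> `|Psi (v + h) - (Psi v + 'd (Psi : _ -> R^o) v h)| <=
    r / (2 + `|e|) * `|h|.
  move=> hh; have := hs h; rewrite -ball_normE /ball_ /= sub0r normrN => /(_ hh).
  by rewrite [_ \o _]/comp /= !fctE /= (addrC h).
have s1 : 0 < s / (1 + `|e|) by rewrite divr_gt0 // ltr_pwDl.
near=> q; have q0 : 0 < q.+1%:R :> R by [].
have [g1 g2] : (grid_scale q)^-1 <= q.+1%:R^-1 /\ q.+1%:R^-1 < s / (1 + `|e|).
  by near: q; exact: grid_scale_small.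
set a := q.+1%:R : R in q0 g1 g2 *.
pose h2 := grid q v - v; pose h1 := h2 + a^-1 *: e.
have n2 : `|h2| <= a^-1 * a^-1.
  by rewrite (le_trans (grid_dist q v)) // /grid_scale -/a expr2 invfM.
have ai : 0 < a^-1 by rewrite invr_gt0.
have ai1 : a^-1 <= 1 by rewrite invf_le1 // ler1n.
have n2' : `|h2| <= a^-1 by apply: (le_trans n2); rewrite ler_piMl // ltW.
have n1 : `|h1| <= a^-1 * (1 + `|e|).
  rewrite (le_trans (ler_normD _ _)) // mulrDr mulr1 lerD //.
  by rewrite normrZ gtr0_norm.
have as' : a^-1 * (1 + `|e|) < s by rewrite -ltr_pdivlMr // ltr_pwDl.
have l1 : `|h1| < s by exact: le_lt_trans n1 as'.
have l2 : `|h2| < s.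
  by rewrite (le_lt_trans n2') // (le_lt_trans _ as') // ler_peMr ?(ltW ai) // lerDl.
have := hs' _ l1; have := hs' _ l2.
have -> : v + h1 = grid q v + a^-1 *: e by rewrite /h1 /h2 addrA (addrCA v) subrr addr0.
have -> : v + h2 = grid q v by rewrite /h2 addrCA subrr addr0.
have -> : 'd (Psi : _ -> R^o) v h1 = 'd (Psi : _ -> R^o) v h2 + a^-1 * 'd (Psi : _ -> R^o) v e.
  by rewrite /h1 linearD linearZ.
move: n1 n2'; move: `|h1| `|h2| (Psi (grid q v)) (Psi (_ + _)) ('d (Psi : _ -> R^o) v h2)
  ('d (Psi : _ -> R^o) v e) => x1 x2 p1 p2 d2 de n1 n2' b2 b1.
rewrite (_ : de - a * (p2 - p1) = a * ((p1 - (Psi v + d2)) - (p2 - (Psi v + (d2 + a^-1 * de))))).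
  rewrite normrM (gtr0_norm q0) mulrC -ler_pdivlMr //.
  rewrite (le_trans (ler_normB _ _)) // (le_trans (lerD b2 b1)) // -mulrDr.
  rewrite (le_trans (ler_wpM2l (ltW r1) (lerD n2' n1))) //.
  rewrite (_ : a^-1 + _ = a^-1 * (2 + `|e|)); last by ring.
  by rewrite mulrCA divfK ?gt_eqF // mulrC.
by field; rewrite gt_eqF.
Unshelve. all: by end_near. Qed.

End Grid.

Section MeasurableWrt.
Context {d : measure_display} {T : measurableType d} {R : realType}.

Lemma measurable_wrt_open (U : topologicalType) (Y : T -> U) :
  (forall O, open O -> measurable (Y @^-1` O)) -> measurable_wrt measurable Y.
Proof.
move=> h B; apply: (smallest_sub (X := [set B | measurable (Y @^-1` B)])) => //.
split => [|A mA|A mA] /=.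
- by rewrite preimage_set0.
- by rewrite setTD preimage_setC; exact: measurableC.
- by rewrite preimage_bigcup; exact: bigcupT_measurable.
Qed.

Lemma open_borel (U : topologicalType) (O : set U) : open O -> borel O.
Proof. exact: sub_sigma_algebra. Qed.

Lemma measurable_wrt_funP (f : T -> R) :
  measurable_wrt measurable f <-> measurable_fun setT f.
Proof.
split=> [h|mf].
  apply: (measurability _ (RGenOpens.measurableE R)) => _ [_ [a [b ->]] <-].
  by rewrite setTI; apply: h; apply: open_borel; exact: interval_open.
apply: measurable_wrt_open => O oO; rewrite -[X in measurable X]setTI.
by apply: mf => //; exact: open_measurable.
Qed.

Lemma measurable_wrt_comp (U V : topologicalType) (Y : T -> U) (h : U -> V) :
  continuous h -> measurable_wrt measurable Y ->
  measurable_wrt measurable (h \o Y).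
Proof.
move=> hc mY; apply: measurable_wrt_open => O oO; rewrite comp_preimage.
by apply: mY; apply: open_borel; exact: open_comp.
Qed.

(** The limit lies in an open set when, for some [l], the approximations eventually stay among the
    points whose ball of radius 1/(l+1) lies in that set; taking the interior makes these points an
    open set. *)
Lemma measurable_wrt_cvg (V : normedModType R) (Yn : nat -> T -> V) (Y : T -> V) :
  (forall q, measurable_wrt measurable (Yn q)) ->
  (forall w, Yn q w @[q --> \oo] --> Y w) -> measurable_wrt measurable Y.
Proof.
move=> mYn cY; apply: measurable_wrt_open => O oO.
pose C (l : nat) := interior [set v | ball v l.+1%:R^-1 `<=` O].
suff -> : Y @^-1` O = \bigcup_l \bigcup_i \bigcap_(q in [set q | (i <= q)%N])
    (Yn q @^-1` C l).
  apply: bigcupT_measurable => l; apply: bigcupT_measurable => i.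
  apply: bigcap_measurableType => q _; apply: mYn; apply: open_borel.
  exact: open_interior.
apply/seteqP; split => w /=.
  move=> Ow; have /nbhs_ballP[r /= r0 hr] : nbhs (Y w) O by exact: open_nbhs_nbhs.
  have r2 : 0 < r / 2 by rewrite divr_gt0.
  have [l _ hl] := near_infty_natSinv_lt (PosNum r2).
  have /(_ l (leqnn l)) /= lr := hl.
  have /cvgrPdistC_lt/(_ _ r2)[i _ hi] := cY w.
  exists l => //; exists i => // q /= iq.
  have := hi q iq => /= hq.
  rewrite /C /interior /=; apply/nbhs_ballP; exists (r / 2 - `|Yn q w - Y w|).
    by rewrite /= subr_gt0.
  move=> v; rewrite -ball_normE /ball_ /= => hv v'.
  move=> hv'; apply: hr; rewrite -ball_normE /ball_ /=.
  rewrite (_ : Y w - v' = (v - v') + (Yn q w - v) - (Yn q w - Y w)); last first.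
    by rewrite opprB (addrC (v - v')) subrKA [RHS]addrC subrKA.
  rewrite (le_lt_trans (ler_normB _ _)) //; have := ler_normD (v - v') (Yn q w - v).
  by have := lt_trans hv' lr; move=> hv2; lra.
move=> [l _ [i _ h]].
have l0 : 0 < l.+1%:R^-1 :> R by rewrite invr_gt0.
have /cvgrPdistC_lt/(_ _ l0)[j _ hj] := cY w.
have := h (maxn i j) (leq_maxl _ _) => /interior_subset /=; apply.
by rewrite -ball_normE /=; apply: hj; exact: leq_maxr.
Qed.

Variable k : nat.
Variable X : T -> 'rV[R]_k.
Hypothesis mX : forall j, measurable_fun setT (fun w => X w 0 j).

(** The rounded point takes countably many values, and on each cell the function is a fixed [Phi v].
    This is how a family measurable only for each parameter gets evaluated at a random parameter. *)
Lemma measurable_wrt_grid (U : topologicalType) (Phi : 'rV[R]_k -> T -> U) q :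
  (forall v, measurable_wrt measurable (Phi v)) ->
  measurable_wrt measurable (fun w => Phi (grid q (X w)) w).
Proof.
move=> mPhi B bB.
pose cell (z : 'rV[int]_k) := \bigcap_(j in [set: 'I_k])
  [set w | Num.floor (X w 0 j * grid_scale q) = z 0 j].
pose pt (z : 'rV[int]_k) : 'rV[R]_k := \row_j ((z 0 j)%:~R / grid_scale q).
have -> : (fun w => Phi (grid q (X w)) w) @^-1` B =
    \bigcup_z (cell z `&` Phi (pt z) @^-1` B).
  apply/seteqP; split => w /=.
    move=> Bw; exists (\row_j Num.floor (X w 0 j * grid_scale q)) => //.
    split; first by move=> j _ /=; rewrite mxE.
    rewrite /= (_ : pt _ = grid q (X w)) //.
    by apply/rowP => j; rewrite !mxE.
  move=> [z _ [cz]] /=; rewrite (_ : pt z = grid q (X w)) //.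
  by apply/rowP => j; rewrite !mxE; rewrite -(cz j).
apply: countable_bigcupT_measurable; first exact: countableP.
move=> z; apply: measurableI; last exact: mPhi.
apply: fin_bigcap_measurable => // j _.
rewrite (_ : [set w | _] = setT `&` (fun w => X w 0 j * grid_scale q) @^-1`
    `[(z 0 j)%:~R, (z 0 j + 1)%:~R[%classic).
  by apply: measurable_funM => //; exact: measurable_itv.
rewrite setTI; apply/seteqP; split => w /=; rewrite in_itv /= -floor_eq.
  by move=> ->.
by move/eqP.
Qed.

Lemma measurable_wrt_row : measurable_wrt measurable X.
Proof.
apply: (@measurable_wrt_cvg _ (fun q w => grid q (X w))).
  move=> q; apply: (measurable_wrt_grid (Phi := fun v _ => v)) => v B _.
  have [Bv|nBv] := pselect (B v).
    by rewrite (_ : _ @^-1` _ = setT) //; apply/seteqP; split.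
  by rewrite (_ : _ @^-1` _ = set0) //; apply/seteqP; split.
by move=> w; exact: grid_cvg.
Qed.

Lemma measurable_wrt_cst (U : topologicalType) (v : U) :
  measurable_wrt measurable (fun _ : T => v).
Proof.
move=> B _; have [Bv|nBv] := pselect (B v).
  by rewrite (_ : _ @^-1` _ = setT) //; apply/seteqP; split.
by rewrite (_ : _ @^-1` _ = set0) //; apply/seteqP; split.
Qed.

Lemma measurable_wrt_at_continuous (V : normedModType R) (h : 'rV[R]_k -> V) :
  (forall w, {for X w, continuous h}) -> measurable_wrt measurable (h \o X).
Proof.
move=> hc; apply: (@measurable_wrt_cvg _ (fun q w => h (grid q (X w)))).
  move=> q; apply: (measurable_wrt_grid (Phi := fun v _ => h v)) => v.
  exact: measurable_wrt_cst.
by move=> w; apply: continuous_cvg (hc w) _; exact: grid_cvg.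
Qed.

(** [grid_diff_cvg] presents the derivative as a pointwise limit of quotients that depend on [X w]
    only through its rounding; measurability of [Psi v] for fixed [v] then suffices. *)
Lemma measurable_diff (Psi : 'rV[R]_k -> T -> R) e :
  (forall v, measurable_fun setT (Psi v)) ->
  (forall w, differentiable (Psi ^~ w : _ -> R^o) (X w)) ->
  measurable_fun setT (fun w => 'd (Psi ^~ w : _ -> R^o) (X w) e).
Proof.
move=> mPsi dPsi; apply/measurable_wrt_funP.
apply: (@measurable_wrt_cvg R^o (fun q w => q.+1%:R *
  (Psi (grid q (X w) + q.+1%:R^-1 *: e) w - Psi (grid q (X w)) w))).
  move=> q; apply: (measurable_wrt_grid
    (Phi := fun v w => q.+1%:R * (Psi (v + q.+1%:R^-1 *: e) w - Psi v w))) => v.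
  apply/measurable_wrt_funP; apply: measurable_funM => //.
  by apply: measurable_funB; exact: mPsi.
by move=> w; exact: grid_diff_cvg (dPsi w).
Qed.

End MeasurableWrt.

(** * Measurability of one step of the algorithm *)

Section StepMeasurable.
Context {R : realType}.

Lemma lipschitz_continuous k l (f : 'rV[R]_k -> 'rV[R]_l) :
  (forall u v, enorm (f u - f v) <= enorm (u - v)) -> continuous f.
Proof.
move=> hf v; apply/(@cvgrPdist_le _ _ _ (nbhs v)) => e e0.
have K0 : 0 < k%:R + 1 :> R by rewrite ltr_wpDl.
apply/nbhs_ballP; exists (e / (k%:R + 1)); first by rewrite /= divr_gt0.
move=> w; rewrite mx_norm_ball /ball_ /= => vw.
rewrite (le_trans (norm_le_enorm _)) // (le_trans (hf _ _)) //.
rewrite (le_trans (enorm_le_norm _)) //.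
rewrite (@le_trans _ _ ((k%:R + 1) * (e / (k%:R + 1)))) //; last first.
  by rewrite mulrC divfK // gt_eqF.
by rewrite ler_pM // ?lerDl // ltW.
Qed.

Lemma diff_row_mx k l (F : 'rV[R]_k * 'rV[R]_l -> R) a y p q :
  differentiable (F : _ -> R^o) (a, y) ->
  differentiable ((fun v => F (lsubmx v, rsubmx v)) : 'rV[R]_(k + l) -> R^o)
    (row_mx a y) /\
  'd ((fun v => F (lsubmx v, rsubmx v)) : 'rV[R]_(k + l) -> R^o) (row_mx a y)
    (row_mx p q) = 'd (F : _ -> R^o) (a, y) (p, q).
Proof.
move=> dF.
have cl : continuous (@lsubmx R 1 k l).
  by move=> v; apply: differentiable_continuous; exact: differentiable_lsubmx.
have cr : continuous (@rsubmx R 1 k l).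
  by move=> v; apply: differentiable_continuous; exact: differentiable_rsubmx.
have dh : differentiable (fun v : 'rV[R]_(k + l) => (lsubmx v, rsubmx v)) (row_mx a y).
  by apply: differentiable_pair; [exact: differentiable_lsubmx|exact: differentiable_rsubmx].
have dF' : differentiable (F : _ -> R^o) (lsubmx (row_mx a y), rsubmx (row_mx a y)).
  by rewrite row_mxKl row_mxKr.
split; first exact: (differentiable_comp dh dF').
have e1 : 'd (@lsubmx R 1 k l) (row_mx a y) (row_mx p q) = p.
  by rewrite (diff_lin _ cl); exact: row_mxKl.
have e2 : 'd (@rsubmx R 1 k l) (row_mx a y) (row_mx p q) = q.
  by rewrite (diff_lin _ cr); exact: row_mxKr.
have eh : 'd (fun v : 'rV[R]_(k + l) => (lsubmx v, rsubmx v)) (row_mx a y)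
    (row_mx p q) = (p, q).
  rewrite (diff_pair (differentiable_lsubmx _) (differentiable_rsubmx _)).
  by congr (_, _).
by rewrite (diff_comp dh dF') [LHS]/= eh row_mxKl row_mxKr.
Qed.

Context {d : measure_display} {Omega : measurableType d}
  {P : probability Omega R} {N n m : nat} (G : aggGame P N n m).
Hypotheses (hgame : game_assumption G) (hwp : well_posed G).

Lemma eproj_strat_continuous i : continuous (eproj (strat G i)).
Proof.
have hn v : nearest (strat G i) v (eproj (strat G i) v).
  apply: eproj_nearest; apply: compact_nearest; first exact: (strat_compact hgame).
  exact: (strat_nonempty hgame).
apply: lipschitz_continuous => u v.
exact: nearest_nonexp (strat_lconvex hgame (i := i)) (hn u) (hn v).
Qed.

Context {dT : measure_display} {T : measurableType dT}.

Definition coord_measurable k (X : T -> 'rV[R]_k) :=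
  forall j, measurable_fun setT (fun w => X w 0 j).

Lemma coord_measurable_wrt k (X : T -> 'rV[R]_k) :
  measurable_wrt measurable X -> coord_measurable X.
Proof.
move=> mX j; apply/measurable_wrt_funP.
by apply: (measurable_wrt_comp (h := fun v : 'rV[R]_k => v 0 j)) mX;
  exact: coord_continuous.
Qed.

Lemma coord_measurableD k (X Y : T -> 'rV[R]_k) :
  coord_measurable X -> coord_measurable Y -> coord_measurable (fun w => X w + Y w).
Proof.
move=> mX mY j; under eq_fun do rewrite mxE.
by apply: measurable_funD; [exact: mX|exact: mY].
Qed.

Lemma coord_measurableZ k (c : R) (X : T -> 'rV[R]_k) :
  coord_measurable X -> coord_measurable (fun w => c *: X w).
Proof.
move=> mX j; under eq_fun do rewrite mxE.
by apply: measurable_funM => //; exact: mX.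
Qed.

Lemma coord_measurableB k (X Y : T -> 'rV[R]_k) :
  coord_measurable X -> coord_measurable Y -> coord_measurable (fun w => X w - Y w).
Proof.
move=> mX mY j; under eq_fun do rewrite rowBE.
by apply: measurable_funB; [exact: mX|exact: mY].
Qed.

Lemma coord_measurable_sum k (I : Type) (r : seq I) (X : I -> T -> 'rV[R]_k) :
  (forall i, coord_measurable (X i)) -> coord_measurable (fun w => \sum_(i <- r) X i w).
Proof.
move=> mX j; under eq_fun do rewrite summxE.
by apply: measurable_sum => i; exact: mX.
Qed.

Lemma coord_measurable_row_mx k l (X : T -> 'rV[R]_k) (Y : T -> 'rV[R]_l) :
  coord_measurable X -> coord_measurable Y ->
  coord_measurable (fun w => row_mx (X w) (Y w)).
Proof.
move=> mX mY j; case: (split_ordP j) => i ->.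
  by under eq_fun do rewrite row_mxEl; exact: mX.
by under eq_fun do rewrite row_mxEr; exact: mY.
Qed.

Lemma coord_measurable_mulmx k l (X : T -> 'rV[R]_l) (A : T -> 'M[R]_(k, l)) :
  coord_measurable X -> (forall i j, measurable_fun setT (fun w => A w i j)) ->
  coord_measurable (fun w => X w *m (A w)^T).
Proof.
move=> mX mA j; under eq_fun do rewrite mxE.
apply: measurable_sum => i; apply: measurable_funM; first exact: mX.
by under eq_fun do rewrite mxE; exact: mA.
Qed.

Lemma coord_measurable_at_continuous k l (h : 'rV[R]_k -> 'rV[R]_l) (X : T -> 'rV[R]_k) :
  coord_measurable X -> (forall w, {for X w, continuous h}) ->
  coord_measurable (fun w => h (X w)).
Proof.
move=> mX hc; apply: coord_measurable_wrt.
exact: (measurable_wrt_at_continuous mX hc).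
Qed.

Lemma measurable_jacobian k l (h : 'rV[R]_k -> 'rV[R]_l) (X : T -> 'rV[R]_k) i j :
  coord_measurable X -> (forall w, differentiable h (X w)) ->
  measurable_fun setT (fun w => ('J h (X w)) i j).
Proof.
move=> mX dh.
have dc w : differentiable ((fun v => h v 0 j) : _ -> R^o) (X w).
  exact: (differentiable_comp (dh w) (differentiable_coord _ 0 j)).
have e w : ('J h (X w)) i j = 'd ((fun v => h v 0 j) : _ -> R^o) (X w) (delta_mx 0 i).
  by rewrite -diff_comp_coord // /jacobian mxE.
under eq_fun do rewrite e.
exact: (measurable_diff mX (Psi := fun v _ => h v 0 j)).
Qed.

(** Action and aggregate are joined into one row vector, on which [measurable_diff] acts; both
    partial gradients are values of the same total derivative. *)
Lemma measurable_qgrad i (X : T -> 'rV[R]_(Defs.dim G i)) (Y : T -> 'rV[R]_n)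
    (V : T -> 'rV[R]_(ndim G i)) :
  coord_measurable X -> coord_measurable Y -> measurable_wrt measurable V ->
  (forall w, strat G i (X w)) ->
  coord_measurable (fun w => qgrad G i (X w) (Y w) (V w)).
Proof.
move=> mX mY mV hX; have [_ mr _ dr] := hwp.
have mXY := coord_measurable_row_mx mX mY.
pose Psi v w := rcost G i (lsubmx v) (rsubmx v) (V w).
have mPsi v : measurable_fun setT (Psi v).
  apply/measurable_wrt_funP => B bB; rewrite /Psi.
  exact: (mV _ (mr i (lsubmx v) (rsubmx v) B bB)).
have dF w := dr i (V w) (X w) (Y w) (hX w).
have mdiff p q : measurable_fun setT (fun w =>
    'd ((fun v => rcost G i v.1 v.2 (V w)) : _ -> R^o) (X w, Y w) (p, q)).
  have e w : 'd ((fun v => rcost G i v.1 v.2 (V w)) : _ -> R^o) (X w, Y w) (p, q) =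
      'd (Psi ^~ w : _ -> R^o) (row_mx (X w) (Y w)) (row_mx p q).
    by rewrite (diff_row_mx p q (dF w)).2.
  under eq_fun do rewrite e.
  apply: measurable_diff => // w.
  exact: (diff_row_mx p q (dF w)).1.
rewrite /qgrad /agg_grad; apply: coord_measurableD.
  move=> j; under eq_fun do rewrite mxE.
  have e w := (diff_partial_l (delta_mx 0 j) (dF w)).2.
  by under eq_fun do rewrite e; exact: mdiff.
apply: coord_measurableZ; apply: coord_measurable_mulmx.
  move=> j; under eq_fun do rewrite mxE.
  have e w := (diff_partial_r (delta_mx 0 j) (dF w)).2.
  by under eq_fun do rewrite e; exact: mdiff.
move=> j l; apply: measurable_jacobian => // w.
exact: (agg_differentiable hgame).
Qed.

Variables (W : 'M[R]_N) (a b c : R) (z : 'I_N -> R).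
Variables (st : T -> state G) (V : T -> forall i, 'rV[R]_(ndim G i)).
Hypotheses (stz : forall w, st_z G (st w) = z)
  (sts : forall w, strats G (st_x G (st w)))
  (mx : forall i, coord_measurable (fun w => st_x G (st w) i))
  (mmu : forall i, coord_measurable (fun w => st_mu G (st w) i))
  (ms : forall i, coord_measurable (fun w => st_sigma G (st w) i))
  (mV : forall i, measurable_wrt measurable (fun w => V w i)).

Lemma mix_measurable k (f : T -> 'I_N -> 'rV[R]_k) i :
  (forall j, coord_measurable (fun w => f w j)) ->
  coord_measurable (fun w => \sum_j W i j *: f w j).
Proof.
by move=> mf; apply: coord_measurable_sum => j; exact: coord_measurableZ.
Qed.

Lemma step_x_measurable i :
  coord_measurable (fun w => st_x G (step G W a b c (V w) (st w)) i).
Proof.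
apply: coord_measurable_wrt.
rewrite (_ : (fun w => _) = eproj (strat G i) \o (fun w => st_x G (st w) i - a *:
  (qgrad G i (st_x G (st w) i)
     ((\sum_j W i j * z j)^-1 *: (\sum_j W i j *: st_sigma G (st w) j)) (V w i) +
   (\sum_j W i j * z j)^-1 *: ((\sum_j W i j *: st_mu G (st w) j) *m
     (constr_grad G i (st_x G (st w) i))^T)))); last first.
  by apply/funext => w /=; rewrite stz.
apply: measurable_wrt_comp; first exact: eproj_strat_continuous.
apply: measurable_wrt_row; apply: coord_measurableB => //.
apply: coord_measurableZ; apply: coord_measurableD.
  apply: measurable_qgrad => // [|w]; last exact: sts.
  by apply: coord_measurableZ; exact: mix_measurable.
apply: coord_measurableZ; apply: coord_measurable_mulmx.
  exact: mix_measurable.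
move=> k l; apply: measurable_jacobian => // w.
by apply: (constr_differentiable hgame); exact: sts.
Qed.

Lemma step_mu_measurable i :
  coord_measurable (fun w => st_mu G (step G W a b c (V w) (st w)) i).
Proof.
rewrite /= => k; under eq_fun do rewrite eproj_orthant mxE.
apply: measurable_maxr => //.
have mh : coord_measurable (fun w => \sum_j W i j *: st_mu G (st w) j).
  exact: mix_measurable.
apply: (coord_measurableD mh); apply: coord_measurableZ; apply: coord_measurableB.
  apply: coord_measurable_at_continuous => // w; apply: differentiable_continuous.
  by apply: (constr_differentiable hgame); exact: sts.
exact: coord_measurableZ.
Qed.

Lemma agg_measurable i (X : T -> 'rV[R]_(Defs.dim G i)) :
  coord_measurable X -> (forall w, strat G i (X w)) ->
  coord_measurable (fun w => agg G i (X w)).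
Proof.
move=> mX hX; apply: coord_measurable_at_continuous => // w.
by apply: differentiable_continuous; exact: (agg_differentiable hgame).
Qed.

(** The premise puts the new actions in the strategy sets, the points where [agg] is known to be
    continuous. *)
Lemma step_sigma_measurable i :
  (forall w, strats G (st_x G (step G W a b c (V w) (st w)))) ->
  coord_measurable (fun w => st_sigma G (step G W a b c (V w) (st w)) i).
Proof.
move=> hs; apply: coord_measurableB; last first.
  by apply: agg_measurable => // w; exact: sts.
apply: coord_measurableD; first exact: mix_measurable.
by apply: (agg_measurable (step_x_measurable (i := i))) => w; exact: hs.
Qed.

End StepMeasurable.

(** * Convergence of a path *)

(* The squares u_t^2 have summable increments, hence converge; their limit is 0
   because sum a_t = oo while sum a_t u_t < oo. *)
Lemma vanishing_of_summable {R : realType} (u a : nat -> R) (C sa2 D : R) :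
  0 <= C -> (forall t, 0 <= u t) -> (forall t, 0 < a t) ->
  (forall t, `|u t.+1 - u t| <= C * a t) ->
  (forall T, \sum_(t < T) a t ^+ 2 <= sa2) ->
  (forall T, \sum_(t < T) a t * u t <= D) ->
  (forall M, exists T, M <= \sum_(t < T) a t) -> u @ \oo --> (0 : R).
Proof.
move=> C0 u0 a0 du ha2 hD hinf.
(* The excess of the square of [u t + C * a t] over that of [u t]. *)
pose b t := 2 * C * (a t * u t) + C ^+ 2 * a t ^+ 2.
have b0 t : 0 <= b t.
  by rewrite addr_ge0 // !mulr_ge0 ?sqr_ge0 // ?exprn_ge0 // ltW.
pose s T : R := \sum_(t < T) b t.
have sS T : s T.+1 = s T + b T by rewrite /s big_ord_recr.
have snd : nondecreasing_seq s by apply/nondecreasing_seqP => T; rewrite sS lerDl.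
have sb T : s T <= 2 * C * D + C ^+ 2 * sa2.
  rewrite /s big_split /= -!mulr_sumr lerD //.
    by rewrite ler_wpM2l ?hD // mulr_ge0.
  by rewrite ler_wpM2l ?ha2 // exprn_ge0.
have scvg : cvgn s by apply: nondecreasing_is_cvgn => //; exists (2 * C * D + C ^+ 2 * sa2) => _ [T _ <-].
have u2 t : u t.+1 ^+ 2 <= u t ^+ 2 + b t.
  have : u t.+1 <= u t + C * a t.
    by have := du t; rewrite ler_norml => /andP[_]; lra.
  have h1 : 0 <= C * a t by rewrite mulr_ge0 // ltW.
  have -> : u t ^+ 2 + b t = (u t + C * a t) ^+ 2 by rewrite /b; ring.
  by move=> h; rewrite ler_sqr ?nnegrE // addr_ge0.
have u2s t k : u (t + k)%N ^+ 2 <= u t ^+ 2 + (s (t + k)%N - s t).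
  elim: k => [|k IH]; first by rewrite addn0 subrr addr0.
  by rewrite addnS sS; have := u2 (t + k)%N; lra.
apply/cvgrPdist_le => e e0.
have e20 : 0 < e ^+ 2 / 2 by rewrite divr_gt0 // exprn_gt0.
have /cvgrPdist_le/(_ _ e20)[T0 _ hT0] := scvg.
(* Otherwise [u] stays above [e / 2] after [T0], and divergence of the sum of [a] pushes the sum of
   [a t * u t] beyond [D]. *)
have [t1 t1T ut1] : exists2 t1, (T0 <= t1)%N & u t1 ^+ 2 <= e ^+ 2 / 2.
  apply: contrapT => hno.
  have big t : (T0 <= t)%N -> e / 2 <= u t.
    move=> tT; rewrite leNgt; apply/negP => hu; apply: hno; exists t => //.
    apply: (@le_trans _ _ ((e / 2) ^+ 2)).
      by rewrite ler_sqr ?nnegrE ?divr_ge0 ?(ltW e0) // ltW.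
    by have := sqr_ge0 e; lra.
  have [T hT] := hinf (2 * D / e + 1 + \sum_(t < T0) a t).
  have TT0 : (T0 <= T)%N.
    rewrite leqNgt; apply/negP => lt; have := hT; rewrite leNgt => /negP; apply.
    have D0 : 0 <= D by have := hD 0%N; rewrite big_ord0.
    have De : 0 <= 2 * D / e by rewrite divr_ge0 ?(ltW e0) // mulr_ge0.
    rewrite -(subnKC (ltnW lt)) big_split_ord /=.
    have : 0 <= \sum_(i < T0 - T) a (T + i)%N by rewrite sumr_ge0 // => t _; exact: ltW.
    by lra.
  have : e / 2 * (\sum_(t < T) a t - \sum_(t < T0) a t) <= D.
    apply: (le_trans _ (hD T)); rewrite -(subnKC TT0) !big_split_ord /=.
    rewrite addrAC subrr add0r mulr_sumr -[X in X <= _]add0r lerD //.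
      by rewrite sumr_ge0 // => t _; rewrite mulr_ge0 // ltW.
    by apply: ler_sum => t _; rewrite mulrC ler_wpM2l ?(ltW (a0 _)) // big // leq_addr.
  move=> h; have h2 : 2 * D / e + 1 <= \sum_(t < T) a t - \sum_(t < T0) a t by lra.
  have := ler_wpM2l (ltW (divr_gt0 e0 (ltr0Sn R 1))) h2.
  rewrite mulrDr mulr1 (_ : e / 2 * (2 * D / e) = D); first by lra.
  by field; rewrite gt_eqF.
exists t1 => // t /= tt1; rewrite sub0r normrN ger0_norm //.
rewrite -ler_sqr ?nnegrE ?(ltW e0) //.
have := u2s t1 (t - t1)%N; rewrite subnKC // => /le_trans; apply.
have l1 := hT0 t1 t1T.
have l2 : s t <= limn s by apply: nondecreasing_cvgn_le.
have : limn s - s t1 <= e ^+ 2 / 2 by apply: le_trans (ler_norm _) l1.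
lra.
Qed.

Section PathConvergence.
Context {R : realType} {d : measure_display} {Omega : measurableType d}
  {P : probability Omega R} {N n m : nat} (G : aggGame P N n m).
Hypotheses (hN : (0 < N)%N) (hgame : game_assumption G)
  (hmono : strictly_monotone G).
Variables (xs : profile G) (B : R).
Hypotheses (hxs : strats G xs)
  (hB : forall (y : profile G) i, strats G y -> enorm (pg y i) <= B).

Definition pdist (x y : profile G) : R := \sum_i enorm (x i - y i).

Lemma pdist_ge0 x y : 0 <= pdist x y.
Proof. by apply: sumr_ge0 => i _; exact: enorm_ge0. Qed.

Lemma pdist_continuous (y : profile G) :
  continuous (fun u : 'rV[R]_(\sum_i Defs.dim G i + m) => pdist (primal u) y).
Proof.
apply: continuous_sumr => i u.
apply: (@continuous_comp _ _ _ (fun u => primal u i - y i) (fun v => enorm v)).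
  apply: (@cvgB _ _ _ (nbhs u)); last exact: cvg_cst.
  exact: (@primal_continuous _ _ _ _ _ _ _ G).
exact: enorm_continuous.
Qed.

(** The gap is not known to be continuous, so no minimum is taken: the local bounds of
    [gap_lbound_near] are made uniform by compactness of the profiles at distance at least [e]. *)
Lemma gap_lbound (e : R) : 0 < e -> exists2 c, 0 < c &
  forall y, strats G y -> e <= pdist y xs -> c <= gap y xs.
Proof.
move=> e0.
(* With a multiplier box of size 0, [boxed] is a copy of the product of the strategy sets, and
   [boxed_compact] applies. *)
pose K := boxed (G := G) 0 `&` [set u | e <= pdist (primal u) xs].
have cK : compact K.
  apply: compact_closedI; first exact: boxed_compact.
  exact: (closed_preimage (@pdist_continuous xs) (@closed_ge _ e)).
have : \forall c \near (0 : R)^'+, K `<=` [set u | c <= gap (primal u) xs \/ ~ boxed (G := G) 0 u].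
  apply: (compact_near_coveringP _).1 cK _ _ _ _ _ => u [[hu _] ud].
  have ne : primal u <> xs.
    move=> E; move: ud; rewrite /= E /pdist big1 => [|i _]; last by rewrite subrr enorm0.
    by rewrite leNgt e0.
  have [c c0 [r r0 hr]] := gap_lbound_near hN hgame hmono hB hu hxs ne.
  have nu : \forall v \near u, pdist (primal v) (primal u) < r.
    apply: (@cvgr_lt _ _ (nbhs u) _ _ _ (@pdist_continuous (primal u) u)).
    by rewrite /pdist big1 // => i _; rewrite subrr enorm0.
  exists ([set v | pdist (primal v) (primal u) < r], [set b | b <= c]).
    by split => //=; exact: nbhs_right_le.
  move=> [v b] [/= hv hb]; have [[hs bv]|nb] := pselect (boxed (G := G) 0 v); last by right.
  by left; apply: (le_trans hb); apply: hr => //; exact: ltW.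
move=> hnear; have [c [c0 hc]] : exists c : R, 0 < c /\
    K `<=` [set u | c <= gap (primal u) xs \/ ~ boxed (G := G) 0 u].
  have : \forall c \near (0 : R)^'+, 0 < c /\
      K `<=` [set u | c <= gap (primal u) xs \/ ~ boxed (G := G) 0 u].
    by apply: filterI => //; exact: nbhs_right_gt.
  by move/filter_ex => [c hc]; exists c.
exists c => // y hy hd.
have b0 : box 0 (0 : 'rV[R]_m) by move=> k; rewrite mxE lexx.
have [u bu [eu _]] := boxed_pair hy b0.
have /hc[] : K u by split => //=; rewrite eu.
  by rewrite eu.
by move/(_ bu).
Qed.

Lemma stack_dist_le (x y : profile G) : `|stack G x - stack G y| <= pdist x y.
Proof.
rewrite /stack -mxrowB [`|_|]mx_normrE; apply: bigmax_le => [|[i j] _ /=].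
  exact: pdist_ge0.
rewrite ord1 mxE /pdist (bigD1 (tagnat.sig1 j)) //=.
rewrite (le_trans (coord_le_enorm _ _)) // lerDl.
by apply: sumr_ge0 => l _; exact: enorm_ge0.
Qed.

Variables (x : nat -> profile G) (a : nat -> R) (C sa2 D L : R).
Hypotheses (hx : forall t, strats G (x t)) (a0 : forall t, 0 < a t) (C0 : 0 <= C)
  (hC : forall t i, enorm (x t.+1 i - x t i) <= a t * C)
  (ha2 : forall T, \sum_(t < T) a t ^+ 2 <= sa2)
  (hinf : forall M, exists T, M <= \sum_(t < T) a t)
  (hL : forall y, strats G y -> pdist y xs <= L)
  (hD : forall T, \sum_(t < T) a t * gap (x t) xs <= D).

(** Near [xs] the gap need not control the distance linearly. It controls the excess of the distance
    over [e / 2]: where this is positive the gap is at least [c], so the excess is at most [L / c]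
    times the gap and [vanishing_of_summable] applies to it. *)
Lemma path_converges : (fun t => stack G (x t)) @ \oo --> stack G xs.
Proof.
apply/(@cvgrPdist_le _ _ _ \oo) => e e0.
have e2 : 0 < e / 2 by rewrite divr_gt0.
have [c c0 hc] := gap_lbound e2.
pose u t := Num.max 0 (pdist (x t) xs - e / 2).
have dS t : `|pdist (x t.+1) xs - pdist (x t) xs| <= N%:R * C * a t.
  rewrite /pdist -sumrB (le_trans (ler_norm_sum _ _ _)) //.
  rewrite -mulrA mulr_natl -[X in _ *+ X]card_ord -sumr_const.
  apply: ler_sum => i _; rewrite mulrC; apply: le_trans (hC t i).
  rewrite ler_norml; apply/andP; split.
    rewrite lerNl opprB lerBlDr -[x t i - xs i](subrKA (x t.+1 i)).
    by rewrite (enormBC (x t.+1 i)) enormD.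
  by rewrite lerBlDr -[X in enorm X <= _](subrKA (x t i)) enormD.
have hu : u @ \oo --> (0 : R).
  apply: (@vanishing_of_summable _ u a (N%:R * C) sa2 (L / c * D)) => //.
  - by rewrite mulr_ge0.
  - by move=> t; rewrite le_max lexx.
  - move=> t; apply: le_trans (dS t); rewrite /u.
    set p := pdist _ _; set q := pdist _ _.
    have [h1|h1] := leP 0 (p - e / 2); have [h2|h2] := leP 0 (q - e / 2).
    + by rewrite opprB addrA subrK.
    + by rewrite subr0 ger0_norm // (le_trans _ (ler_norm _)) // lerD2l lerN2; lra.
    + rewrite sub0r normrN ger0_norm // distrC (le_trans _ (ler_norm _)) // lerD2l lerN2; lra.
    + by rewrite subrr normr0 normr_ge0.
  - move=> T; have L0 : 0 <= L by exact: le_trans (pdist_ge0 _ _) (hL hxs).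
    have Lc : 0 <= L / c by rewrite divr_ge0 // ltW.
    apply: (le_trans _ (ler_wpM2l Lc (hD T))); rewrite mulr_sumr.
    apply: ler_sum => t _; rewrite mulrCA ler_wpM2l ?(ltW (a0 t)) //.
    have g0 := gap_ge0 hmono (hx t) hxs.
    rewrite /u ge_max mulr_ge0 //=.
    have [h|h] := leP (e / 2) (pdist (x t) xs); last first.
      by apply: (@le_trans _ _ 0); [rewrite subr_le0 ltW|rewrite mulr_ge0].
    have h1 := hc _ (hx t) h; rewrite (@le_trans _ _ L) //.
      by rewrite lerBlDr ler_wpDr ?(ltW e2) // hL.
    by rewrite mulrAC ler_pdivlMr // ler_wpM2l.
have /cvgrPdist_lt/(_ _ e2) := hu; apply: filterS => t.
rewrite sub0r normrN ger0_norm ?le_max ?lexx // gt_max => /andP[_ h].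
rewrite -[X in X <= _]normrN opprB (le_trans (stack_dist_le _ _)) //; lra.
Qed.

End PathConvergence.

(** * Conditional expectations *)

Lemma sigma_algebra_setT {T : Type} (F : set (set T)) :
  sigma_algebra setT F -> F setT.
Proof. by move=> [F0 FC _]; rewrite -(setD0 [set: T]); exact: FC. Qed.

Section Integrals.
Context {R : realType} {d : measure_display} {T : measurableType d}
  {P : probability T R}.

(** The sum is the integer part of [y]. *)
Lemma staircase (y : R) M : 0 <= y <= M%:R ->
  0 <= y - \sum_(l < M) (l.+1%:R <= y)%R%:R <= 1.
Proof.
elim: M => [|M IH] in y *.
  by rewrite big_ord0 subr0 => /andP[y0 y1]; rewrite y0 (le_trans y1).
move=> /andP[y0 y1]; rewrite big_ord_recr /=.
have [h|h] := leP M.+1%:R y.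
  rewrite (eq_bigr (fun _ => 1)) => [|l _]; last first.
    by rewrite (le_trans _ h) // ler_nat ltnS ltnW.
  rewrite sumr_const card_ord /= ?mulr1n ?mulr0n; move: y1 h; rewrite -natr1 => y1 h; apply/andP; split; lra.
have [h2|h2] := leP y M%:R; first by rewrite addr0; apply: IH; rewrite y0.
rewrite (eq_bigr (fun _ => 1)) => [|l _]; last first.
  by rewrite (le_trans _ (ltW h2)) // ler_nat.
rewrite sumr_const card_ord /= ?mulr1n ?mulr0n; move: h h2; rewrite -natr1 => h h2; apply/andP; split; lra.
Qed.

Lemma mean_ge0_ae (f : T -> R) : P.-integrable setT (EFin \o f) ->
  {ae P, forall w, 0 <= f w} -> 0 <= \int[P]_w f w.
Proof.
move=> /integrableP[mf _] f0.
have e : (\int[P]_w (f w)%:E = \int[P]_w `|f w|%:E)%E.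
  apply: ae_eq_integral => //.
    apply/measurable_EFinP; apply: measurableT_comp => //.
    exact/measurable_EFinP.
  by apply: filterS f0 => w f0 _ /=; rewrite ger0_norm.
rewrite /Rintegral e.
by apply: fine_ge0; apply: integral_ge0 => w _ /=; rewrite lee_fin.
Qed.

Lemma norm_mean_le_ae (f : T -> R) S : P.-integrable setT (EFin \o f) ->
  {ae P, forall w, `|f w| <= S} -> `|\int[P]_w f w| <= S.
Proof.
move=> intf fS.
have ic : P.-integrable setT (EFin \o (fun _ : T => S)).
  exact: finite_measure_integrable_cst.
have ES : \int[P]_w (fun _ : T => S) w = S.
  by rewrite Rintegral_cst // [fine _](congr1 fine (probability_setT P)) mulr1.
have h1 : 0 <= \int[P]_w (f w + S).
  apply: mean_ge0_ae; first exact: (integrableD _ intf ic).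
  by apply: filterS fS => w; rewrite ler_norml => /andP[h _]; lra.
have h2 : 0 <= \int[P]_w (S - f w).
  apply: mean_ge0_ae; first exact: (integrableB _ ic intf).
  by apply: filterS fS => w; rewrite ler_norml => /andP[_ h]; lra.
rewrite RintegralD // ES in h1; rewrite RintegralB // ES in h2.
by rewrite ler_norml -sub0r lerBlDr h1 -subr_ge0.
Qed.

Lemma integrable_sumR (I : Type) (r : seq I) (f : I -> T -> R) :
  (forall i, P.-integrable setT (EFin \o f i)) ->
  P.-integrable setT (EFin \o (fun w => \sum_(i <- r) f i w)).
Proof.
move=> intf; rewrite (_ : _ \o _ = (fun w => \sum_(i <- r) (f i w)%:E)%E).
  by apply: integrable_sum => // i _; exact: intf.
by apply/funext => w /=; rewrite sumEFin.
Qed.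

Lemma integrableZR (k : R) (f : T -> R) : P.-integrable setT (EFin \o f) ->
  P.-integrable setT (EFin \o (fun w => k * f w)).
Proof. by move=> intf; exact: (integrableZl measurableT k intf). Qed.

Lemma Rintegral_sumR (I : Type) (r : seq I) (f : I -> T -> R) :
  (forall i, P.-integrable setT (EFin \o f i)) ->
  \int[P]_w (\sum_(i <- r) f i w) = \sum_(i <- r) \int[P]_w f i w.
Proof.
move=> intf; elim: r => [|i r IH].
  rewrite big_nil; under eq_Rintegral do rewrite big_nil.
  by rewrite Rintegral_cst // mul0r.
rewrite big_cons -IH -RintegralD //; last exact: integrable_sumR.
by under eq_Rintegral do rewrite big_cons.
Qed.

Variable F : set (set T).
Hypotheses (Fm : F `<=` measurable) (Fsigma : sigma_algebra setT F).

Lemma measurable_wrt_sub (U : topologicalType) (Y : T -> U) :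
  measurable_wrt F Y -> measurable_wrt measurable Y.
Proof. by move=> mY B bB; apply: Fm; exact: mY. Qed.

Lemma measurable_wrt_ge (H : T -> R) c : measurable_wrt F H ->
  F [set w | c <= H w].
Proof.
move=> mH; rewrite (_ : [set _ | _] = setT `\` [set w | H w < c]).
  have [_ FC _] := Fsigma; apply: FC.
  apply: (mH [set r : R | r < c]).
  by apply: sub_sigma_algebra; exact: open_lt.
by rewrite setTD; apply/seteqP; split => w /=; rewrite leNgt => /negP.
Qed.

(* Approximate H uniformly by staircase functions with steps in F. *)
Lemma integral_mul_eq0 (D H : T -> R) c :
  P.-integrable setT (EFin \o D) ->
  (forall A, F A -> \int[P]_(w in A) D w = 0) ->
  measurable_wrt F H -> (forall w, `|H w| <= c) ->
  P.-integrable setT (EFin \o (fun w => D w * H w)) /\ \int[P]_w (D w * H w) = 0.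
Proof.
move=> intD hD mH Hc.
have mult (h : T -> R) b : measurable_fun setT h -> (forall w, `|h w| <= b) ->
    P.-integrable setT (EFin \o (fun w => D w * h w)).
  move=> mh hb; apply: (integrableMl _ intD mh) => //.
  by exists b; split; [exact: num_real|move=> M bM w _ /=; exact: le_trans (hb w) (ltW bM)].
have mH' : measurable_fun setT H.
  by apply/measurable_wrt_funP; exact: measurable_wrt_sub.
have intDH := mult _ _ mH' Hc.
split=> //; apply/eqP; rewrite -normr_le0.
have i0 : 0 <= \int[P]_w `|D w| by apply: Rintegral_ge0.
have c0 : 0 <= c.
  have [[w _]|nT] := pselect ([set: T] !=set0); first exact: le_trans (Hc w).
  have : P [set: T] = 0%E.
    by rewrite (_ : [set: T] = set0) ?measure0 //; apply/seteqP; split=> w // _; apply: nT; exists w.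
  by rewrite probability_setT => /eqP; rewrite eqe oner_eq0.
apply/ler_addgt0Pr => e e0; rewrite add0r.
(* With steps of height [1 / q.+1] the staircase error contributes less than [e]. *)
have [q] : exists q : nat, (\int[P]_w `|D w|) / e < q.+1%:R.
  exists (Num.truncn ((\int[P]_w `|D w|) / e)).
  exact: truncnS_gt.
rewrite ltr_pdivrMr // => hq.
set s : R := q.+1%:R in hq; have s0 : 0 < s by rewrite ltr0n.
pose M := (Num.truncn (2 * c * s)).+1.
have hy w : 0 <= (H w + c) * s <= M%:R.
  have := Hc w; rewrite ler_norml => /andP[h1 h2].
  rewrite mulr_ge0 ?(ltW s0) //=; last by lra.
  rewrite (le_trans _ (ltW (truncnS_gt _))) // ler_wpM2r ?(ltW s0) //; lra.
pose A l := [set w | l.+1%:R <= (H w + c) * s].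
have FA l : F (A l).
  rewrite (_ : A l = [set w | l.+1%:R / s - c <= H w]); first exact: measurable_wrt_ge.
  by apply/seteqP; split => w /=; rewrite lerBlDr ler_pdivrMr.
pose S w := \sum_(l < M) \1_(A l) w : R.
have hS w : 0 <= (H w + c) * s - S w <= 1.
  have := staircase (hy w); rewrite /S.
  rewrite (eq_bigr (fun l : 'I_M => \1_(A l) w)) // => l _.
  rewrite indicE; congr (_%:R); congr nat_of_bool.
  by apply/idP/idP; rewrite inE.
have intA l : P.-integrable setT (EFin \o (fun w => D w * \1_(A l) w)).
  apply: (mult _ 1); first by apply: measurable_indic; exact: Fm.
  by move=> w; rewrite indicE normr_nat; case: (_ \in _).
have zA l : \int[P]_w (D w * \1_(A l) w) = 0.
  rewrite -[RHS](hD _ (FA l)) [RHS]Rintegral_mkcond.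
  apply: eq_Rintegral => w _; rewrite indicE patchE.
  by case: ifPn => _; rewrite ?mulr1 ?mulr0.
have intE : P.-integrable setT (EFin \o (fun w => D w * ((H w + c) * s - S w))).
  apply: (mult _ 1).
    apply: measurable_funB.
      by apply: measurable_funM => //; exact: measurable_funD.
    by apply: measurable_sum => l; apply: measurable_indic; exact: Fm.
  by move=> w; have /andP[h1 h2] := hS w; rewrite ger0_norm.
(* [H] splits into the staircase remainder, the staircase and a constant; the last two are
   combinations of indicators of sets in [F], against which [D] integrates to 0. *)
have DHE : \int[P]_w (D w * H w) = s^-1 * \int[P]_w (D w * ((H w + c) * s - S w)).
  have e1 w : D w * H w = s^-1 * (D w * ((H w + c) * s - S w)) +
      (s^-1 * \sum_(l < M) (D w * \1_(A l) w) + - c * D w).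
    by rewrite -mulr_sumr -/(S w); field; rewrite gt_eqF.
  rewrite (_ : (fun w => D w * H w) = (fun w =>
      s^-1 * (D w * ((H w + c) * s - S w)) +
      (s^-1 * \sum_(l < M) (D w * \1_(A l) w) + - c * D w))); last exact/funext.
  have i2 : P.-integrable setT (EFin \o (fun w => \sum_(l < M) (D w * \1_(A l) w))).
    exact: integrable_sumR.
  rewrite RintegralD //; last 2 first.
  - exact: integrableZR.
  - by apply: (integrableD _ (integrableZR _ i2) (integrableZR _ intD)).
  rewrite RintegralZl // RintegralD //; try exact: integrableZR.
  rewrite !RintegralZl // Rintegral_sumR // big1 // mulr0.
  rewrite hD ?mulr0 ?addr0 //.
  exact: sigma_algebra_setT.
rewrite DHE normrM gtr0_norm ?invr_gt0 // mulrC ler_pdivrMr //.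
apply: (le_trans (le_normr_Rintegral _ intE)) => //.
rewrite mulrC (le_trans _ (ltW hq)) //; apply: le_Rintegral => //.
- exact: (integrable_norm intE).
- exact: (integrable_norm intD).
move=> w _; rewrite normrM ler_piMr //; have /andP[h1 h2] := hS w.
by rewrite ger0_norm.
Qed.

End Integrals.

Lemma cond_exp_mul_eq0 {R : realType} {d : measure_display} {T : measurableType d}
    {P : probability T R} (F : set (set T)) (Y Z H : T -> R) c :
  F `<=` measurable -> sigma_algebra setT F -> is_cond_exp P F Y Z ->
  measurable_wrt F H -> (forall w, `|H w| <= c) ->
  P.-integrable setT (EFin \o (fun w => (Y w - Z w) * H w)) /\
  \int[P]_w ((Y w - Z w) * H w) = 0.
Proof.
move=> Fm Fs [iY iZ _ YZ] mH Hc.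
apply: (integral_mul_eq0 Fm Fs _ _ mH Hc) => [|A FA].
  exact: (integrableB _ iY iZ).
have mA := Fm _ FA.
rewrite RintegralB //; last 2 first.
- exact: (integrableS measurableT mA (@subsetT _ _) iY).
- exact: (integrableS measurableT mA (@subsetT _ _) iZ).
by rewrite /Rintegral YZ // subrr.
Qed.

(** As [C] is the same on almost every path, integration removes [e] and bounds the mean of every
    partial sum of [f]. The series of nonnegative terms is then integrable by monotone convergence,
    hence finite almost everywhere. *)
Lemma ae_bounded_sums {R : realType} {d : measure_display} {T : measurableType d}
    {P : probability T R} (f e : nat -> T -> R) C :
  (forall t w, 0 <= f t w) -> (forall t, P.-integrable setT (EFin \o f t)) ->
  (forall t, P.-integrable setT (EFin \o e t)) ->
  (forall t, \int[P]_w e t w = 0) ->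
  {ae P, forall w, forall n, \sum_(t < n) (f t w + e t w) <= C} ->
  {ae P, forall w, exists D, forall n, \sum_(t < n) f t w <= D}.
Proof.
move=> f0 intf inte e0 hC.
have sumf n : \sum_(t < n) \int[P]_w f t w <= C.
  rewrite -Rintegral_sumR //.
  have int1 : P.-integrable setT (EFin \o (fun w => \sum_(t < n) f t w)).
    exact: (integrable_sumR (index_enum 'I_n) (fun t : 'I_n => intf t)).
  have int2 : P.-integrable setT (EFin \o (fun w => \sum_(t < n) e t w)).
    exact: (integrable_sumR (index_enum 'I_n) (fun t : 'I_n => inte t)).
  have intc : P.-integrable setT (EFin \o (fun _ => C)).
    exact: finite_measure_integrable_cst.
  have int3 : P.-integrable setT
     (EFin \o (fun w => \sum_(t < n) f t w + \sum_(t < n) e t w)).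
    exact: (integrableD _ int1 int2).
  rewrite -subr_ge0 (_ : _ - _ =
      \int[P]_w (C - (\sum_(t < n) f t w + \sum_(t < n) e t w))).
    apply: mean_ge0_ae; first exact: (integrableB _ intc int3).
    apply: filterS hC => w /(_ n); rewrite -big_split subr_ge0.
    exact.
  rewrite RintegralB // RintegralD // (Rintegral_sumR _ (f := fun t : 'I_n => e t)) //.
  rewrite Rintegral_cst // [fine _](congr1 fine (probability_setT P)) mulr1 [X in _ - (_ + X)]big1 ?addr0 //.
have mf t : measurable_fun setT (EFin \o f t) by case/integrableP : (intf t).
have nn t w : (0 <= (EFin \o f t) w)%E by rewrite /= lee_fin.
pose g w := (\sum_(0 <= t <oo) (f t w)%:E)%E.
have ig : P.-integrable setT g.
  apply/integrableP; split.
    exact: (ge0_emeasurable_sum (P := xpredT) (fun t w _ _ => nn t w) (fun t _ => mf t)).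
  rewrite (_ : (fun w => `|g w|%E) = g); last first.
    by apply/funext => w; rewrite gee0_abs // nneseries_ge0 // => t _ _; exact: nn.
  rewrite /g (integral_nneseries P measurableT mf (fun t w _ => nn t w)).
  apply: (@le_lt_trans _ _ C%:E); last exact: ltry.
  apply: lime_le; first by apply: is_cvg_nneseries => t _ _; exact: integral_ge0.
  apply: nearW => n; rewrite big_mkord.
  rewrite (eq_bigr (fun t : 'I_n => (\int[P]_w f t w)%:E)) => [|t _].
    by rewrite sumEFin lee_fin; exact: sumf.
  exact: esym (fineK (integrable_fin_num measurableT (intf t))).
have := integrable_ae measurableT ig; apply: filterS => w /(_ I) gw.
exists (fine (g w)) => n; rewrite -lee_fin fineK // -sumEFin.
by rewrite -(big_mkord xpredT (fun t => (f t w)%:E)); apply: nneseries_lim_ge => t _ _; exact: nn.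
Qed.

(** * The noise of the oracle *)

Section Noise.
Context {R : realType} {d : measure_display} {Omega : measurableType d}
  {P : probability Omega R} {N n m : nat} (G : aggGame P N n m).
Variables (xi : samples G) (W : nat -> 'M[R]_N) (alpha beta : nat -> R)
  (x0 : profile G).
Hypotheses (hwp : well_posed G) (hsamp : is_sampling G xi)
  (hgame : game_assumption G) (hunbiased : oracle_unbiased G xi)
  (hbounded : oracle_bounded G xi) (hx0 : strats G x0).

Definition traj (w : Omega) (t : nat) : state G :=
  run G W alpha beta alpha x0 xi t w.
Definition traj_noise (w : Omega) (t : nat) : forall i, 'rV[R]_(ndim G i) :=
  fun i => xi t i w.

Let traj_st0 w : traj w 0%N = init G x0. Proof. by []. Qed.
Let traj_stS w t : traj w t.+1 =
  step G (W t) (alpha t) (beta t) (alpha t) (traj_noise w t) (traj w t).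
Proof. by []. Qed.

Lemma traj_strats w t : strats G (st_x G (traj w t)).
Proof. exact: (st_x_strats hgame hx0 (traj_st0 w) (traj_stS w)). Qed.

Lemma filtration_measurable t : filtration G xi t `<=` measurable.
Proof.
apply: smallest_sub; first exact: sigma_algebra_measurable.
by move=> _ [s [i [B [_ bB ->]]]]; exact: (hsamp s i).1.
Qed.

Lemma filtration_sigma t : sigma_algebra setT (filtration G xi t).
Proof. exact: smallest_sigma_algebra. Qed.

Lemma filtration_mono t : filtration G xi t `<=` filtration G xi t.+1.
Proof.
apply: smallest_sub; first exact: filtration_sigma.
move=> A [s [i [B [st bB AE]]]]; apply: sub_sigma_algebra.
by exists s, i, B; split=> //; exact: ltnW.
Qed.

Lemma sample_measurable t i : measurable_wrt (filtration G xi t.+1) (xi t i).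
Proof. by move=> B bB; apply: sub_sigma_algebra; exists t, i, B. Qed.

(** [Omega] with the history before time [t] as its sigma-algebra: lemmas about a measurable type
    become statements about [filtration]. *)
Let hist (t : nat) := g_sigma_algebraType
  [set A | exists s i B, [/\ (s < t)%N, borel B & A = xi s i @^-1` B]].

Let hist_coord t k (X : Omega -> 'rV[R]_k) :
  measurable_wrt (filtration G xi t) X -> coord_measurable (X : hist t -> _).
Proof. by move=> mX; apply: coord_measurable_wrt => B bB; exact: mX. Qed.

Let coord_hist t k (X : Omega -> 'rV[R]_k) :
  coord_measurable (X : hist t -> _) -> measurable_wrt (filtration G xi t) X.
Proof. by move=> mX B bB; exact: (measurable_wrt_row mX bB). Qed.

Let wrt_next t k (X : Omega -> 'rV[R]_k) : measurable_wrt (filtration G xi t) X ->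
  measurable_wrt (filtration G xi t.+1) X.
Proof. by move=> mX B bB; apply: filtration_mono; exact: mX. Qed.

(** The step from [t] to [t.+1] consumes the samples drawn at time [t], which [filtration] contains
    from [t.+1] on. *)
Lemma traj_measurable t i :
  [/\ measurable_wrt (filtration G xi t) (fun w => st_x G (traj w t) i),
      measurable_wrt (filtration G xi t) (fun w => st_mu G (traj w t) i) &
      measurable_wrt (filtration G xi t) (fun w => st_sigma G (traj w t) i)].
Proof.
elim: t i => [|t IH] i.
  by split; exact: (measurable_wrt_cst (T := hist 0)).
have mx j : coord_measurable ((fun w => st_x G (traj w t) j) : hist t.+1 -> _).
  by have [h _ _] := IH j; exact: hist_coord (wrt_next h).
have mm j : coord_measurable ((fun w => st_mu G (traj w t) j) : hist t.+1 -> _).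
  by have [_ h _] := IH j; exact: hist_coord (wrt_next h).
have ms j : coord_measurable ((fun w => st_sigma G (traj w t) j) : hist t.+1 -> _).
  by have [_ _ h] := IH j; exact: hist_coord (wrt_next h).
have hz w := st_zE (traj_st0 w) (traj_stS w) t.
have hs w := traj_strats w t.
have mV j : measurable_wrt (@measurable _ (hist t.+1)) (fun w => traj_noise w t j).
  exact: sample_measurable.
split; apply: coord_hist.
- exact: (step_x_measurable hgame hwp (T := hist t.+1) (W t) (alpha t) (beta t) (alpha t) hz hs mx mm ms mV).
- exact: (step_mu_measurable hgame (T := hist t.+1) (W t) (alpha t) (beta t)
    (alpha t) (traj_noise^~ t) hs mx mm).
- apply: (step_sigma_measurable (T := hist t.+1) (W := W t) (a := alpha t) (b := beta t)
    (c := alpha t) hgame hwp hz hs mx mm ms mV).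
  by move=> w; exact: (traj_strats w t.+1).
Qed.

Lemma sigma_est_measurable t i :
  measurable_wrt (filtration G xi t) (fun w => sigma_est W (traj w) t i).
Proof.
apply: coord_hist; apply: coord_measurableZ.
apply: (mix_measurable (T := hist t)) => j.
by have [_ _ h] := traj_measurable t j; exact: hist_coord h.
Qed.

Lemma sigma_measurable t :
  measurable_wrt (filtration G xi t) (fun w => sigma G (st_x G (traj w t))).
Proof.
apply: coord_hist; apply: coord_measurableZ.
apply: (coord_measurable_sum (T := hist t)) => j.
apply: (agg_measurable hgame (T := hist t)) => [|w]; last exact: traj_strats.
by have [h _ _] := traj_measurable t j; exact: hist_coord h.
Qed.

Lemma sigma_est_point t i :
  oracle_point G xi t i (fun w => st_x G (traj w t) i)
    (fun w => sigma_est W (traj w) t i).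
Proof.
split=> [|w|]; [by have [] := traj_measurable t i|exact: traj_strats|].
exact: sigma_est_measurable.
Qed.

(** Not a point queried by the algorithm. Unbiasedness there provides the integrability of the
    pseudo-gradient at the true aggregate, hence of the gap. *)
Lemma sigma_point t i :
  oracle_point G xi t i (fun w => st_x G (traj w t) i)
    (fun w => sigma G (st_x G (traj w t))).
Proof.
split=> [|w|]; [by have [] := traj_measurable t i|exact: traj_strats|].
exact: sigma_measurable.
Qed.

Lemma qsample_bounded : exists2 S, 0 < S & {ae P, forall w, forall t i,
  enorm (qsample W (traj_noise w) (traj w) t i) <= S}.
Proof.
have [S S0 hS] := hbounded; exists S => //.
apply: ae_foralln => t; apply: filter_forall => i.
exact: (hS t i _ _ (sigma_est_point t i)).
Qed.

(** The oracle is queried at time 0 at a constant point, measurable for the trivial sigma-algebra: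
    each coordinate of the gradient is the mean of samples bounded by [S]. The total dimension makes
    the bound common to all players. *)
Lemma pgrad_bounded : exists2 B, 0 < B &
  forall i a y, strat G i a -> enorm (pgrad G i a y) <= B.
Proof.
have [S S0 hS] := hbounded; exists ((\sum_i Defs.dim G i)%:R * S + 1).
  by rewrite ltr_pwDr // mulr_ge0 // ltW.
move=> i a y sa.
have pt : oracle_point G xi 0 i (fun _ => a) (fun _ => y).
  by split=> // B bB; exact: (measurable_wrt_cst (T := hist 0)).
have hk k : `|pgrad G i a y 0 k| <= S.
  have [iq ip _ qp] := hunbiased pt k.
  have hb : {ae P, forall w, `|qgrad G i a y (xi 0%N i w) 0 k| <= S}.
    apply: filterS (hS _ _ _ _ pt) => w; exact: le_trans (coord_le_enorm _ _).
  have E : \int[P]_w qgrad G i a y (xi 0%N i w) 0 k = pgrad G i a y 0 k.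
    rewrite /Rintegral qp; last exact: (sigma_algebra_setT (filtration_sigma 0)).
    rewrite -[RHS]mulr1 -[X in _ * X](congr1 fine (probability_setT P)).
    by rewrite -(Rintegral_cst P _ _).
  by rewrite -E; exact: (norm_mean_le_ae iq hb).
rewrite (le_trans (enorm_le_l1 _)) //.
rewrite (@le_trans _ _ (\sum_(k < Defs.dim G i) S)) ?ler_sum //.
rewrite sumr_const card_ord -[S *+ _]mulr_natl; apply: ler_wpDr => //.
apply: ler_wpM2r; first exact: ltW.
by rewrite ler_nat (bigD1 i) //= leq_addr.
Qed.

Variable y : profile G.
Hypothesis hy : strats G y.

Lemma deviation_measurable t i k :
  measurable_wrt (filtration G xi t) (fun w => (st_x G (traj w t) i - y i) 0 k).
Proof.
have mc : coord_measurable ((fun w => st_x G (traj w t) i - y i) : hist t -> _).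
  apply: coord_measurableB => [|j]; last exact: measurable_cst.
  by have [h _ _] := traj_measurable t i; exact: hist_coord h.
by move=> B bB; exact: ((measurable_wrt_funP _).2 (mc k) B bB).
Qed.

Lemma deviation_bounded : exists c, forall t i k w,
  `|(st_x G (traj w t) i - y i) 0 k| <= c.
Proof.
have [_ _ _ _ [_ _ [L [M [L0 _ hL]]]]] := hgame; exists (L + L) => t i k w.
rewrite (le_trans (coord_le_enorm _ _)) // (le_trans (enormB _ _)) // lerD //.
  by have [] := hL i _ (traj_strats w t i).
by have [] := hL i _ (hy i).
Qed.

(** Coordinatewise, the deviation of [x_t] from [y] is bounded and measurable for [filtration] at
    time [t], so [cond_exp_mul_eq0] applies. *)
Lemma noise_term_mean0 t :
  P.-integrable setT (EFin \o
    (fun w => noise_term W (traj_noise w) (traj w) y t)) /\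
  \int[P]_w noise_term W (traj_noise w) (traj w) y t = 0.
Proof.
have [c hc] := deviation_bounded.
have h i (k : 'I_(Defs.dim G i)) := cond_exp_mul_eq0 (@filtration_measurable t) (filtration_sigma t)
  (hunbiased (sigma_est_point t i) k) (@deviation_measurable t i k)
  (hc t i k).
rewrite (_ : (fun w => _) = fun w => \sum_i \sum_k
    ((qgrad G i (st_x G (traj w t) i) (sigma_est W (traj w) t i) (xi t i w) 0 k -
      pgrad G i (st_x G (traj w t) i) (sigma_est W (traj w) t i) 0 k) *
     (st_x G (traj w t) i - y i) 0 k)); last first.
  apply/funext => w; apply: eq_bigr => i _; rewrite /dot; apply: eq_bigr => k _.
  by congr (_ * _); exact: rowBE.
have h1 i : P.-integrable setT (EFin \o (fun w => \sum_k
    ((qgrad G i (st_x G (traj w t) i) (sigma_est W (traj w) t i) (xi t i w) 0 k -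
      pgrad G i (st_x G (traj w t) i) (sigma_est W (traj w) t i) 0 k) *
     (st_x G (traj w t) i - y i) 0 k))).
  by apply: integrable_sumR => k; exact: (h i k).1.
split; first exact: integrable_sumR.
rewrite Rintegral_sumR // big1 // => i _; rewrite Rintegral_sumR; last first.
  by move=> k; exact: (h i k).1.
by rewrite big1 // => k _; exact: (h i k).2.
Qed.

Lemma gap_integrable t :
  P.-integrable setT (EFin \o (fun w => gap (st_x G (traj w t)) y)).
Proof.
have [c hc] := deviation_bounded.
rewrite (_ : (fun w => _) = fun w => \sum_i \sum_k
    ((pgrad G i (st_x G (traj w t) i) (sigma G (st_x G (traj w t))) 0 k -
      pg y i 0 k) * (st_x G (traj w t) i - y i) 0 k)); last first.
  apply/funext => w; apply: eq_bigr => i _; rewrite /dot; apply: eq_bigr => k _.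
  by congr (_ * _); exact: rowBE.
apply: integrable_sumR => i; apply: integrable_sumR => k.
have [_ ip _ _] := hunbiased (sigma_point t i) k.
have ic : P.-integrable setT (EFin \o (fun _ : Omega => pg y i 0 k)).
  exact: finite_measure_integrable_cst.
have md : measurable_fun setT (fun w => (st_x G (traj w t) i - y i) 0 k).
  apply/measurable_wrt_funP; apply: measurable_wrt_sub (@deviation_measurable t i k).
  exact: filtration_measurable.
apply: (integrableMl measurableT (integrableB measurableT ip ic) md).
exists c; split; first exact: num_real.
by move=> M cM w _ /=; exact: le_trans (hc t i k w) (ltW cM).
Qed.

End Noise.

(** * The step-size series and almost sure convergence *)

Lemma sum_head_shift {R : realType} (u : nat -> R) T :
  \sum_(t < T.+1) u t = u 0%N + \sum_(1 <= t < T.+1) u t.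
Proof. by rewrite -(big_mkord xpredT u) big_ltn. Qed.

(** The series of the hypotheses start at index 1, the estimates along a path at 0; the first term
    is added by hand. *)
Lemma partial_sums_bounded {R : realType} (u : nat -> R) :
  (forall t, 0 <= u t) -> (\sum_(1 <= t <oo) (u t)%:E < +oo)%E ->
  exists s, forall T, \sum_(t < T) u t <= s.
Proof.
move=> u0 fin; have nn t : (1 <= t)%N -> true -> (0 <= (u t)%:E)%E.
  by rewrite lee_fin.
have s0 : (0 <= \sum_(1 <= t <oo) (u t)%:E)%E by apply: nneseries_ge0.
exists (u 0%N + fine (\sum_(1 <= t <oo) (u t)%:E)%E) => T.
apply: (@le_trans _ _ (\sum_(t < T.+1) u t)).
  by rewrite big_ord_recr /= lerDl.
rewrite sum_head_shift lerD2l -lee_fin -sumEFin fineK; last first.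
  by rewrite ge0_fin_numE.
exact: nneseries_lim_ge.
Qed.

Lemma partial_sums_unbounded {R : realType} (u : nat -> R) :
  (forall t, 0 <= u t) -> (\sum_(1 <= t <oo) (u t)%:E = +oo)%E ->
  forall M, exists T, M <= \sum_(t < T) u t.
Proof.
move=> u0 oo M; apply: contrapT => /forallNP h.
have : (\sum_(1 <= t <oo) (u t)%:E <= M%:E)%E; last by rewrite oo leNgt ltry.
apply: lime_le; first by apply: is_cvg_nneseries => t _ _; rewrite lee_fin.
near=> T; rewrite sumEFin lee_fin.
have -> : T = T.-1.+1 by rewrite prednK //; near: T; exact: nbhs_infty_gt.
rewrite (@le_trans _ _ (\sum_(t < T.-1.+1) u t)) ?sum_head_shift ?lerDr //.
by rewrite -sum_head_shift ltW // ltNge; apply/negP; exact: h.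
Unshelve. all: by end_near. Qed.

Theorem theorem2 (R : realType) (d : measure_display) (Omega : measurableType d)
    (P : probability Omega R) (N n m : nat) (G : aggGame P N n m)
    (xi : samples G) (E : nat -> rel 'I_N) (W : nat -> 'M[R]_N)
    (alpha beta gamma : nat -> R) (x0 : profile G)
    (hN : (0 < N)%N)
    (hwp : well_posed G)
    (hsamp : is_sampling G xi)
    (hW : is_weighting E W)
    (hgraph : graph_assumption E W)
    (hgame : game_assumption G)
    (hlip : lipschitz_assumption G)
    (hunbiased : oracle_unbiased G xi)
    (hbounded : oracle_bounded G xi)
    (hmono : strictly_monotone G)
    (hx0 : strats G x0)
    (halpha : is_step_size alpha)
    (hbeta : is_step_size beta)
    (hgamma : is_step_size gamma)
    (halphagamma : forall t, alpha t = gamma t)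
    (hsum_a : (\sum_(1 <= t <oo) (alpha t)%:E = +oo)%E)
    (hsum_a2 : (\sum_(1 <= t <oo) (alpha t ^+ 2)%:E < +oo)%E)
    (hsum_a2b2 : (\sum_(1 <= t <oo) (alpha t ^+ 2 / beta t ^+ 2)%:E < +oo)%E)
    (hsum_ab : (\sum_(1 <= t <oo) (alpha t * beta t)%:E < +oo)%E)
    (hsum_a2b : (\sum_(1 <= t <oo) (alpha t ^+ 2 / beta t)%:E < +oo)%E) :
  exists xs : profile G,
    unique (is_vGNE G) xs /\
    {ae P, forall w,
      (fun t => stack G (st_x G (run G W alpha beta gamma x0 xi t w))) @ \oo
        --> stack G xs}.
Proof.
have <- : alpha = gamma by exact/funext.
have [xs [mus hxs]] := saddle_exists hN hgame hlip hmono.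
exists xs; split; first exact: vGNE_unique hxs.
have a0 t : 0 < alpha t by have /andP[] := halpha.1 t.
have b0 t : 0 < beta t by have /andP[] := hbeta.1 t.
have [sa2 ha2] : exists s, forall T, \sum_(t < T) alpha t ^+ 2 <= s.
  by apply: (partial_sums_bounded (u := fun t => alpha t ^+ 2)) => // t; exact: sqr_ge0.
have [sab hab] : exists s, forall T, \sum_(t < T) alpha t * beta t <= s.
  by apply: (partial_sums_bounded (u := fun t => alpha t * beta t)) => // t; rewrite mulr_ge0 // ltW.
have [sa2b ha2b] : exists s, forall T, \sum_(t < T) alpha t ^+ 2 / beta t <= s.
  apply: (partial_sums_bounded (u := fun t => alpha t ^+ 2 / beta t)) => // t.
  by rewrite divr_ge0 ?sqr_ge0 // ltW.
have [sa2b2 ha2b2] : exists s, forall T,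
    \sum_(t < T) alpha t ^+ 2 / beta t ^+ 2 <= s.
  apply: (partial_sums_bounded (u := fun t => alpha t ^+ 2 / beta t ^+ 2)) => // t.
  by rewrite divr_ge0 ?sqr_ge0.
have hinf := partial_sums_unbounded (fun t => ltW (a0 t)) hsum_a.
have [Lf Lf0 hLf] := hlip.
have [_ _ _ _ [_ [Ls Ls0 hLs] [L [M [L0 M0 hL]]]]] := hgame.
have [delta delta0 hdelta] := push_weights_lbound hN hW hgraph
  (z := push_weight W) erefl (fun _ => erefl).
have [K [_ hK]] := push_sum_consensus hN hW hgraph
  (z := push_weight W) erefl (fun _ => erefl).
have [ys [kappa [hys kappa0 hkappa]]] := slater_margin hgame.
have [B _ hB] := pgrad_bounded hunbiased hbounded.
have [S S0 hS] := qsample_bounded W alpha beta hwp hgame hbounded hx0.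
have hxs' := saddle_strats hxs.
pose st := traj xi W alpha beta x0 : Omega -> nat -> state G.
pose u := traj_noise xi.
pose e t w := alpha t * noise_term W (u w) (st w) xs t.
pose f t w := alpha t * gap (st_x G (st w t)) xs.
have hx w t : strats G (st_x G (st w t)).
  exact: (traj_strats xi W alpha beta hgame hx0 w t).
have noise0 t := noise_term_mean0 W alpha beta hwp hsamp hgame hunbiased hx0 hxs' t.
have gapi t := gap_integrable W alpha beta hwp hsamp hgame hunbiased hx0 hxs' t.
have key : {ae P, forall w, exists D, forall T, \sum_(t < T) f t w <= D}.
  (* [path_gap_sum] bounds twice the weighted sum of gap and noise, whence the division by 2. *)
  apply: (ae_bounded_sums (e := e)
    (C := (N%:R * (2 * L) ^+ 2 + N%:R * dot mus mus +
           lyap_err_bound x0 L M Ls Lf S delta K sa2 sab sa2b sa2b2 mus) / 2)).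
  - by move=> t w; rewrite mulr_ge0 ?(ltW (a0 t)) // gap_ge0.
  - by move=> t; exact: integrableZR (gapi t).
  - by move=> t; exact: integrableZR (noise0 t).1.
  - by move=> t; rewrite RintegralZl //; [rewrite (noise0 t).2 mulr0|exact: (noise0 t).1].
  apply: filterS hS => w hSw T; rewrite ler_pdivlMr // mulrC.
  have := path_gap_sum hN hgame hW hgraph hx0 halpha hbeta L0 M0 Ls0 Lf0 S0 delta0
    hL hLs hLf hdelta hK ha2 hab ha2b ha2b2 (st := st w) (u := u w) erefl
    (fun _ => erefl) hSw T hxs.
  apply: le_trans; apply: ler_wpM2l => //; apply: ler_sum => t _.
  by rewrite mulrDr.
apply: filterS2 hS key => w hSw [D hD].
(* The absolute value supplies the nonnegative constant that [path_converges] asks for. *)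
apply: (path_converges hN hgame hmono hxs' (B := B) _ (x := fun t => st_x G (st w t))
  (a := alpha) (C := `|cincr x0 L M Ls Lf S B delta K sa2 sab sa2b sa2b2 kappa|)
  (sa2 := sa2) (D := D) (L := N%:R * (2 * L))) => //.
- by move=> y i hy; exact: hB.
- move=> t i; apply: (@le_trans _ _ (alpha t *
    cincr x0 L M Ls Lf S B delta K sa2 sab sa2b sa2b2 kappa)).
    exact: (x_incr_bound hN hgame hW hgraph hx0 halpha hbeta L0 M0 Ls0 Lf0 S0 delta0
      hL hLs hLf hB hdelta hK ha2 hab ha2b ha2b2 (st := st w) (u := u w) erefl
      (fun _ => erefl) hSw hys kappa0 hkappa).
  by rewrite ler_wpM2l ?(ltW (a0 t)) // ler_norm.
- move=> y hy; rewrite /pdist (@le_trans _ _ (\sum_(i < N) 2 * L)) //.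
    by apply: ler_sum => i _; exact: (strat_dist_le hL (hy i) (hxs' i)).
  by rewrite sumr_const card_ord -[_ *+ N]mulr_natl.
Qed.
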